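(* There exist constants $C>0$, $\epsilon_0>0$, $\delta_0>0$ such that the following holds for all $\epsilon\in(0,\epsilon_0)$, $\delta\in(0,\delta_0)$. Let $a,b\in\mathbb{R}$, $H(x,y)=ax+by$ on $\mathbb{R}^2$, and let $u$ be a solution for $H$ (in the sense of the context). With $$N_v=\Big\{(x,y):\ |x|<1+\tfrac{\epsilon}{2}-\sqrt{1-y^2},\ |y|<\tfrac{\sqrt3}{2}\Big\},$$ $$N_h=\Big\{(x,y):\ \big|y-1-\tfrac{\delta}{2}\big|<1+\tfrac{\delta}{2}-\sqrt{1-(x-1-\tfrac{\epsilon}{2})^2},\ \big|x-1-\tfrac{\epsilon}{2}\big|<\tfrac{\sqrt3}{2}\Big\},$$ $$S(x,y)=-2\sqrt{\delta}\,\frac{(x-1-\frac{\epsilon}{2})(y-1-\frac{\delta}{2})}{\big((x-1-\frac{\epsilon}{2})^2+\delta\big)^2},$$ we have $$\nabla u(x,y)=2b\Big(\frac{1}{\delta+(x-1-\frac{\epsilon}{2})^2}(0,1)+\frac{1}{\sqrt\delta}S(x,y)(1,0)\Big)+R_1(x,y)\quad\text{for all }(x,y)\in N_h,$$ and there is a constant $\mu_0$ with $\frac1C<\mu_0<C$ such that $$\nabla u(x,y)=a\,\mu_0\frac{\sqrt\epsilon}{\epsilon+y^2}(1,0)+R_2(x,y)\quad\text{for all }(x,y)\in N_v,$$ where $\|R_1\|_{L^\infty(N_h)}+\|R_2\|_{L^\infty(N_v)}\le C(|a|+|b|)$.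
   Context: Let $\epsilon,\delta>0$. For each integer $n$, $D_{Rn}$ is the open unit disk centered at $(1+\frac{\epsilon}{2},\,n(2+\delta))$ and $D_{Ln}$ is the open unit disk centered at $(-1-\frac{\epsilon}{2},\,n(2+\delta))$; let $\mathcal D=\bigcup_{n\in\mathbb Z}(D_{Ln}\cup D_{Rn})$. Let $\Omega=\mathbb{R}\times(-1-\frac{\delta}{2},1+\frac{\delta}{2})$. On disk boundaries, $\nu$ denotes the unit normal pointing into the disk. Given a harmonic $H$ on $\mathbb{R}^2$ with $\nabla H(x,y)=\nabla H(x,y+2+\delta)$, a solution for $H$ is a function $u$ harmonic in $\mathbb{R}^2\setminus\overline{\mathcal D}$ such that: $u$ is constant on $\partial D_{L0}$ and constant on $\partial D_{R0}$; $\int_{\partial D_{L0}}\partial_\nu u\,ds=\int_{\partial D_{R0}}\partial_\nu u\,ds=0$; $\int_{\Omega\setminus\overline{D_{L0}\cup D_{R0}}}|\nabla(u-H)|^2\,dx\,dy<\infty$; and $\nabla u(x,y)=\nabla u(x,y+2+\delta)$ for all $(x,y)\in\mathbb{R}^2\setminus\overline{\mathcal D}$. *)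

(* Defs.v *)
From HB Require Import structures.
From mathcomp Require Import all_boot all_order all_algebra.
From mathcomp Require Import all_classical all_reals all_analysis.
Set Implicit Arguments. Unset Strict Implicit. Unset Printing Implicit Defensive.
Import Order.TTheory GRing.Theory Num.Theory.
Import numFieldNormedType.Exports.
Local Open Scope classical_set_scope.
Local Open Scope ring_scope.

Section Defs.
Variable R : realType.
Implicit Types (u H : R * R -> R) (p c : R * R) (eps delta : R).

Definition dx u p : R := derive1 (fun t => u (t, p.2)) p.1.
Definition dy u p : R := derive1 (fun t => u (p.1, t)) p.2.

Definition harmonic_on (U : set (R * R)) u : Prop :=
  forall p, U p ->
    (derivable (fun t => u (t, p.2)) p.1 1 /\
     derivable (fun t => u (p.1, t)) p.2 1 /\
     derivable (fun t => dx u (t, p.2)) p.1 1 /\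
     derivable (fun t => dx u (p.1, t)) p.2 1 /\
     derivable (fun t => dy u (t, p.2)) p.1 1 /\
     derivable (fun t => dy u (p.1, t)) p.2 1) /\
    ({for p, continuous u} /\ {for p, continuous (dx u)} /\
     {for p, continuous (dy u)} /\
     {for p, continuous (dx (dx u))} /\ {for p, continuous (dy (dx u))} /\
     {for p, continuous (dx (dy u))} /\ {for p, continuous (dy (dy u))}) /\
    dx (dx u) p + dy (dy u) p = 0.

Definition cL eps delta (n : int) : R * R := (- 1 - eps / 2, n%:~R * (2 + delta)).
Definition cR eps delta (n : int) : R * R := (1 + eps / 2, n%:~R * (2 + delta)).

Definition sqdist p c : R := (p.1 - c.1) ^+ 2 + (p.2 - c.2) ^+ 2.

(** R^2 minus the closure of the union of all disks (the disks have pairwise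
    disjoint closures and form a locally finite family, so the closure of the
    union is the union of the closed disks) *)
Definition Ext eps delta : set (R * R) :=
  [set p | forall n : int, 1 < sqdist p (cL eps delta n) /\ 1 < sqdist p (cR eps delta n)].

Definition Cell eps delta : set (R * R) :=
  [set p | `|p.2| < 1 + delta / 2 /\ 1 < sqdist p (cL eps delta 0) /\
           1 < sqdist p (cR eps delta 0)].

(** flux of the inward normal derivative of u through the circle of radius r
    centered at c:  int_0^{2pi} d_nu u (c + r e^{it}) r dt, nu = -e^{it} *)
Definition flux u c (r : R) : R :=
  (\int[@lebesgue_measure R]_(t in `[0, 2 * pi]%classic)
     (- (dx u (c.1 + r * cos t, c.2 + r * sin t) * cos t +
         dy u (c.1 + r * cos t, c.2 + r * sin t) * sin t) * r)).

(** u is constant on the boundary circle of the unit disk centered at c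
    (boundary values understood as limits from the exterior domain E) *)
Definition const_on_circle (E : set (R * R)) u c : Prop :=
  exists k : R, forall p, sqdist p c = 1 -> u @ within E (nbhs p) --> k.

(** zero flux through the boundary circle (boundary integral understood as the
    limit of the fluxes through the circles of radius r > 1, r -> 1) *)
Definition zero_flux u c : Prop := flux u c r @[r --> 1^'+] --> 0.

Definition solution eps delta H u : Prop :=
  let E := Ext eps delta in
  [/\ harmonic_on E u,
      (const_on_circle E u (cL eps delta 0) /\
       const_on_circle E u (cR eps delta 0)),
      (zero_flux u (cL eps delta 0) /\ zero_flux u (cR eps delta 0)),
      (\int[(@lebesgue_measure R) \x (@lebesgue_measure R)]_(p in Cell eps delta)
          (((dx u p - dx H p) ^+ 2 + (dy u p - dy H p) ^+ 2)%:E) < +oo)%E &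
      forall x y, E (x, y) ->
        dx u (x, y) = dx u (x, y + (2 + delta)) /\
        dy u (x, y) = dy u (x, y + (2 + delta))].

Definition Nv eps : set (R * R) :=
  [set p | `|p.1| < 1 + eps / 2 - Num.sqrt (1 - p.2 ^+ 2) /\
           `|p.2| < Num.sqrt 3 / 2].

Definition Nh eps delta : set (R * R) :=
  [set p | `|p.2 - 1 - delta / 2| <
             1 + delta / 2 - Num.sqrt (1 - (p.1 - 1 - eps / 2) ^+ 2) /\
           `|p.1 - 1 - eps / 2| < Num.sqrt 3 / 2].

Definition Sfun eps delta p : R :=
  - 2 * Num.sqrt delta * ((p.1 - 1 - eps / 2) * (p.2 - 1 - delta / 2)) /
    ((p.1 - 1 - eps / 2) ^+ 2 + delta) ^+ 2.

Definition vnorm (v : R * R) : R := Num.sqrt (v.1 ^+ 2 + v.2 ^+ 2).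

End Defs.

(* Main.v *)
Require Import Defs.
From HB Require Import structures.
From mathcomp Require Import all_boot all_order all_algebra.
From mathcomp Require Import all_classical all_reals all_analysis.
From mathcomp Require Import measurable_realfun ring lra.
Set Implicit Arguments.
Unset Strict Implicit.
Unset Printing Implicit Defensive.
Import Order.TTheory GRing.Theory Num.Theory.
Import numFieldNormedType.Exports.
Local Open Scope classical_set_scope.
Local Open Scope ring_scope.

(* Everything is derived from the maximum principle and explicit barriers.

   Finite energy and periodicity force u to differ from a x + b y by a function tending to constants as x tends to +oo and -oo. Since a harmonic function lying below the mean of its values on every vertical line far to the right is constant there, the extrema of u - a x - b y are governed by its values near the disks. Write kL and kR for the boundary values of u on the two central disks, so that u increases by b (2 + delta) from one disk to the next one above it.

   In each gap, u is compared with an affine function of the bipolar potential, which is harmonic outside the two disks and equal to -1 and 1 on their boundaries. The difference vanishes on both circles and is bounded by C (|a| + |b|) + |kR - kL|, so tangent-circle barriers bound its gradient. For the horizontal gap the boundary values differ by b (2 + delta), which gives the first expansion; for the vertical gap they differ by kR - kL, and it remains to show kR - kL = a mu0 sqrt eps with mu0 bounded above and below and independent of the solution.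

   The zero flux condition says that the mean of u over the circle of radius r about the center of a disk differs from the boundary value by o(r - 1). The part v of u that is odd in x and even in y depends only on a and on d = (kR - kL) / 2. If a > 0 then v >= d bip; Hopf's lemma on the outer side of the disk makes the mean of v - d grow at least like a (r - 1), while the mean of d (1 - bip) is at most C d (r - 1) / sqrt eps, whence d >= a sqrt eps / C. In the other direction, v - d <= C a (r - 1) everywhere, and on the arc of length sqrt eps facing the gap v - d <= C a (r - 1) - d (r - 1) / (8 eps); so d <= C a sqrt eps. In particular a = 0 forces d = 0, and by linearity d / a does not depend on the solution. *)

(** * Calculus in one and two variables *)

Section Calculus.
Variable R : realType.
Implicit Types (f g : R -> R) (w : R * R -> R) (p q : R * R).
Implicit Types (a b c d e h l r s t x y : R).

(** A solution is only known to have limits on the circles, so no gradient is ever evaluated there: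
    fluxes are replaced by the growth of circle means, and each sign or size obtained near a circle
    comes from a barrier that is explicit up to the boundary. Existence of solutions is not proved
    either, so the constant of the vertical gap has to be extracted from whatever solutions there
    are.

    The obstacle is the vertical gap. In the horizontal gap periodicity prescribes the jump; across
    the vertical gap the jump is an unknown that only the vanishing flux determines. The exponent of
    [eps] comes from a balance: on the circle of radius [r], at angle [s] from the gap, [1 - bip] is
    of order [(r - 1) / (eps + s^2)], whose integral is of order [(r - 1) / sqrt eps]; multiplied by
    [d] it has to match the contribution [a (r - 1)] of the rest of the circle. The resulting bound
    on [d] is used twice: in the leading term, and to keep the [y]-derivative of [d bip], of size up
    to [d / sqrt eps] in the gap, inside the remainder. *)

Lemma nbhs_boxP p (A : set (R * R)) : nbhs p A <->
  exists2 r : R, 0 < r & forall x y, `|x - p.1| < r -> `|y - p.2| < r -> A (x, y).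
Proof.
split=> [/nbhs_ballP[r /= r0 rA]|[r r0 rA]].
  exists r => // x y hx hy; apply: rA; split => /=; rewrite /ball/= distrC //.
apply/nbhs_ballP; exists r => //= -[x y] [/= hx hy].
by apply: rA; rewrite distrC.
Qed.

Lemma continuous_boxP w p : {for p, continuous w} <->
  forall e, 0 < e -> exists2 r : R, 0 < r &
    forall x y, `|x - p.1| < r -> `|y - p.2| < r -> `|w (x, y) - w p| < e.
Proof.
split=> [/cvgrPdist_lt cw e e0|cw].
  have /nbhs_boxP[r r0 rw] := cw _ e0.
  by exists r => // x y hx hy; rewrite distrC; exact: rw.
apply/cvgrPdist_lt => e e0; have [r r0 rw] := cw _ e0.
by apply/nbhs_boxP; exists r => // x y hx hy; rewrite distrC; exact: rw.
Qed.

(** The nonstrict remainder bound is proportional to [|h|] and covers [h = 0], so increments can be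
    added and compared without any division. *)
Lemma is_derive1P f x d : is_derive x 1 f d <->
  forall e, 0 < e -> exists2 r : R, 0 < r &
    forall h, `|h| < r -> `|f (x + h) - f x - d * h| <= e * `|h|.
Proof.
split=> [df e e0|H].
  have df1 : derivable f x 1 by case: df.
  have df2 : 'D_1 f x = d by case: df.
  have := df1; rewrite /derivable => /cvg_ex[l /= hl].
  have ld : l = d by rewrite -df2 /derive (cvg_lim _ hl).
  rewrite ld in hl; move/cvgrPdist_le: hl => /(_ _ e0).
  rewrite /dnbhs near_withinE => /nbhs_ballP[r /= r0 rw].
  exists r => // h hr; have [->|h0] := eqVneq h 0.
    by rewrite addr0 subrr mulr0 subr0 normr0 mulr0.
  have := rw h; rewrite /ball /= sub0r normrN => /(_ hr h0).
  rewrite /GRing.scale /= mulr1 => hh.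
  have -> : f (x + h) - f x - d * h = - (d - h^-1 * (f (h + x) - f x)) * h.
    by rewrite (addrC h x); field.
  by rewrite normrM normrN ler_wpM2r.
have hl : h^-1 *: (f (h *: 1 + x) - f x) @[h --> 0^'] --> d.
  apply/cvgrPdist_le => e e0; have [r r0 rw] := H _ e0.
  rewrite /dnbhs near_withinE; apply/nbhs_ballP; exists r => //= h.
  rewrite /ball /= sub0r normrN /GRing.scale /= mulr1 => hr h0.
  have := rw h hr; rewrite (addrC h x).
  have -> : f (x + h) - f x - d * h = - (d - h^-1 * (f (x + h) - f x)) * h by field.
  by rewrite normrM normrN ler_pM2r // normr_gt0.
split; first by apply/cvg_ex; exists d.
by rewrite /derive; exact: cvg_lim hl.
Qed.

Lemma is_derive_continuous f x d : is_derive x 1 f d -> {for x, continuous f}.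
Proof. by case=> df _; exact/differentiable_continuous/derivable1_diffP. Qed.

Lemma mean_value (f df : R -> R) a b : a < b ->
  (forall x, a <= x <= b -> is_derive x 1 f (df x)) ->
  exists c : R, a < c < b /\ f b - f a = df c * (b - a).
Proof.
move=> ab H; have [||c cab ->] := @MVT R f df a b ab.
- by move=> x; rewrite in_itv /= => /andP[? ?]; apply: H; rewrite !ltW.
- apply: continuous_in_subspaceT => x; rewrite inE /= in_itv /= => xab.
  exact: is_derive_continuous (H x xab).
by exists c; split => //; move: cab; rewrite in_itv.
Qed.

(** A nonzero [g' t0] would make [g] exceed [g t0] on one side of [t0]. With [g' t0 = 0], a positive
    [l] makes [g'] positive just to the right, and the mean value theorem produces a larger value
    there. *)
Lemma max_second_derive (g g' : R -> R) t0 l e : 0 < e ->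
  (forall t, `|t - t0| < e -> is_derive t 1 g (g' t)) ->
  is_derive t0 1 g' l ->
  (forall t, `|t - t0| < e -> g t <= g t0) -> l <= 0.
Proof.
move=> e0 dg dg' mg; rewrite leNgt; apply/negP => l0.
have g'0 : g' t0 = 0.
  have /is_derive1P D : is_derive t0 1 g (g' t0) by apply: dg; rewrite subrr normr0.
  apply/eqP; rewrite -normr_eq0 eq_le normr_ge0 andbT leNgt; apply/negP => gp.
  have [r r0 hr] := D (`|g' t0| / 2) (divr_gt0 gp (ltr0Sn _ 1)).
  pose h := Num.min (r / 2) (e / 2).
  have h0 : 0 < h by rewrite lt_min !divr_gt0.
  have hlr : h < r by rewrite gt_min; apply/orP; left; lra.
  have hle : h < e by rewrite gt_min; apply/orP; right; lra.
  have [g'p|g'n] := ler0P (g' t0).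
  - have := hr (- h); rewrite normrN gtr0_norm // => /(_ hlr).
    have := mg (t0 - h); rewrite (_ : t0 - h - t0 = - h); last by ring.
    rewrite normrN gtr0_norm // => /(_ hle); rewrite (ler0_norm g'p) ler_norml.
    rewrite (ler0_norm g'p) in gp.
    by move=> ? /andP[]; nra.
  - have := hr h; rewrite gtr0_norm // => /(_ hlr).
    have := mg (t0 + h); rewrite (_ : t0 + h - t0 = h); last by ring.
    rewrite gtr0_norm // => /(_ hle); rewrite (gtr0_norm g'n) ler_norml.
    by move=> ? /andP[]; nra.
have /is_derive1P D' := dg'.
have [r r0 hr] := D' (l / 2) (divr_gt0 l0 (ltr0Sn _ 1)).
pose h := Num.min (r / 2) (e / 2).
have h0 : 0 < h by rewrite lt_min !divr_gt0.
have hlr : h < r by rewrite gt_min; apply/orP; left; lra.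
have hle : h < e by rewrite gt_min; apply/orP; right; lra.
have [||c [/andP[c1 c2] hc]] := @mean_value g g' t0 (t0 + h); first lra.
  by move=> x /andP[x1 x2]; apply: dg; rewrite ger0_norm; lra.
have ch : `|c - t0| < r by rewrite gtr0_norm; lra.
have := hr _ ch; rewrite (_ : t0 + (c - t0) = c); last by ring.
rewrite g'0 subr0 (gtr0_norm (_ : 0 < c - t0)); last lra.
rewrite ler_norml => /andP[hc1 _].
have g'c : 0 < g' c by nra.
have := mg (t0 + h); rewrite (_ : t0 + h - t0 = h); last by ring.
rewrite gtr0_norm // => /(_ hle).
have : 0 < g' c * (t0 + h - t0) by apply: mulr_gt0 => //; lra.
by move: hc; lra.
Qed.

End Calculus.

(** * Harmonic functions and the maximum principle *)

Section Harmonic.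
Variable R : realType.
Implicit Types (G : set (R * R)) (w wx wy : R * R -> R) (p q : R * R).
Implicit Types (a b c d e h l r s t x y : R).

(** The gradient is an explicit parameter and only the second derivatives are existential: the
    gradient of a combination of harmonic functions can then be read off its type, with no
    derivative to compute. The recorded data are those on which the maximum principle operates. *)
Definition harm G w wx wy := exists wxx wyy : R * R -> R, forall p, G p ->
  [/\ {for p, continuous w},
      is_derive p.1 1 (fun t => w (t, p.2)) (wx p),
      is_derive p.2 1 (fun t => w (p.1, t)) (wy p) &
      [/\ is_derive p.1 1 (fun t => wx (t, p.2)) (wxx p),
          is_derive p.2 1 (fun t => wy (p.1, t)) (wyy p) &
          wxx p + wyy p = 0]].

Lemma harm_sub G G' w wx wy : G' `<=` G -> harm G w wx wy -> harm G' w wx wy.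
Proof.
by move=> GG [wxx [wyy H]]; exists wxx, wyy => p /GG; exact: H.
Qed.

Lemma harmD G w wx wy w' wx' wy' : harm G w wx wy -> harm G w' wx' wy' ->
  harm G (fun p => w p + w' p) (fun p => wx p + wx' p) (fun p => wy p + wy' p).
Proof.
move=> [wxx [wyy H]] [wxx' [wyy' H']].
exists (fun p => wxx p + wxx' p), (fun p => wyy p + wyy' p) => p Gp.
have [c dx1 dy1 [dxx1 dyy1 l]] := H p Gp.
have [c' dx1' dy1' [dxx1' dyy1' l']] := H' p Gp.
split; [exact: cvgD|exact: is_deriveD|exact: is_deriveD|].
split; [exact: is_deriveD|exact: is_deriveD|].
by rewrite addrACA l l' addr0.
Qed.

Lemma harmZ G w wx wy (k : R) : harm G w wx wy ->
  harm G (fun p => k * w p) (fun p => k * wx p) (fun p => k * wy p).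
Proof.
move=> [wxx [wyy H]].
exists (fun p => k * wxx p), (fun p => k * wyy p) => p Gp.
have [c dx1 dy1 [dxx1 dyy1 l]] := H p Gp.
split; [exact: cvgMr|exact: is_deriveZ|exact: is_deriveZ|].
split; [exact: is_deriveZ|exact: is_deriveZ|].
by rewrite -mulrDr l mulr0.
Qed.

Lemma harm_ext G w wx wy w' wx' wy' :
  harm G w wx wy -> (forall p, w p = w' p) -> (forall p, wx p = wx' p) ->
  (forall p, wy p = wy' p) -> harm G w' wx' wy'.
Proof. by move=> + /funext <- /funext <- /funext <-. Qed.

Lemma harmB G w wx wy w' wx' wy' : harm G w wx wy -> harm G w' wx' wy' ->
  harm G (fun p => w p - w' p) (fun p => wx p - wx' p) (fun p => wy p - wy' p).
Proof.
move=> H H'; apply: (harm_ext (harmD H (harmZ (-1) H'))) => p /=; ring.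
Qed.

Lemma harm_affine G a b c :
  harm G (fun p => a * p.1 + b * p.2 + c) (fun=> a) (fun=> b).
Proof.
exists (fun=> 0), (fun=> 0) => p _; split => /=.
- apply: cvgD; last exact: cvg_cst.
  by apply: cvgD; apply: cvgMr; [exact: cvg_fst|exact: cvg_snd].
- by apply: is_derive_eq; rewrite /GRing.scale /=; ring.
- by apply: is_derive_eq; rewrite /GRing.scale /=; ring.
- by split; rewrite ?addr0//; exact: is_derive_cst.
Qed.

Lemma harm_cst G c : harm G (fun=> c) (fun=> 0) (fun=> 0).
Proof. by apply: (harm_ext (harm_affine G 0 0 c)) => p //; ring. Qed.

Lemma harm_quad G c : harm G (fun p => c * (p.2 ^+ 2 - p.1 ^+ 2))
  (fun p => - (2 * c * p.1)) (fun p => 2 * c * p.2).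
Proof.
exists (fun=> - (2 * c)), (fun=> 2 * c) => p _; split => /=.
- apply: cvgMr; rewrite /=; apply: cvgB; apply: cvgM; try exact: cvg_fst; exact: cvg_snd.
- by apply: is_derive_eq; rewrite /GRing.scale /=; ring.
- by apply: is_derive_eq; rewrite /GRing.scale /=; ring.
- by split; [apply: is_derive_eq; rewrite /GRing.scale /=; ring..|ring].
Qed.

Lemma harm_log G q : (forall p, G p -> 0 < sqdist p q) ->
  harm G (fun p => ln (sqdist p q)) (fun p => 2 * (p.1 - q.1) / sqdist p q)
    (fun p => 2 * (p.2 - q.2) / sqdist p q).
Proof.
move=> Gq.
exists (fun p => (2 * sqdist p q - 4 * (p.1 - q.1) ^+ 2) / sqdist p q ^+ 2),
  (fun p => (2 * sqdist p q - 4 * (p.2 - q.2) ^+ 2) / sqdist p q ^+ 2) => p Gp.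
have p0 := Gq p Gp; rewrite /sqdist in p0 *.
have pn0 : (p.1 - q.1) ^+ 2 + (p.2 - q.2) ^+ 2 != 0 by rewrite gt_eqF.
have h1 : is_derive p.1 1 (fun t => (t - q.1) ^+ 2 + (p.2 - q.2) ^+ 2) (2 * (p.1 - q.1)).
  by apply: is_derive_eq; rewrite /GRing.scale /=; ring.
have h2 : is_derive p.2 1 (fun t => (p.1 - q.1) ^+ 2 + (t - q.2) ^+ 2) (2 * (p.2 - q.2)).
  by apply: is_derive_eq; rewrite /GRing.scale /=; ring.
split => /=.
- apply: continuous_comp; last exact: continuous_ln.
  apply: cvgD; apply: cvgM; apply: cvgB; try exact: cvg_cst; try exact: cvg_fst; exact: cvg_snd.
- have := @is_derive1_comp _ _ (fun t => (t - q.1) ^+ 2 + (p.2 - q.2) ^+ 2) _ _ _ (is_derive1_ln p0) h1; rewrite /comp /=.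
  by move/is_derive_eq; apply; rewrite mulrC.
- have := @is_derive1_comp _ _ (fun t => (p.1 - q.1) ^+ 2 + (t - q.2) ^+ 2) _ _ _ (is_derive1_ln p0) h2; rewrite /comp /=.
  by move/is_derive_eq; apply; rewrite mulrC.
split.
- have h3 : is_derive p.1 1 (fun t => 2 * (t - q.1)) 2.
    by apply: is_derive_eq; rewrite /GRing.scale /=; ring.
  have h4 := @is_deriveV _ (fun t => (t - q.1) ^+ 2 + (p.2 - q.2) ^+ 2) _ _ _ pn0 h1; have := is_deriveM h3 h4.
  by move/is_derive_eq; apply; rewrite /GRing.scale /=; field.
- have h3 : is_derive p.2 1 (fun t => 2 * (t - q.2)) 2.
    by apply: is_derive_eq; rewrite /GRing.scale /=; ring.
  have h4 := @is_deriveV _ (fun t => (p.1 - q.1) ^+ 2 + (t - q.2) ^+ 2) _ _ _ pn0 h2; have := is_deriveM h3 h4.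
  by move/is_derive_eq; apply; rewrite /GRing.scale /=; field.
- by field.
Qed.

Lemma harm_continuous G w wx wy p : harm G w wx wy -> G p -> {for p, continuous w}.
Proof. by move=> [wxx [wyy H]] /H[]. Qed.

(* Perturbing w by a small multiple of x^2 makes it strictly subharmonic, so an interior maximum is impossible; the second coordinate of p need only be bounded up to the symmetries of w. *)
Lemma harm_max G w wx wy (X Y : R) : open G -> harm G w wx wy ->
  (forall p, G p -> `|p.1| <= X) ->
  (forall p, G p -> exists y, [/\ G (p.1, y), `|y| <= Y & w (p.1, y) = w p]) ->
  (forall q, ~ G q -> forall e, 0 < e -> \forall p \near q, G p -> w p <= e) ->
  forall p, G p -> w p <= 0.
Proof.
move=> oG [wxx [wyy H]] GX GY bd p0 Gp0; rewrite leNgt; apply/negP => wp0.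
have X0 : 0 <= X by apply: le_trans (GX _ Gp0).
pose e := w p0 / 3; have e0 : 0 < e by rewrite /e; lra.
(* The boundary hypothesis at level [e / 2] prevents limits of points of [A] from leaving [G]; hence
   [A] is closed inside a rectangle, and compact. *)
pose A := [set p | [/\ G p, `|p.1| <= X, `|p.2| <= Y & e <= w p]].
pose K : set (R * R) := `[- X, X] `*` `[- Y, Y].
have cK : compact K by apply: compact_setX; exact: segment_compact.
have AK : A `<=` K.
  by move=> p [_ h1 h2 _]; split; rewrite /= in_itv /= -ler_norml.
have clK : closed K by apply: compact_closed => //; exact: norm_hausdorff.
have clA : closed A.
  move=> q cq.
  have [Kq1 Kq2] : K q by apply: clK; apply: closureS cq.
  have Gq : G q.
    apply: contrapT => nGq; have e2 : 0 < e / 2 by lra.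
    have [p [[Gp _ _ ep] /(_ Gp)]] := cq _ (bd q nGq (e / 2) e2).
    by lra.
  split => //; [by move: Kq1; rewrite /= in_itv /= -ler_norml|
    by move: Kq2; rewrite /= in_itv /= -ler_norml|].
  rewrite leNgt; apply/negP => wq.
  have [c _ _ _] := H q Gq.
  have [p [[Gp _ _ ep] /=]] := cq _ (@cvgr_lt _ _ _ _ _ _ c _ wq).
  by lra.
have cA : compact A by apply: (subclosed_compact clA cK).
(* The perturbation is at most [e] on the strip while [w p0 = 3 e], so [w >= 2 e] at the maximum of
   [F] over [A]. The constraint [e <= w] is therefore inactive there, and the maximum is
   interior. *)
pose tau := e / (X ^+ 2 + 1).
have X21 : 0 < X ^+ 2 + 1 by rewrite ltr_wpDl // sqr_ge0.
have tau0 : 0 < tau by rewrite divr_gt0.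
have tauX x : `|x| <= X -> tau * x ^+ 2 <= e.
  move=> xX; rewrite /tau mulrAC ler_pdivrMr // ler_wpM2l ?(ltW e0)//.
  by rewrite -real_normK ?num_real// (le_trans (lerXn2r 2 _ _ xX)) ?nnegrE// lerDl.
pose F p := w p + tau * p.1 ^+ 2.
have [y0 [Gy0 yY0 wy0]] := GY _ Gp0.
have Ay0 : A (p0.1, y0) by split => //=; rewrite ?GX// wy0 /e; lra.
have [||c /set_mem[Gc cX cY ec] cmax] := @compact_EVT_max _ R F A _ cA.
- by exists (p0.1, y0).
- apply: continuous_in_subspaceT => p /set_mem[Gp _ _ _].
  have [cw _ _ _] := H p Gp.
  by apply: cvgD => //; apply: cvgMr; apply: cvgM; exact: cvg_fst.
have wc : 2 * e <= w c.
  have := cmax _ (mem_set Ay0); rewrite /F /= wy0.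
  have := tauX _ cX; have : 0 <= tau * p0.1 ^+ 2 by rewrite mulr_ge0 ?sqr_ge0// ltW.
  by rewrite /e; lra.
have [cw _ _ [_ _ lap]] := H c Gc.
have /nbhs_boxP[r r0 rG] : nbhs c G by apply: open_nbhs_nbhs; split.
have /continuous_boxP /(_ e e0)[r' r'0 rw] := cw.
pose s := Num.min r r'; have s0 : 0 < s by rewrite lt_min r0.
have sr x y : `|x - c.1| < s -> `|y - c.2| < s -> G (x, y) /\ e < w (x, y).
  rewrite !lt_min => /andP[h1 h2] /andP[h3 h4]; split; first exact: rG.
  by have := rw _ _ h2 h4; rewrite ltr_norml => /andP[]; lra.
have Fmax x y : `|x - c.1| < s -> `|y - c.2| < s -> F (x, y) <= F c.
  move=> h1 h2; have [Gxy wxy] := sr _ _ h1 h2.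
  have [y' [/= Gy' yY' wy']] := GY _ Gxy.
  have <- : F (x, y') = F (x, y) by rewrite /F wy'.
  by apply: cmax; apply/mem_set; split => //=; [exact: GX Gxy|rewrite wy' ltW].
have dx0 : wxx c + 2 * tau <= 0.
  apply: (@max_second_derive _ (fun t => F (t, c.2)) (fun t => wx (t, c.2) + 2 * tau * t) c.1 _ s s0).
  - move=> t ts; have [|Gt _] := sr t c.2 ts; first by rewrite subrr normr0.
    have [_ /= dt _ _] := H _ Gt.
    apply: is_deriveD => //; apply: is_derive_eq; rewrite /GRing.scale /=; ring.
  - have [_ _ _ [dt _ _]] := H _ Gc.
    by apply: is_deriveD => //; apply: is_derive_eq; rewrite /GRing.scale /=; ring.
  - move=> t ts; have := Fmax t c.2 ts; rewrite subrr normr0 => /(_ s0).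
    by rewrite -surjective_pairing.
have dy0 : wyy c <= 0.
  apply: (@max_second_derive _ (fun t => F (c.1, t)) (fun t => wy (c.1, t)) c.2 _ s s0).
  - move=> t ts; have [|Gt _] := sr c.1 t _ ts; first by rewrite subrr normr0.
    have [_ _ /= dt _] := H _ Gt.
    have dc : is_derive t 1 (fun=> tau * c.1 ^+ 2) 0 by exact: is_derive_cst.
    by have := is_deriveD dt dc; rewrite addr0.
  - by have [_ _ _ [_ dt _]] := H _ Gc.
  - move=> t ts; have := Fmax c.1 t; rewrite subrr normr0 => /(_ s0 ts).
    by rewrite -surjective_pairing.
by lra.
Qed.

End Harmonic.

(** * Isometries and the interior gradient estimate *)

Section HarmonicTransforms.
Variable R : realType.
Implicit Types (G : set (R * R)) (w wx wy : R * R -> R) (p q : R * R).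
Implicit Types (a b c d e h k l r s t x y M : R).

Lemma is_derive_affine_comp (f : R -> R) a b t d : is_derive (a * t + b) 1 f d ->
  is_derive t 1 (fun u => f (a * u + b)) (a * d).
Proof.
move=> df; have h : is_derive t 1 (fun u => a * u + b) a.
  by apply: is_derive_eq; rewrite /GRing.scale /=; ring.
by have := @is_derive1_comp _ _ (fun u => a * u + b) _ _ _ df h; rewrite mulrC.
Qed.

Let sN1 : (-1) ^+ 2 = 1 :> R. Proof. by rewrite sqrrN expr1n. Qed.

Lemma continuous_pair2 (f g : R * R -> R) p : {for p, continuous f} ->
  {for p, continuous g} -> {for p, continuous (fun q => (f q, g q))}.
Proof. by move=> cf cg; exact: (cvg_pair cf cg). Qed.

(** [a] and [c] are signs, so translations and the reflections in both axes are covered at once. *)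
Lemma harm_isometry G w wx wy a b c d : a ^+ 2 = 1 -> c ^+ 2 = 1 -> harm G w wx wy ->
  harm [set p | G (a * p.1 + b, c * p.2 + d)] (fun p => w (a * p.1 + b, c * p.2 + d))
    (fun p => a * wx (a * p.1 + b, c * p.2 + d)) (fun p => c * wy (a * p.1 + b, c * p.2 + d)).
Proof.
move=> a1 c1 [wxx [wyy H]].
exists (fun p => wxx (a * p.1 + b, c * p.2 + d)), (fun p => wyy (a * p.1 + b, c * p.2 + d)).
move=> p /= Gp; have [cw /= dx1 dy1 [dxx1 dyy1 l]] := H _ Gp.
split => //.
- apply: (@continuous_comp _ _ _ (fun p : R * R => (a * p.1 + b, c * p.2 + d))) cw.
  apply: continuous_pair2; apply: cvgD; try exact: cvg_cst; apply: cvgMr; [exact: cvg_fst|exact: cvg_snd].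
- exact: (is_derive_affine_comp (f := fun t => w (t, c * p.2 + d))).
- exact: (is_derive_affine_comp (f := fun t => w (a * p.1 + b, t))).
split => //.
- have := is_derive_affine_comp (f := fun t => wx (t, c * p.2 + d)) dxx1.
  move=> /(is_deriveZ a) /is_derive_eq; apply.
  by rewrite /GRing.scale /= mulrA -expr2 a1 mul1r.
- have := is_derive_affine_comp (f := fun t => wy (a * p.1 + b, t)) dyy1.
  move=> /(is_deriveZ c) /is_derive_eq; apply.
  by rewrite /GRing.scale /= mulrA -expr2 c1 mul1r.
Qed.

Lemma harm_swap G w wx wy : harm G w wx wy ->
  harm [set p | G (p.2, p.1)] (fun p => w (p.2, p.1)) (fun p => wy (p.2, p.1)) (fun p => wx (p.2, p.1)).
Proof.
move=> [wxx [wyy H]]; exists (fun p => wyy (p.2, p.1)), (fun p => wxx (p.2, p.1)).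
move=> p /= Gp; have [cw /= dx1 dy1 [dxx1 dyy1 l]] := H _ Gp.
split => //; last by split => //; rewrite addrC.
apply: (@continuous_comp _ _ _ (fun p : R * R => (p.2, p.1))) cw.
by apply: continuous_pair2; [exact: cvg_snd|exact: cvg_fst].
Qed.

Lemma near_le_continuous w q e : {for q, continuous w} -> w q <= 0 -> 0 < e ->
  \forall p \near q, w p <= e.
Proof.
move=> cw wq e0.
have /continuous_boxP /(_ e e0)[r r0 rw] := cw.
apply/nbhs_boxP; exists r => // x y hx hy; have := rw x y hx hy.
by rewrite ltr_norml => /andP[]; lra.
Qed.

Lemma open_box (x0 x1 y0 y1 : R) :
  open [set p : R * R | x0 < p.1 < x1 /\ y0 < p.2 < y1].
Proof.
have -> : [set p : R * R | x0 < p.1 < x1 /\ y0 < p.2 < y1] =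
  (fst @^-1` `]x0, x1[) `&` (snd @^-1` `]y0, y1[).
  by apply/seteqP; split => p /=; rewrite !in_itv.
by apply: openI; apply: open_comp => //; try exact: itv_open;
  move=> p _; [exact: cvg_fst|exact: cvg_snd].
Qed.

Lemma near_notin_closed (C : set (R * R)) q : open C -> C q ->
  forall (P : R * R -> Prop), (forall p, C p -> P p) -> \forall p \near q, P p.
Proof.
move=> oC Cq P CP; apply: filterS CP _; exact: open_nbhs_nbhs.
Qed.

Lemma near_fst q (P : R -> Prop) : (\forall x \near q.1, P x) -> \forall p \near q, P p.1.
Proof. exact: (@cvg_fst _ _ (nbhs q.1) (nbhs q.2)). Qed.

Lemma near_snd q (P : R -> Prop) : (\forall x \near q.2, P x) -> \forall p \near q, P p.2.
Proof. exact: (@cvg_snd _ _ (nbhs q.1) (nbhs q.2)). Qed.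

Lemma harm_max_bounded G w wx wy (X : R) : open G -> harm G w wx wy ->
  (forall p, G p -> `|p.1| <= X /\ `|p.2| <= X) ->
  (forall q, ~ G q -> forall e, 0 < e -> \forall p \near q, G p -> w p <= e) ->
  forall p, G p -> w p <= 0.
Proof.
move=> oG H GX; apply: (@harm_max _ G w wx wy X X oG H) => p /[dup] Gp /GX[] //.
by exists p.2; rewrite -surjective_pairing.
Qed.

(** The half difference [g] of [w] and its mirror image vanishes on [x = 0], is bounded by [M] and
    has the same [x]-derivative as [w] at the origin. On the half square [0 < x < s], [|y| < s] it
    is compared with [psi = M ((y / s)^2 - (x / s)^2 + 2 x / s)], which is harmonic, nonnegative on
    [x = 0] and at least [M] on the three other sides; the slope of [psi] at the origin is
    [2 M / s]. *)
Lemma harm_grad_half (w wx wy : R * R -> R) s M : 0 < s -> 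
  harm [set p : R * R | `|p.1| < 2 * s /\ `|p.2| < 2 * s] w wx wy ->
  (forall x y, `|x| < 2 * s -> `|y| < 2 * s -> `|w (x, y)| <= M) ->
  wx (0, 0) <= 2 * M / s.
Proof.
set G := [set p | _] => s0 H wM.
have M0 : 0 <= M by apply: le_trans (wM 0 0 _ _); rewrite ?normr0//; lra.
pose g p := 2^-1 * (w p - w (- p.1, p.2)).
pose psi p := M / s ^+ 2 * (p.2 ^+ 2 - p.1 ^+ 2) + (2 * M / s * p.1 + 0 * p.2 + 0).
pose F p := g p - psi p.
have HF : exists Fx Fy, harm G F Fx Fy.
  have H' : harm G (fun p => w (-1 * p.1 + 0, 1 * p.2 + 0))
      (fun p => -1 * wx (-1 * p.1 + 0, 1 * p.2 + 0)) (fun p => 1 * wy (-1 * p.1 + 0, 1 * p.2 + 0)).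
    have H' := @harm_isometry G w wx wy (-1) 0 1 0 sN1 (expr1n _ _) H.
    apply: (harm_sub _ H').
    by move=> p [h1 h2] /=; rewrite /G /= !addr0 mulN1r mul1r normrN.
  do 2 eexists; apply: (harm_ext (harmB (harmZ 2^-1 (harmB H H'))
    (harmD (harm_quad G (M / s ^+ 2)) (harm_affine G (2 * M / s) 0 0)))) => p //=.
  by rewrite /F /g /psi mulN1r mul1r (addr0 (- p.1)) (addr0 p.2).
have {HF}[Fx [Fy HF]] := HF.
pose D : set (R * R) := [set p : R * R | 0 < p.1 < s /\ - s < p.2 < s].
have DG : D `<=` G by move=> p [/andP[? ?] /andP[? ?]]; split; rewrite ltr_norml; lra.
have Fle : forall p, D p -> F p <= 0.
  apply: (@harm_max_bounded D F Fx Fy s); first exact: open_box.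
  - exact: harm_sub HF.
  - by move=> p [/andP[? ?] /andP[? ?]]; rewrite !ler_norml; split; apply/andP; split; lra.
  move=> q nDq e e0.
  have [q10|q10] := ltP q.1 0.
    apply: filterS (near_fst (P := fun x => x < 0) _); last exact: lt_nbhsl.
    by move=> p /= p1 [/andP[? ?] _]; lra.
  have [q1s|q1s] := ltP s q.1.
    apply: filterS (near_fst (P := fun x => s < x) _); last exact: lt_nbhsr.
    by move=> p /= p1 [/andP[? ?] _]; lra.
  have [q2s|q2s] := ltP s q.2.
    apply: filterS (near_snd (P := fun x => s < x) _); last exact: lt_nbhsr.
    by move=> p /= p1 [_ /andP[? ?]]; lra.
  have [q2s'|q2s'] := ltP q.2 (- s).
    apply: filterS (near_snd (P := fun x => x < - s) _); last exact: lt_nbhsl.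
    by move=> p /= p1 [_ /andP[? ?]]; lra.
  have Gq : G q by split; rewrite ltr_norml; lra.
  apply: filterS (near_le_continuous (w := F) (q := q) _ _ e0); first by [].
    exact: harm_continuous HF Gq.
  have gM : g q <= M.
    have := wM q.1 q.2 Gq.1 Gq.2; have := wM (- q.1) q.2.
    rewrite normrN => /(_ Gq.1 Gq.2); rewrite -surjective_pairing /g.
    by rewrite !ler_norml => /andP[? ?] /andP[? ?]; lra.
  suff : g q <= psi q by rewrite /F subr_le0.
  have psiE : psi q = M * ((q.2 / s) ^+ 2 - (q.1 / s) ^+ 2 + 2 * (q.1 / s)).
    by rewrite /psi; field; rewrite gt_eqF.
  have xs0 : 0 <= q.1 / s by rewrite divr_ge0 // ltW.
  have xs1 : q.1 / s <= 1 by rewrite ler_pdivrMr // mul1r.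
  have ys1 : (q.2 / s) ^+ 2 <= 1.
    by rewrite expr_div_n ler_pdivrMr ?exprn_gt0// mul1r; nra.
  have [q1e0|q1n0] := eqVneq q.1 0.
    have -> : g q = 0 by rewrite /g q1e0 oppr0 -q1e0 -surjective_pairing subrr mulr0.
    by rewrite psiE q1e0 mul0r expr0n subr0 mulr0 addr0 mulr_ge0 // sqr_ge0.
  have q1p : 0 < q.1 by rewrite lt_neqAle eq_sym q1n0.
  apply: (le_trans gM); rewrite psiE; apply: ler_peMr => //.
  have [q1s1|q1s1] := eqVneq q.1 s.
    by rewrite q1s1 divff ?gt_eqF//; have := sqr_ge0 (q.2 / s); lra.
  have q1lt : q.1 < s by rewrite lt_neqAle q1s1.
  have : (q.2 / s) ^+ 2 = 1.
    have [->|q2n] := eqVneq q.2 s; first by rewrite divff ?gt_eqF// expr1n.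
    have [->|q2n'] := eqVneq q.2 (- s); first by rewrite mulNr divff ?gt_eqF// sqrrN expr1n.
    exfalso; apply: nDq; split; apply/andP; split => //; first by rewrite lt_neqAle eq_sym q2n'.
    by rewrite lt_neqAle q2n.
  by move=> ->; nra.
have G00 : G (0, 0) by split; rewrite normr0; lra.
have [wxx [wyy Hw]] := H; have [_ dw _ _] := Hw _ G00.
have /is_derive1P dwP := dw.
apply/ler_addgt0Pr => e e0; have [r r0 rw] := dwP e e0.
pose h := Num.min (r / 2) (s / 2).
have h0 : 0 < h by rewrite lt_min !divr_gt0.
have hr : h < r by rewrite gt_min; apply/orP; left; lra.
have hs : h < s by rewrite gt_min; apply/orP; right; lra.
have := rw h; have := rw (- h); rewrite normrN (gtr0_norm h0) => /(_ hr) + /(_ hr) /=.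
rewrite add0r add0r !ler_norml => /andP[_ h1] /andP[h2 _].
have := Fle (h, 0); rewrite /D /= => /(_ _); rewrite /F /g /psi /= => h3.
have {}h3 := h3 (conj (introT andP (conj h0 hs)) (introT andP (conj _ s0))).
have {}h3 : 2^-1 * (w (h, 0) - w (- h, 0)) <= 2 * M / s * h.
  have : 0 <= M / s ^+ 2 * h ^+ 2 by rewrite mulr_ge0 ?sqr_ge0// divr_ge0 // sqr_ge0.
  by have := h3 ltac:(lra); rewrite expr0n /= sub0r; lra.
have : (wx (0, 0) - (2 * M / s + e)) * h <= 0 by nra.
by rewrite pmulr_lle0 // subr_le0.
Qed.

(** The one-sided bound is applied to [w], to [- w], and to both after exchanging the coordinates;
    [r = 2 s] turns [2 M / s] into [4 M / r]. *)
Lemma harm_grad G w wx wy p r M : 0 < r -> harm G w wx wy ->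
  (forall x y, `|x - p.1| < r -> `|y - p.2| < r -> G (x, y) /\ `|w (x, y)| <= M) ->
  `|wx p| <= 4 * M / r /\ `|wy p| <= 4 * M / r.
Proof.
move=> r0 H wM; pose s := r / 2; have s0 : 0 < s by rewrite divr_gt0.
have rE : 2 * s = r by rewrite /s; field.
have sE : 2 * M / s = 4 * M / r by rewrite /s; field; rewrite gt_eqF.
have H0 : harm [set q : R * R | `|q.1| < 2 * s /\ `|q.2| < 2 * s]
    (fun q => w (1 * q.1 + p.1, 1 * q.2 + p.2)) (fun q => 1 * wx (1 * q.1 + p.1, 1 * q.2 + p.2))
    (fun q => 1 * wy (1 * q.1 + p.1, 1 * q.2 + p.2)).
  have H' := @harm_isometry G w wx wy 1 p.1 1 p.2 (expr1n _ _) (expr1n _ _) H.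
  apply: (harm_sub _ H').
  move=> q [h1 h2] /=; rewrite !mul1r rE in h1 h2 *.
  by have [] := wM (q.1 + p.1) (q.2 + p.2); rewrite ?addrK.
have M0 x y : `|x| < 2 * s -> `|y| < 2 * s -> `|w (1 * x + p.1, 1 * y + p.2)| <= M.
  rewrite rE !mul1r => h1 h2.
  by have [] := wM (x + p.1) (y + p.2); rewrite ?addrK.
have HN := harmZ (-1) H0.
have MN x y : `|x| < 2 * s -> `|y| < 2 * s -> `|-1 * w (1 * x + p.1, 1 * y + p.2)| <= M.
  by move=> h1 h2; rewrite mulN1r normrN; exact: M0.
have sw : [set q : R * R | `|q.1| < 2 * s /\ `|q.2| < 2 * s] `<=`
    [set q | [set q : R * R | `|q.1| < 2 * s /\ `|q.2| < 2 * s] (q.2, q.1)].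
  by move=> q [].
have HS := harm_sub sw (harm_swap H0); have HSN := harm_sub sw (harm_swap HN).
have := harm_grad_half s0 H0 M0; have := harm_grad_half s0 HN MN.
have := harm_grad_half s0 HS (fun x y hx hy => M0 y x hy hx).
have := harm_grad_half s0 HSN (fun x y hx hy => MN y x hy hx).
rewrite /= !mulr0 !add0r !mul1r -surjective_pairing sE !ler_norml.
by move=> h1 h2 h3 h4; split; apply/andP; split; lra.
Qed.

End HarmonicTransforms.

(** * Gradient bounds in a narrow gap *)

Section LocalGradient.
Variable R : realType.
Implicit Types (G : set (R * R)) (w wx wy : R * R -> R) (p q z m : R * R).
Implicit Types (a b d e h k l r s t x y M : R).

Lemma sqdist_ge0 p q : 0 <= sqdist p q.
Proof. by rewrite /sqdist addr_ge0 ?sqr_ge0. Qed.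

Lemma sqdistC p q : sqdist p q = sqdist q p.
Proof. by rewrite /sqdist; ring. Qed.

(** The cross term is bounded by Cauchy-Schwarz, obtained from Lagrange's identity with the square
    of [a d - b c]; no square root is taken. *)
Lemma sqdist_triangle p q z r s : 0 <= r -> 0 <= s -> sqdist p q <= r ^+ 2 ->
  sqdist q z <= s ^+ 2 -> sqdist p z <= (r + s) ^+ 2.
Proof.
rewrite /sqdist => r0 s0; set a := p.1 - q.1; set b := p.2 - q.2.
set c := q.1 - z.1; set d := q.2 - z.2 => h1 h2.
have -> : p.1 - z.1 = a + c by rewrite /a /c; ring.
have -> : p.2 - z.2 = b + d by rewrite /b /d; ring.
have dot : a * c + b * d <= r * s.
  rewrite leNgt; apply/negP => h.
  have h3 : (a ^+ 2 + b ^+ 2) * (c ^+ 2 + d ^+ 2) <= r ^+ 2 * s ^+ 2.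
    by apply: ler_pM => //; rewrite addr_ge0 ?sqr_ge0.
  have := sqr_ge0 (a * d - b * c); have rs0 : 0 <= r * s by rewrite mulr_ge0.
  by nra.
by nra.
Qed.

Lemma sqdist_triangle_lt p q z r s : 0 <= r -> 0 <= s -> sqdist p q < r ^+ 2 ->
  sqdist q z <= s ^+ 2 -> sqdist p z < (r + s) ^+ 2.
Proof.
move=> r0 s0 h1 h2; have rp : 0 < r.
  by rewrite lt_neqAle r0 andbT; apply: contraTneq h1 => <-; rewrite expr0n -leNgt sqdist_ge0.
pose r' := Num.sqrt (sqdist p q).
have r'r : r' < r by rewrite -(ger0_norm r0) -sqrtr_sqr ltr_sqrt // exprn_gt0.
have : sqdist p z <= (r' + s) ^+ 2.
  by apply: (@sqdist_triangle p q z r' s) => //; rewrite ?sqrtr_ge0// sqr_sqrtr ?sqdist_ge0.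
have := sqrtr_ge0 (sqdist p q); rewrite -/r' => r'0 h; apply: (le_lt_trans h).
by apply: ltrXn2r => //; rewrite ?nnegrE ?addr_ge0// ?ltr_leD// ltrD2r.
Qed.

Lemma continuous_sqdist q p : {for p, continuous (fun z => sqdist z q)}.
Proof.
by apply: cvgD; apply: cvgM; apply: cvgB; try exact: cvg_cst; try exact: cvg_fst; exact: cvg_snd.
Qed.

Lemma open_sqdist_lt q r : open [set p | sqdist p q < r].
Proof.
have -> : [set p | sqdist p q < r] = (fun z => sqdist z q) @^-1` `]-oo, r[.
  by apply/seteqP; split => p /=; rewrite in_itv.
by apply: open_comp => [p _|]; [exact: continuous_sqdist|exact: interval_open].
Qed.

Lemma open_sqdist_gt q r : open [set p | r < sqdist p q].
Proof.
have -> : [set p | r < sqdist p q] = (fun z => sqdist z q) @^-1` `]r, +oo[.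
  by apply/seteqP; split => p /=; rewrite in_itv /= andbT.
by apply: open_comp => [p _|]; [exact: continuous_sqdist|exact: interval_open].
Qed.

(** [m] is the middle of the gap. The radii are nested as [11 / 10 < 23 / 20 < 6 / 5]: gradients are
    estimated within the first, tangency points lie within the second, and a ball of radius [1 / 20]
    about such a point stays within the third. *)
Definition gap_nbhd (c1 c2 m : R * R) : set (R * R) :=
  [set z | [/\ 1 < sqdist z c1, 1 < sqdist z c2 & sqdist z m < (6 / 5) ^+ 2]].

Lemma open_gap_nbhd c1 c2 m : open (gap_nbhd c1 c2 m).
Proof.
have -> : gap_nbhd c1 c2 m =
   [set p | 1 < sqdist p c1] `&` [set p | 1 < sqdist p c2] `&` [set p | sqdist p m < (6/5) ^+ 2].
  by apply/seteqP; split=> p /=; [move=> []|move=> [[]]].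
by apply: openI; [apply: openI; exact: open_sqdist_gt|exact: open_sqdist_lt].
Qed.

Definition vanishes_at G w (c : R * R) := forall q, sqdist q c = 1 ->
  forall e, 0 < e -> \forall p \near q, G p -> `|w p| <= e.

(* The disk of half the radius internally tangent at q gives a barrier that is positive on the unit circle away from q. *)
Lemma tangent_barrierE c q p : sqdist q c = 1 ->
  4 * sqdist p ((c.1 + q.1) / 2, (c.2 + q.2) / 2) = 1 + 2 * (sqdist p c - 1) + 2 * sqdist p q.
Proof.
rewrite /sqdist /= => H; apply/eqP; rewrite -subr_eq0; apply/eqP.
transitivity (1 - ((q.1 - c.1) ^+ 2 + (q.2 - c.2) ^+ 2)); last by rewrite H subrr.
by field.
Qed.

(** The barrier is [M / L] times [beta z = ln (4 |z - c'|^2)], where [c'] is the centre of the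
    tangent disk of radius [1 / 2]. By the identity above, [beta] is at least [ln (1 + 2 |z - q|^2)]
    outside the first disk: it is nonnegative on both circles and at least [L] at distance [1 / 20]
    from [q]. The inequality [ln (1 + x) <= x] then yields a bound that vanishes at [q], whatever
    the width of the gap. *)
Lemma gap_barrier c1 c2 m w wx wy M p q : 0 <= M ->
  harm (gap_nbhd c1 c2 m) w wx wy ->
  (forall z, gap_nbhd c1 c2 m z -> w z <= M) ->
  vanishes_at (gap_nbhd c1 c2 m) w c1 -> vanishes_at (gap_nbhd c1 c2 m) w c2 ->
  sqdist q c1 = 1 -> sqdist q m <= (23 / 20) ^+ 2 ->
  gap_nbhd c1 c2 m p -> sqdist p q < (1 / 20) ^+ 2 ->
  w p <= M / ln (1 + 2 * (1 / 20) ^+ 2) * (2 * (sqdist p c1 - 1) + 2 * sqdist p q).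
Proof.
set G := gap_nbhd c1 c2 m => M0 H wM v1 v2 qc qm Gp pq.
pose L : R := ln (1 + 2 * (1 / 20) ^+ 2).
have L0 : 0 < L by apply: ln_gt0; lra.
pose c' := ((c1.1 + q.1) / 2, (c1.2 + q.2) / 2).
pose beta z := ln (4 : R) + ln (sqdist z c').
have Gc' z : G z -> 0 < sqdist z c'.
  move=> [z1 _ _]; have := tangent_barrierE z qc; rewrite -/c'.
  by have := sqdist_ge0 z q; lra.
have betaE z : G z -> beta z = ln (1 + 2 * (sqdist z c1 - 1) + 2 * sqdist z q).
  by move=> Gz; rewrite /beta -lnM ?posrE ?Gc'// tangent_barrierE.
have beta_ge z : G z -> ln (1 + 2 * sqdist z q) <= beta z.
  move=> Gz; rewrite betaE // ler_ln ?posrE; have [z1 _ _] := Gz; have := sqdist_ge0 z q; lra.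
pose D := G `&` [set z | sqdist z q < (1 / 20) ^+ 2].
have HD : exists fx fy, harm D (fun z => w z - M / L * beta z) fx fy.
  do 2 eexists; apply: harmB; first by apply: harm_sub H => z [].
  apply: harmZ; apply: harmD; first exact: harm_cst.
  by apply: harm_log => z [/Gc'].
have [fx [fy {}HD]] := HD.
have key : forall z, D z -> w z - M / L * beta z <= 0.
  pose X := Num.max `|q.1| `|q.2| + 1.
  have oD : open D by apply: openI; [exact: open_gap_nbhd|exact: open_sqdist_lt].
  apply: (@harm_max_bounded _ D _ fx fy X) => //.
    move=> z [_ /=]; rewrite /sqdist => zq.
    have bnd (a b : R) : a ^+ 2 + b ^+ 2 < (1/20) ^+ 2 -> `|a| <= 1.
      move=> h; have := sqr_ge0 b; rewrite ler_norml => hb; apply/andP; split; nra.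
    have h1 := bnd _ _ zq; rewrite addrC in zq; have h2 := bnd _ _ zq.
    have := ler_normD (z.1 - q.1) q.1; have := ler_normD (z.2 - q.2) q.2.
    have : `|q.1| <= Num.max `|q.1| `|q.2| by rewrite le_max lexx.
    have : `|q.2| <= Num.max `|q.1| `|q.2| by rewrite le_max lexx orbT.
    by rewrite !subrK /X; lra.
  move=> z nDz e e0.
  have [zq|zq] := ltP (sqdist z q) ((1 / 20) ^+ 2); last first.
    (* This majorant of the difference is continuous on the whole plane and nonpositive outside the
       ball, so points of the sphere are treated alike whether or not they lie on one of the
       circles. *)
    pose f u := M * (1 - L^-1 * ln (1 + 2 * sqdist u q)).
    have cf : {for z, continuous f}.
      apply: cvgMr; apply: cvgB; first exact: cvg_cst.
      apply: cvgMr; apply: continuous_comp.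
        by apply: cvgD; [exact: cvg_cst|apply: cvgMr; exact: continuous_sqdist].
      by apply: continuous_ln; have := sqdist_ge0 z q; lra.
    have fz : f z <= 0.
      apply: (mulr_ge0_le0 M0); rewrite subr_le0 ler_pdivlMl // mulr1 /L ler_ln ?posrE; lra.
    have := near_le_continuous cf fz e0; apply: filterS => u fu [Gu _].
    have := wM _ Gu; have := beta_ge _ Gu; rewrite /f in fu => h1 h2.
    have : M / L * ln (1 + 2 * sqdist u q) <= M / L * beta u by rewrite ler_wpM2l // divr_ge0 // ltW.
    by move: fu; rewrite mulrBr mulr1 mulrA; lra.
  have zm : sqdist z m < (6 / 5) ^+ 2.
    have -> : 6 / 5 = 1 / 20 + 23 / 20 :> R by lra.
    by apply: (sqdist_triangle_lt _ _ zq qm); lra.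
  have boundary c : vanishes_at G w c -> sqdist z c = 1 -> \forall p \near z, D p -> w p - M / L * beta p <= e.
    move=> vc zc; have := vc z zc e e0; apply: filterS => u hu [Gu _].
    have := hu Gu; rewrite ler_norml => /andP[_ we].
    have : 0 <= M / L * beta u.
      apply: mulr_ge0; first by apply: divr_ge0 => //; exact: ltW.
      apply: (le_trans _ (beta_ge _ Gu)).
      by apply: ln_ge0; have := sqdist_ge0 u q; lra.
    by lra.
  have inside c : sqdist z c < 1 -> (forall u, G u -> 1 < sqdist u c) ->
      \forall p \near z, D p -> w p - M / L * beta p <= e.
    move=> zc Gc; have := @near_notin_closed _ _ z (@open_sqdist_lt c 1) zc; apply.
    by move=> u /= uc [/Gc]; lra.
  have [z1|z1|z1] := ltgtP (sqdist z c1) 1; first by apply: inside z1 _ => u [].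
    have [z2|z2|z2] := ltgtP (sqdist z c2) 1; first by apply: inside z2 _ => u [].
      by exfalso; apply: nDz; split.
    exact: boundary v2 z2.
  exact: boundary v1 z1.
have := key p (conj Gp pq); rewrite subr_le0 => /le_trans; apply.
rewrite -/L ler_wpM2l ?divr_ge0 ?(ltW L0)// betaE // -addrA.
by apply: le_ln1Dx; have [? _ _] := Gp; have := sqdist_ge0 p q; lra.
Qed.

Lemma sqdist_square z p h : `|z.1 - p.1| < h / 2 -> `|z.2 - p.2| < h / 2 -> sqdist z p < h ^+ 2.
Proof. by rewrite /sqdist !ltr_norml => /andP[? ?] /andP[? ?]; nra. Qed.

Lemma sqdist_gt1 z p c h : 0 <= h -> (1 + h) ^+ 2 <= sqdist p c -> sqdist z p < h ^+ 2 -> 1 < sqdist z c.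
Proof.
move=> h0 pc zp; rewrite ltNge; apply/negP => zc.
have pz : sqdist p z < h ^+ 2 by rewrite sqdistC.
have z1 : sqdist z c <= 1 ^+ 2 by rewrite expr1n.
by have := sqdist_triangle_lt h0 ler01 pz z1; rewrite addrC ltNge pc.
Qed.

(** [h] is the distance from [p] to the nearer circle and [q] the radial projection of [p] on it. On
    a square of half side [h / 2] about [p] the barrier at [q] gives [|w| <= 9 h M / L], and the
    interior estimate divides by [h / 2]: the factors [h] cancel and leave [72 M / L]. *)
Lemma gap_grad_near c1 c2 m w wx wy M p (h : R) :
  harm (gap_nbhd c1 c2 m) w wx wy ->
  (forall z, gap_nbhd c1 c2 m z -> `|w z| <= M) ->
  vanishes_at (gap_nbhd c1 c2 m) w c1 -> vanishes_at (gap_nbhd c1 c2 m) w c2 ->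
  0 < h <= 1 / 40 -> sqdist p c1 = (1 + h) ^+ 2 -> (1 + h) ^+ 2 <= sqdist p c2 ->
  sqdist p m <= (11 / 10) ^+ 2 ->
  `|wx p| <= 72 * (M / ln (1 + 2 * (1 / 20) ^+ 2)) /\
  `|wy p| <= 72 * (M / ln (1 + 2 * (1 / 20) ^+ 2)).
Proof.
set G := gap_nbhd c1 c2 m; set L := ln _ => H wM v1 v2 /andP[h0 h1] pc1 pc2 pm.
have L0 : 0 < L by apply: ln_gt0; lra.
have Gz z : sqdist z p < h ^+ 2 -> G z.
  move=> zp; split; [by apply: (sqdist_gt1 (ltW h0) _ zp); rewrite pc1|exact: (sqdist_gt1 (ltW h0) pc2 zp)|].
  have -> : 6 / 5 = 1 / 10 + 11 / 10 :> R by lra.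
  apply: (sqdist_triangle_lt _ _ _ pm); [lra..|].
  by apply: (lt_le_trans zp); rewrite lerXn2r ?nnegrE; lra.
have Gp : G p by apply: Gz; rewrite /sqdist !subrr expr0n /= addr0 exprn_gt0.
have M0 : 0 <= M by apply: le_trans (wM _ Gp).
pose q := (c1.1 + (p.1 - c1.1) / (1 + h), c1.2 + (p.2 - c1.2) / (1 + h)).
have h1n0 : 1 + h != 0 by lra.
have qc1 : sqdist q c1 = 1.
  have -> : sqdist q c1 = sqdist p c1 / (1 + h) ^+ 2 by rewrite /sqdist /q /=; field.
  by rewrite pc1 divff // expf_neq0.
have pq : sqdist p q = h ^+ 2.
  have -> : sqdist p q = sqdist p c1 * h ^+ 2 / (1 + h) ^+ 2 by rewrite /sqdist /q /=; field.
  by rewrite pc1; field.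
have qm : sqdist q m <= (23 / 20) ^+ 2.
  have -> : 23 / 20 = 1 / 20 + 11 / 10 :> R by lra.
  apply: (sqdist_triangle _ _ _ pm); [lra..|].
  by rewrite sqdistC pq lerXn2r ?nnegrE; lra.
have -> : 72 * (M / L) = 4 * (M / L * (9 * h)) / (h / 2) by field; rewrite !gt_eqF.
apply: (harm_grad (G := G) _ H); first by rewrite divr_gt0.
move=> x y hx hy.
have zp : sqdist (x, y) p < h ^+ 2 by exact: sqdist_square.
split; first exact: Gz.
have zq : sqdist (x, y) q < (h + h) ^+ 2.
  by apply: (sqdist_triangle_lt _ _ zp); rewrite ?pq // ltW.
have zc1 : sqdist (x, y) c1 < (h + (1 + h)) ^+ 2.
  by apply: (sqdist_triangle_lt _ _ zp); rewrite ?pc1 //; lra.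
have zq20 : sqdist (x, y) q < (1 / 20) ^+ 2.
  by apply: (lt_le_trans zq); rewrite lerXn2r ?nnegrE; lra.
have est : M / L * (2 * (sqdist (x, y) c1 - 1) + 2 * sqdist (x, y) q) <= M / L * (9 * h).
  by rewrite ler_wpM2l ?divr_ge0 ?(ltW L0)//; nra.
have NG : harm G (fun p => -1 * w p) (fun p => -1 * wx p) (fun p => -1 * wy p) by exact: harmZ.
have vN c : vanishes_at G w c -> vanishes_at G (fun p => -1 * w p) c.
  by move=> vc u uc e e0; have := vc u uc e e0; apply: filterS => u' + Gu' => /(_ Gu'); rewrite mulN1r normrN.
rewrite ler_norml; apply/andP; split.
  rewrite lerNl -mulN1r; apply: (le_trans _ est).
  apply: (gap_barrier M0 NG _ (vN _ v1) (vN _ v2) qc1 qm _ zq20); last exact: Gz.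
  by move=> z /wM; rewrite mulN1r ler_norml => /andP[]; lra.
apply: (le_trans _ est); apply: (gap_barrier M0 H _ v1 v2 qc1 qm _ zq20); last exact: Gz.
by move=> z /wM; rewrite ler_norml => /andP[].
Qed.

Lemma sqdist_radius p c : 1 < sqdist p c -> exists2 h : R, 0 < h & sqdist p c = (1 + h) ^+ 2.
Proof.
move=> pc; exists (Num.sqrt (sqdist p c) - 1); last by rewrite addrC subrK sqr_sqrtr ?sqdist_ge0.
by rewrite subr_gt0 -sqrtr1 ltr_sqrt // (lt_trans ltr01).
Qed.

Lemma gap_grad_far c1 c2 m w wx wy M p (h h1 h2 : R) :
  harm (gap_nbhd c1 c2 m) w wx wy ->
  (forall z, gap_nbhd c1 c2 m z -> `|w z| <= M) ->
  0 < h <= 1 / 40 -> h <= h1 -> h <= h2 -> sqdist p c1 = (1 + h1) ^+ 2 -> sqdist p c2 = (1 + h2) ^+ 2 ->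
  sqdist p m <= (11 / 10) ^+ 2 ->
  `|wx p| <= 4 * M / (h / 2) /\ `|wy p| <= 4 * M / (h / 2).
Proof.
move=> H wM /andP[h0 h40] hh1 hh2 h1E h2E pm.
apply: (harm_grad _ H) => [|x y hx hy]; first by rewrite divr_gt0.
have zp : sqdist (x, y) p < h ^+ 2 by exact: sqdist_square.
have Gz : gap_nbhd c1 c2 m (x, y).
  split; [apply: (sqdist_gt1 (ltW h0) _ zp)|apply: (sqdist_gt1 (ltW h0) _ zp)|].
  - by rewrite h1E lerXn2r ?nnegrE; lra.
  - by rewrite h2E lerXn2r ?nnegrE; lra.
  have -> : 6 / 5 = 1 / 10 + 11 / 10 :> R by lra.
  apply: (sqdist_triangle_lt _ _ _ pm); [lra..|].
  by apply: (lt_le_trans zp); rewrite lerXn2r ?nnegrE; lra.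
by split => //; exact: wM.
Qed.

Lemma gap_nbhdC c1 c2 m : gap_nbhd c1 c2 m = gap_nbhd c2 c1 m.
Proof. by apply/seteqP; split => z []. Qed.

(** [K] is chosen before the centres, so the estimate is uniform as the gap closes. Points within
    [1 / 40] of a circle use the barrier on the nearer one; for the others a square of fixed size
    fits, whence the constant [4 / (1 / 80) = 320]. *)
Lemma gap_grad : exists2 K : R, 0 < K & forall c1 c2 m w wx wy M p,
  harm (gap_nbhd c1 c2 m) w wx wy ->
  (forall z, gap_nbhd c1 c2 m z -> `|w z| <= M) ->
  vanishes_at (gap_nbhd c1 c2 m) w c1 -> vanishes_at (gap_nbhd c1 c2 m) w c2 ->
  gap_nbhd c1 c2 m p -> sqdist p m <= (11 / 10) ^+ 2 ->
  `|wx p| <= K * M /\ `|wy p| <= K * M.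
Proof.
have [L L0 LE] : exists2 L : R, 0 < L & L = ln (1 + 2 * (1 / 20) ^+ 2).
  by eexists; last reflexivity; apply: ln_gt0; lra.
pose A : R := 72; pose B : R := 320.
have A0 : 0 < A by exact: ltr0n.
have B0 : 0 < B by exact: ltr0n.
exists (A / L + B) => [|c1 c2 m w wx wy M p H wM v1 v2 Gp pm].
  exact: addr_gt0 (divr_gt0 A0 L0) B0.
have M0 : 0 <= M by apply: le_trans (wM _ Gp).
have AM : 0 <= A / L * M by apply: mulr_ge0 => //; apply: divr_ge0; exact: ltW.
have BM : 0 <= B * M by apply: mulr_ge0 => //; exact: ltW.
have weaken x : `|x| <= A * (M / L) -> `|x| <= (A / L + B) * M.
  by move=> h; apply: (le_trans h); rewrite mulrA mulrAC [leRHS]mulrDl lerDl.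
have weaken' x : `|x| <= 4 * M / (1 / 40 / 2) -> `|x| <= (A / L + B) * M.
  have BE : 4 * M / (1 / 40 / 2) = B * M by rewrite /B; field.
  by move=> h; apply: (le_trans h); rewrite BE [leRHS]mulrDl lerDr.
have [p1 p2 _] := Gp.
have [h1 h10 h1E] := sqdist_radius p1; have [h2 h20 h2E] := sqdist_radius p2.
pose t : R := 1 / 40; have t0 : 0 < t by exact: divr_gt0.
have I40 : 0 < t <= 1 / 40 by rewrite t0 lexx.
have h40 (h : R) : t <= h \/ h <= t by case: (leP h t) => [|/ltW]; [right|left].
case: (leP h1 h2) => [h12|/ltW h21].
  case: (h40 h1) => [hb|hs].
    have hb' := le_trans hb h12.
    by have [/weaken' ? /weaken'] := gap_grad_far H wM I40 hb hb' h1E h2E pm.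
  have h1I : 0 < h1 <= 1 / 40 by rewrite h10.
  have le12 : (1 + h1) ^+ 2 <= sqdist p c2 by rewrite h2E lerXn2r ?nnegrE ?addr_ge0 ?lerD2l// ltW.
  have := gap_grad_near H wM v1 v2 h1I h1E le12 pm; rewrite -LE.
  by move=> [/weaken ? /weaken].
case: (h40 h2) => [hb|hs].
  have hb' := le_trans hb h21.
  by have [/weaken' ? /weaken'] := gap_grad_far H wM I40 hb' hb h1E h2E pm.
have h2I : 0 < h2 <= 1 / 40 by rewrite h20.
have le21 : (1 + h2) ^+ 2 <= sqdist p c1 by rewrite h1E lerXn2r ?nnegrE ?addr_ge0 ?lerD2l// ltW.
rewrite gap_nbhdC in H wM v1 v2.
have := gap_grad_near H wM v2 v1 h2I h2E le21 pm; rewrite -LE.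
by move=> [/weaken ? /weaken].
Qed.

End LocalGradient.

(** * The bipolar potential of two unit disks *)

Section Bipolar.
Variable R : realType.
Implicit Types (p q z : R * R) (a c d e h k l r s t x y : R).

(** Here and in the next lemma the two sides agree at 1 and their difference has a derivative with a
    perfect square as numerator. The two bounds are sharp enough to enclose [lnfoc] within a factor
    [1 + e / 4]. *)
Lemma ln_le_sinh k : 1 <= k -> ln k <= (k - k^-1) / 2.
Proof.
rewrite le_eqVlt => /orP[/eqP<-|k1]; first by rewrite ln1 invr1 subrr mul0r.
pose f x := (x - x^-1) / 2 - ln x; pose df x := (1 - x^-1) ^+ 2 / 2.
have [|c [/andP[c1 c2] E]] := @mean_value _ f df 1 k k1.
  move=> x /andP[x1 _]; have x0 : 0 < x by lra.
  have xn0 : x != 0 by rewrite gt_eqF.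
  have h1 := is_deriveV xn0 (@is_derive_id _ _ x (1 : R)).
  have h2 : is_derive x 1 (fun t => (t - t^-1) / 2) ((1 + x^-1 ^+ 2) / 2).
    have := is_deriveZ (2^-1 : R) (is_deriveB (@is_derive_id _ _ x (1 : R)) h1).
    rewrite (_ : _ \*: _ = (fun t => (t - t^-1) / 2)); last by apply/funext => t /=; rewrite mulrC.
    by move/is_derive_eq; apply; rewrite /GRing.scale /=; field.
  have := is_deriveB h2 (is_derive1_ln x0).
  by move/is_derive_eq; apply; rewrite /df; field.
have f1 : f 1 = 0 by rewrite /f ln1 invr1; lra.
have : 0 <= df c * (k - 1) by rewrite mulr_ge0 ?divr_ge0 ?sqr_ge0 ?subr_ge0// ltW.
by rewrite -E f1 subr0 /f subr_ge0.
Qed.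

Lemma ln_ge_ratio k : 1 <= k -> 2 * (k - 1) / (k + 1) <= ln k.
Proof.
rewrite le_eqVlt => /orP[/eqP<-|k1]; first by rewrite ln1 subrr mulr0 mul0r.
pose f x := ln x + 4 / (x + 1); pose df x := (x - 1) ^+ 2 / (x * (x + 1) ^+ 2).
have [|c [/andP[c1 c2] E]] := @mean_value _ f df 1 k k1.
  move=> x /andP[x1 _]; have x0 : 0 < x by lra.
  have xn0 : x + 1 != 0 by rewrite gt_eqF; lra.
  have h0 : is_derive x 1 (fun t => t + 1) 1 by apply: is_derive_eq; rewrite addr0.
  have h1 := @is_deriveV _ (fun t => t + 1) _ _ _ xn0 h0.
  have := is_deriveD (is_derive1_ln x0) (is_deriveZ (4 : R) h1).
  by move/is_derive_eq; apply; rewrite /df /GRing.scale /=; field; rewrite xn0 gt_eqF.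
have f1 : f 1 = 2 by rewrite /f ln1; field.
have : 0 <= df c * (k - 1).
  rewrite mulr_ge0 ?subr_ge0 ?(ltW k1)// divr_ge0 ?sqr_ge0// mulr_ge0 ?sqr_ge0//; lra.
rewrite -E f1 /f; have -> : 2 * (k - 1) / (k + 1) = 2 - 4 / (k + 1) by field; rewrite gt_eqF; lra.
by lra.
Qed.

Definition focus e : R := Num.sqrt (e + e ^+ 2 / 4).
Definition lnfoc e : R := ln (1 + e / 2 + focus e).
(* The limit points of the pencil of circles spanned by the two unit circles centered at (1 + e / 2, 0) and (- 1 - e / 2, 0) are (focus e, 0) and (- focus e, 0); the normalization makes bip equal to 1 and - 1 on these circles. *)
Definition bip e z : R :=
  (ln (sqdist z (- focus e, 0)) - ln (sqdist z (focus e, 0))) / (2 * lnfoc e).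
Definition bipx e z : R :=
  ((z.1 + focus e) / sqdist z (- focus e, 0) - (z.1 - focus e) / sqdist z (focus e, 0)) / lnfoc e.
Definition bipy e z : R :=
  (z.2 / sqdist z (- focus e, 0) - z.2 / sqdist z (focus e, 0)) / lnfoc e.

Lemma focusE e : 0 < e -> focus e ^+ 2 = e + e ^+ 2 / 4.
Proof. by move=> e0; rewrite sqr_sqrtr // addr_ge0 ?divr_ge0 ?sqr_ge0// ltW. Qed.

Lemma focus_gt0 e : 0 < e -> 0 < focus e.
Proof. by move=> e0; rewrite sqrtr_gt0 addr_gt0 // divr_gt0 // exprn_gt0. Qed.

(** With [k = 1 + e / 2 + focus e] one has [k^-1 = 1 + e / 2 - focus e], so that
    [(k - k^-1) / 2 = focus e], and [2 (k - 1) / (k + 1)] equals [focus e / (1 + e / 4)] because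
    [focus e ^ 2 = e + e^2 / 4]. *)
Lemma lnfoc_bounds e : 0 < e -> focus e / (1 + e / 4) <= lnfoc e <= focus e.
Proof.
move=> e0; have p0 := focus_gt0 e0; have pE := focusE e0; rewrite /lnfoc.
set k := 1 + e / 2 + focus e; have k1 : 1 <= k by rewrite /k; lra.
have kk : k * (1 + e / 2 - focus e) = 1 by rewrite /k; lra.
have k0 : 0 < k by lra.
have kV : k^-1 = 1 + e / 2 - focus e.
  exact: mulr1_eq.
apply/andP; split; last by apply: (le_trans (ln_le_sinh k1)); rewrite kV /k; lra.
apply: (le_trans _ (ln_ge_ratio k1)).
rewrite ler_pdivrMr ?addr_gt0 ?divr_gt0// mulrAC ler_pdivlMr; last lra.
by rewrite /k; nra.
Qed.

Lemma lnfoc_gt0 e : 0 < e -> 0 < lnfoc e.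
Proof.
move=> e0; have /andP[h _] := lnfoc_bounds e0; apply: lt_le_trans h.
by rewrite divr_gt0 ?focus_gt0// addr_gt0 // divr_gt0.
Qed.

(** The power of [z] with respect to the right circle plus a multiple of [z.1], the equation of the
    radical axis: the focus is a degenerate circle of the pencil. *)
Lemma sqdist_focusN e z : 0 < e -> sqdist z (- focus e, 0) =
  sqdist z (1 + e / 2, 0) - 1 + 2 * (1 + e / 2 + focus e) * z.1.
Proof. by move=> e0; have pE := focusE e0; rewrite /sqdist /= subr0; lra. Qed.

Lemma sqdist_focus e z : 0 < e -> sqdist z (focus e, 0) =
  sqdist z (1 + e / 2, 0) - 1 + 2 * (1 + e / 2 - focus e) * z.1.
Proof. by move=> e0; have pE := focusE e0; rewrite /sqdist /= subr0; lra. Qed.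

Lemma focus_lt e : 0 < e -> e / 2 < focus e < 1 + e / 2.
Proof. by move=> e0; have := focusE e0; have := focus_gt0 e0 => p0 pE; apply/andP; split; nra. Qed.

Lemma sqdist_right_gt0 e z : 1 <= sqdist z (1 + e / 2, 0) -> 0 < e -> z.1 <= 0 -> 1 < sqdist z (1 + e / 2, 0).
Proof. by rewrite /sqdist /= => _ e0 z1; have := sqr_ge0 (z.2 - 0); nra. Qed.

Lemma bip_domain e z : 0 < e -> 1 <= sqdist z (1 + e / 2, 0) -> 1 <= sqdist z (- 1 - e / 2, 0) ->
  0 < sqdist z (focus e, 0) /\ 0 < sqdist z (- focus e, 0).
Proof.
move=> e0; have /andP[f1 f2] := focus_lt e0; have pE := focusE e0.
rewrite /sqdist /= => h1 h2.
have sy := sqr_ge0 (z.2 - 0).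
have [z0|z0] := lerP 0 z.1; split.
- have [|z1] := ltP 0 ((z.1 - focus e) ^+ 2); first lra.
  have : (z.1 - focus e) ^+ 2 = 0 by apply/eqP; rewrite eq_le z1 sqr_ge0.
  move=> /eqP; rewrite sqrf_eq0 subr_eq0 => /eqP zf; rewrite zf in h1 *.
  by nra.
- by have : 0 < (z.1 - - focus e) ^+ 2; [rewrite exprn_gt0 //; lra|lra].
- by have : 0 < (z.1 - focus e) ^+ 2; [rewrite -sqrrN exprn_gt0 //; lra|lra].
- have [|z1] := ltP 0 ((z.1 - - focus e) ^+ 2); first lra.
  have : (z.1 - - focus e) ^+ 2 = 0 by apply/eqP; rewrite eq_le z1 sqr_ge0.
  move=> /eqP; rewrite sqrf_eq0 subr_eq0 => /eqP zf; rewrite zf in h2 *.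
  by nra.
Qed.

Lemma harm_bip e (G : set (R * R)) : 0 < e ->
  (forall z, G z -> 1 < sqdist z (1 + e / 2, 0) /\ 1 < sqdist z (- 1 - e / 2, 0)) ->
  harm G (bip e) (bipx e) (bipy e).
Proof.
move=> e0 GG; have l0 := lnfoc_gt0 e0.
have dom z : G z -> 0 < sqdist z (focus e, 0) /\ 0 < sqdist z (- focus e, 0).
  by move=> /GG[h1 h2]; apply: bip_domain => //; exact: ltW.
have h1 := @harm_log _ G (- focus e, 0) (fun z Gz => (dom z Gz).2).
have h2 := @harm_log _ G (focus e, 0) (fun z Gz => (dom z Gz).1).
apply: (harm_ext (harmZ (2 * lnfoc e)^-1 (harmB h1 h2))) => z /=.
- by rewrite /bip mulrC.
- rewrite /bipx opprK invfM; set i := (sqdist z (- _, _))^-1; set j := (sqdist z _)^-1.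
  by set l := (lnfoc e)^-1; field.
- rewrite /bipy !subr0 invfM; set i := (sqdist z (- _, _))^-1; set j := (sqdist z _)^-1.
  by set l := (lnfoc e)^-1; field.
Qed.

Lemma bip_continuous e z : 0 < e -> 1 <= sqdist z (1 + e / 2, 0) -> 1 <= sqdist z (- 1 - e / 2, 0) ->
  {for z, continuous (bip e)}.
Proof.
move=> e0 h1 h2; have [g1 g2] := bip_domain e0 h1 h2.
apply: cvgM; last exact: cvg_cst.
by apply: cvgB; apply: continuous_comp; rewrite /=; first [exact: continuous_sqdist|exact: continuous_ln].
Qed.

Lemma bip_odd e z : bip e (- z.1, z.2) = - bip e z.
Proof.
rewrite /bip -mulNr opprB; congr ((ln _ - ln _) / _); rewrite /sqdist /=; ring.
Qed.

Lemma bip0 e y : bip e (0, y) = 0.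
Proof. by rewrite /bip /sqdist /= !sub0r !opprK sqrrN subrr mul0r. Qed.

(** On the circle the power vanishes, and the squared distances to the foci are [2 x k] and
    [2 x / k] with [k = 1 + e / 2 + focus e]; the difference of their logarithms is [2 ln k]. *)
Lemma bip_circle e z : 0 < e -> sqdist z (1 + e / 2, 0) = 1 -> bip e z = 1.
Proof.
move=> e0 z1; have l0 := lnfoc_gt0 e0; rewrite /bip sqdist_focusN // sqdist_focus // z1 subrr !add0r.
have x0 : 0 < z.1.
  by rewrite ltNge; apply/negP => h; have := @sqdist_right_gt0 e z; rewrite z1 ltxx => /(_ (lexx _) e0 h).
have /andP[f1 f2] := focus_lt e0; have f0 := focus_gt0 e0.
have pE := focusE e0.
have k0 : 0 < 1 + e / 2 + focus e by lra.
have k0' : 0 < 1 + e / 2 - focus e by lra.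
rewrite !(mulrC 2) -!mulrA !lnM ?posrE ?mulr_gt0// opprD addrACA subrr addr0.
have -> : 1 + e / 2 - focus e = (1 + e / 2 + focus e)^-1.
  by apply/esym/mulr1_eq; lra.
by rewrite lnV ?posrE // opprK -/(lnfoc e); field; rewrite gt_eqF.
Qed.

Lemma bip_ge0 e z : 0 < e -> 0 <= z.1 -> 1 <= sqdist z (1 + e / 2, 0) -> 0 <= bip e z.
Proof.
move=> e0 z0 z1; have l0 := lnfoc_gt0 e0; have f0 := focus_gt0 e0.
have z2 : 1 <= sqdist z (- 1 - e / 2, 0).
  by apply: (le_trans z1); rewrite /sqdist /=; nra.
have [g1 g2] := bip_domain e0 z1 z2.
rewrite /bip divr_ge0 ?mulr_ge0 ?(ltW l0)// subr_ge0 ler_ln ?posrE//.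
by rewrite /sqdist /=; nra.
Qed.

(* With s = (|z - c|^2 - 1) / (2 x), the distances to the two foci are in the ratio (s + c + p) / (s + c - p), and (c + p)(c - p) = 1. *)
Lemma bip_compl e z (s := (sqdist z (1 + e / 2, 0) - 1) / (2 * z.1)) :
  0 < e -> 0 < z.1 -> 1 <= sqdist z (1 + e / 2, 0) ->
  1 - bip e z = ln (1 + 2 * focus e * s / (1 + s * (1 + e / 2 - focus e))) / (2 * lnfoc e).
Proof.
move=> e0 x0 z1; have l0 := lnfoc_gt0 e0; have f0 := focus_gt0 e0; have pE := focusE e0.
have /andP[f1 f2] := focus_lt e0.
have s0 : 0 <= s by rewrite divr_ge0 ?subr_ge0 // mulr_ge0 // ltW.
have N : sqdist z (- focus e, 0) = 2 * z.1 * (s + (1 + e / 2 + focus e)).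
  by rewrite sqdist_focusN // /s; field; rewrite gt_eqF.
have D : sqdist z (focus e, 0) = 2 * z.1 * (s + (1 + e / 2 - focus e)).
  by rewrite sqdist_focus // /s; field; rewrite gt_eqF.
have k0 : 0 < 1 + e / 2 + focus e by lra.
have k0' : 0 < 1 + e / 2 - focus e by lra.
have kk : (1 + e / 2 + focus e) * (1 + e / 2 - focus e) = 1 by lra.
have fk : 2 * focus e = 1 + e / 2 + focus e - (1 + e / 2 - focus e) by lra.
set k := 1 + e / 2 + focus e in N k0 kk fk *; set k' := 1 + e / 2 - focus e in D k0' kk fk *.
have sk : 0 < s + k by lra.
have sk' : 0 < s + k' by lra.
have x2 : 0 < 2 * z.1 by lra.
have sk1 : 0 < 1 + s * k by rewrite ltr_wpDr // mulr_ge0 // ltW.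
have sk1' : 0 < 1 + s * k' by rewrite ltr_wpDr // mulr_ge0 // ltW.
have E1 : 1 + 2 * focus e * s / (1 + s * k') = k ^+ 2 * ((s + k') / (s + k)).
  have -> : 1 + 2 * focus e * s / (1 + s * k') = (1 + s * k) / (1 + s * k').
    by rewrite fk; field; rewrite gt_eqF.
  have -> : 1 + s * k = k * (s + k') by rewrite -[X in X + _ = _]kk; ring.
  have -> : 1 + s * k' = k' * (s + k) by rewrite -[X in X + _ = _]kk; ring.
  have kV : k' = k^-1 by apply/esym/mulr1_eq.
  by rewrite [X in _ / (X * _)]kV; field; rewrite !gt_eqF.
rewrite E1 lnM ?posrE ?exprn_gt0 ?divr_gt0// lnXn // ln_div ?posrE// /bip N D !lnM ?posrE//.
by rewrite -/(lnfoc e); field; rewrite gt_eqF.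
Qed.

Lemma bip_compl_ge0 e z : 0 < e -> 0 < z.1 -> 1 <= sqdist z (1 + e / 2, 0) -> 0 <= 1 - bip e z.
Proof.
move=> e0 x0 z1; rewrite bip_compl //; have l0 := lnfoc_gt0 e0; have f0 := focus_gt0 e0.
have /andP[f1 f2] := focus_lt e0.
set s := _ / (2 * z.1); have s0 : 0 <= s by rewrite divr_ge0 ?subr_ge0 // mulr_ge0 // ltW.
have d1 : 0 <= 1 + s * (1 + e / 2 - focus e) by rewrite addr_ge0 // mulr_ge0 //; lra.
have fs : 0 <= 2 * focus e * s by apply: mulr_ge0 => //; apply: mulr_ge0 => //; exact: ltW.
apply: divr_ge0; last by apply: mulr_ge0 => //; exact: ltW.
by apply: ln_ge0; rewrite lerDl; exact: divr_ge0.
Qed.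

(** From [ln (1 + X) <= X] and [focus e <= 2 lnfoc e]. The division by [z.1] carries the whole
    concentration in the gap, where [z.1] is as small as [e / 2]. *)
Lemma bip_compl_le e z : 0 < e <= 1 -> 0 < z.1 -> 1 <= sqdist z (1 + e / 2, 0) ->
  1 - bip e z <= (sqdist z (1 + e / 2, 0) - 1) / z.1.
Proof.
move=> /andP[e0 e1] x0 z1; rewrite bip_compl //; have l0 := lnfoc_gt0 e0; have f0 := focus_gt0 e0.
have /andP[f1 f2] := focus_lt e0; have /andP[l1 _] := lnfoc_bounds e0.
set s := _ / (2 * z.1); have s0 : 0 <= s by rewrite divr_ge0 ?subr_ge0 // mulr_ge0 // ltW.
have -> : (sqdist z (1 + e / 2, 0) - 1) / z.1 = 2 * s by rewrite /s; field; rewrite gt_eqF.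
rewrite ler_pdivrMr ?mulr_gt0//.
have d1 : 1 <= 1 + s * (1 + e / 2 - focus e) by rewrite lerDl mulr_ge0 //; lra.
have fs : 0 <= 2 * focus e * s by apply: mulr_ge0 => //; apply: mulr_ge0 => //; exact: ltW.
have q0 : 0 <= 2 * focus e * s / (1 + s * (1 + e / 2 - focus e)) by apply: divr_ge0 => //; lra.
apply: (le_trans (le_ln1Dx _)); first lra.
apply: (@le_trans _ _ (2 * focus e * s)); first by rewrite ler_pdivrMr ?ler_peMr //; lra.
have : focus e <= 2 * lnfoc e.
  move: l1; rewrite ler_pdivrMr ?addr_gt0 ?divr_gt0//; nra.
by nra.
Qed.

(** The converse of the previous bound up to a factor 4, from [X / (1 + X) <= ln (1 + X)]. The
    restriction on [s] keeps the denominator [1 + s (k' + 2 focus e)] below 2. *)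
Lemma bip_compl_lower e z : 0 < e <= 1 -> 0 < z.1 -> 1 <= sqdist z (1 + e / 2, 0) ->
  (sqdist z (1 + e / 2, 0) - 1) / (2 * z.1) <= 1 / 4 ->
  (sqdist z (1 + e / 2, 0) - 1) / (4 * z.1) <= 1 - bip e z.
Proof.
move=> /andP[e0 e1] x0 z1; rewrite bip_compl //; have l0 := lnfoc_gt0 e0; have f0 := focus_gt0 e0.
have /andP[f1 f2] := focus_lt e0; have /andP[_ l1] := lnfoc_bounds e0; have pE := focusE e0.
set s := _ / (2 * z.1); have s0 : 0 <= s by rewrite divr_ge0 ?subr_ge0 // mulr_ge0 // ltW.
have -> : (sqdist z (1 + e / 2, 0) - 1) / (4 * z.1) = s / 2 by rewrite /s; field; rewrite gt_eqF.
move=> s4; rewrite ler_pdivlMr ?mulr_gt0//.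
set k' := 1 + e / 2 - focus e; have k'0 : 0 < k' by rewrite /k'; lra.
have sk' : 0 < 1 + s * k' by rewrite ltr_wpDr // mulr_ge0 // ltW.
have sk : 0 < 1 + s * (k' + 2 * focus e) by rewrite ltr_wpDr // mulr_ge0 //; lra.
set X := 2 * focus e * s / (1 + s * k').
have fs : 0 <= 2 * focus e * s by apply: mulr_ge0 => //; apply: mulr_ge0 => //; exact: ltW.
have X0 : 0 <= X by apply: divr_ge0 => //; exact: ltW.
have lnX : X / (1 + X) <= ln (1 + X).
  have := @le_ln1Dx R (- (X / (1 + X))); have X1 : 0 < 1 + X by lra.
  have E : 1 + - (X / (1 + X)) = (1 + X)^-1 by field; rewrite gt_eqF.
  rewrite E lnV ?posrE // => h; rewrite -lerN2; apply: h.
  by rewrite -subr_gt0 opprK addrC E invr_gt0.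
apply: le_trans lnX.
have -> : X / (1 + X) = 2 * focus e * s / (1 + s * (k' + 2 * focus e)).
  by rewrite /X; field; apply/andP; split; rewrite gt_eqF //; lra.
rewrite ler_pdivlMr //.
have h2 : s * (k' + 2 * focus e) <= 1.
  have : k' + 2 * focus e <= 3 by rewrite /k'; nra.
  by nra.
have h3 : s / 2 * (2 * lnfoc e) <= s * focus e by nra.
have h4 : 0 <= s / 2 * (2 * lnfoc e) by apply: mulr_ge0; [exact: divr_ge0|apply: mulr_ge0 => //; exact: ltW].
by nra.
Qed.

(** [Q] is the product of the squared distances to the two foci, expanded in powers of [z.1], the
    small coordinate in a gap. *)
Lemma bip_grad_formula e z (p := focus e) (Q := (p ^+ 2 + z.2 ^+ 2) ^+ 2 + z.1 ^+ 4 + 2 * z.1 ^+ 2 * (z.2 ^+ 2 - p ^+ 2)) :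
  0 < e -> 1 <= sqdist z (1 + e / 2, 0) -> 1 <= sqdist z (- 1 - e / 2, 0) ->
  bipx e z = 2 * (p / lnfoc e) * ((p ^+ 2 + z.2 ^+ 2 - z.1 ^+ 2) / Q) /\
  bipy e z = - (4 * (p / lnfoc e) * (z.1 * z.2 / Q)).
Proof.
move=> e0 h1 h2; have l0 := lnfoc_gt0 e0.
have [g1 g2] := bip_domain e0 h1 h2.
have QE : Q = sqdist z (focus e, 0) * sqdist z (- focus e, 0).
  by rewrite /Q /p /sqdist /=; ring.
have n1 : sqdist z (focus e, 0) != 0 by rewrite gt_eqF.
have n2 : sqdist z (- focus e, 0) != 0 by rewrite gt_eqF.
have nl : lnfoc e != 0 by rewrite gt_eqF.
rewrite /bipx /bipy QE -/p; split.
- have -> : p ^+ 2 + z.2 ^+ 2 - z.1 ^+ 2 = ((z.1 + p) * sqdist z (p, 0) - (z.1 - p) * sqdist z (- p, 0)) / (2 * p).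
    by rewrite /sqdist /=; field; rewrite gt_eqF //; exact: focus_gt0.
  by field; rewrite nl n1 n2 gt_eqF //; exact: focus_gt0.
- have -> : z.1 * z.2 = (z.2 * sqdist z (- p, 0) - z.2 * sqdist z (p, 0)) / (4 * p).
    by rewrite /sqdist /=; field; rewrite gt_eqF //; exact: focus_gt0.
  by field; rewrite nl n1 n2 gt_eqF //; exact: focus_gt0.
Qed.

(** Here [s] runs across the gap and [t] along it, [A] stands for [focus e ^ 2 + t^2] and [k] for
    [focus e / lnfoc e]. Since [|s| <= a <= A], [Q] differs from [A^2] by at most [3 A^3], and
    [k - 1] is at most [A / 4]: terms of size [1 / A] undergo a relative error of order [A], so the
    absolute error stays bounded as [e] tends to 0. *)
Lemma bipx_approx_aux (A a e s t k Q : R) : 0 < e <= 1 / 5 -> a = e + t ^+ 2 -> A = a + e ^+ 2 / 4 ->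
  `|s| <= a -> A <= 1 -> 1 <= k <= 1 + e / 4 ->
  Q = A ^+ 2 + s ^+ 4 + 2 * s ^+ 2 * (t ^+ 2 - (e + e ^+ 2 / 4)) ->
  `|2 * k * ((A - s ^+ 2) / Q) - 2 / a| <= 20 /\
  `|4 * k * (s * t / Q) - 4 * s * t / a ^+ 2| <= 32.
Proof.
move=> /andP[e0 e5] aE AE sa A1 /andP[k1 k2] QE.
have t20 := sqr_ge0 t.
have ea : e <= a by lra.
have a0 : 0 < a by lra.
have aA : a <= A by rewrite AE; have := sqr_ge0 e; lra.
have A0 : 0 < A by lra.
have s2a : s ^+ 2 <= a ^+ 2.
  by rewrite -(real_normK (num_real s)) lerXn2r ?nnegrE // ltW.
have s20 := sqr_ge0 s.
have s2A : s ^+ 2 <= A ^+ 2 by apply: (le_trans s2a); apply: lerXn2r => //; rewrite nnegrE ltW.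
have AA : A ^+ 2 <= A by nra.
have p4 : e + e ^+ 2 / 4 <= 1 / 4 by nra.
have p0 : 0 <= e + e ^+ 2 / 4 by nra.
have s4 : 0 <= s ^+ 4 <= A ^+ 3.
  have -> : s ^+ 4 = (s ^+ 2) ^+ 2 by rewrite -exprM.
  apply/andP; split; first exact: sqr_ge0.
  have -> : A ^+ 3 = A * A ^+ 2 by rewrite exprS.
  by nra.
have tp : - A <= t ^+ 2 - (e + e ^+ 2 / 4) <= A by apply/andP; split; lra.
have QA : A ^+ 2 / 2 <= Q.
  rewrite QE; move: s4 => /andP[s4 _].
  have : - (1 / 4) * s ^+ 2 <= s ^+ 2 * (t ^+ 2 - (e + e ^+ 2 / 4)) by nra.
  lra.
have A2p : 0 < A ^+ 2 by rewrite exprn_gt0.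
have Q0 : 0 < Q by lra.
have A3 : A ^+ 3 = A * A ^+ 2 by rewrite exprS.
have dQ : `|A ^+ 2 - Q| <= 3 * A ^+ 3.
  rewrite ler_norml; move: s4 => /andP[s4 s4']; move: tp => /andP[tp tp'].
  have h1 : s ^+ 2 * (t ^+ 2 - (e + e ^+ 2 / 4)) <= A ^+ 3 by rewrite A3; nra.
  have h2 : - A ^+ 3 <= s ^+ 2 * (t ^+ 2 - (e + e ^+ 2 / 4)) by rewrite A3; nra.
  by rewrite QE; apply/andP; split; lra.
have nA : A != 0 by rewrite gt_eqF.
have nQ : Q != 0 by rewrite gt_eqF.
have na : a != 0 by rewrite gt_eqF.
have Qi : A ^+ 2 / Q <= 2 by rewrite ler_pdivrMr //; lra.
have eAa : `|A^-1 - a^-1| <= 1 / 4.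
  have -> : A^-1 - a^-1 = - ((A - a) / (A * a)) by field; rewrite nA na.
  rewrite (_ : A - a = e ^+ 2 / 4); last by rewrite AE; ring.
  rewrite normrN ger0_norm; last by rewrite !divr_ge0 ?sqr_ge0 ?mulr_ge0 ?ltW.
  by rewrite ler_pdivrMr ?mulr_gt0//; nra.
have kA : `|k - 1| / A <= 1 / 4.
  by rewrite ler_pdivrMr // ger0_norm; lra.
have t1 : `|t| <= 1 by rewrite ler_norml; apply/andP; split; nra.
clear s4 tp p4 p0 aE AE QE; split.
- have E : 2 * k * ((A - s ^+ 2) / Q) - 2 / a =
    2 * k * ((A * (A - s ^+ 2) - Q) / (A * Q)) + 2 * ((k - 1) / A) + 2 * (A^-1 - a^-1).
    by field; rewrite nA nQ na.
  rewrite E; apply: (le_trans (ler_normD _ _)); apply: (le_trans (lerD (ler_normD _ _) (lexx _))).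
  rewrite !normrM normfV (ger0_norm (_ : 0 <= 2)) // (ger0_norm (_ : 0 <= k)); last by clear -k1; lra.
  rewrite (normfV A) (gtr0_norm A0) (gtr0_norm (mulr_gt0 A0 Q0)).
  have h1 : `|A * (A - s ^+ 2) - Q| <= 4 * A ^+ 3.
    have -> : A * (A - s ^+ 2) - Q = (A ^+ 2 - Q) - A * s ^+ 2 by ring.
    apply: (le_trans (ler_normB _ _)); rewrite (ger0_norm (mulr_ge0 (ltW A0) s20)).
    by rewrite A3 in dQ *; clear -dQ s2A A0; nra.
  have h2 : `|A * (A - s ^+ 2) - Q| / (A * Q) <= 8.
    rewrite ler_pdivrMr ?mulr_gt0//; apply: (le_trans h1).
    by rewrite A3; clear -QA A0; nra.
  have h2' : 0 <= `|A * (A - s ^+ 2) - Q| / (A * Q) by rewrite divr_ge0 ?normr_ge0 ?mulr_ge0 ?ltW.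
  have : k * (`|A * (A - s ^+ 2) - Q| / (A * Q)) <= 21 / 20 * 8.
    by apply: ler_pM => //; clear -k1 k2 e5; lra.
  by clear -kA eAa; lra.
- have E : 4 * k * (s * t / Q) - 4 * s * t / a ^+ 2 =
    4 * (k * (s * t * ((A ^+ 2 - Q) / (A ^+ 2 * Q))) + s * t / A * ((k - 1) / A)
      + s * t * (A^-1 - a^-1) * (A^-1 + a^-1)).
    by field; rewrite nA nQ na.
  rewrite E normrM (ger0_norm (_ : 0 <= 4)) //.
  have st : `|s * t| <= a by rewrite normrM; apply: le_trans (ler_piMr _ t1) sa.
  have st0 := normr_ge0 (s * t).
  have b1 : `|k * (s * t * ((A ^+ 2 - Q) / (A ^+ 2 * Q)))| <= 21 / 20 * 6.
    rewrite normrM (ger0_norm (_ : 0 <= k)); last by clear -k1; lra.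
    apply: ler_pM; [clear -k1; lra|exact: normr_ge0|clear -k1 k2 e5; lra|].
    rewrite normrM [`|_ / _|]normrM normfV (gtr0_norm (mulr_gt0 A2p Q0)).
    rewrite mulrA ler_pdivrMr ?mulr_gt0//.
    apply: (@le_trans _ _ (A * (3 * A ^+ 3))); first by apply: ler_pM => //; lra.
    have -> : A * (3 * A ^+ 3) = 3 * A ^+ 2 * A ^+ 2 by ring.
    have : A ^+ 2 * (A ^+ 2 / 2) <= A ^+ 2 * Q by rewrite ler_wpM2l // ltW.
    clear; lra.
  have b2 : `|s * t / A * ((k - 1) / A)| <= 1 / 4.
    rewrite normrM !(normrM _ A^-1) normfV (gtr0_norm A0).
    rewrite -[X in _ <= X]mul1r; apply: ler_pM => //; try by rewrite divr_ge0 ?normr_ge0 ?ltW.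
    by rewrite ler_pdivrMr // mul1r (le_trans st).
  have b3 : `|s * t * (A^-1 - a^-1) * (A^-1 + a^-1)| <= 1 / 2.
    have -> : s * t * (A^-1 - a^-1) * (A^-1 + a^-1) = (A^-1 - a^-1) * (s * t * (A^-1 + a^-1)) by ring.
    rewrite normrM; have -> : 1 / 2 = 1 / 4 * 2 :> R by field.
    apply: ler_pM => //; rewrite normrM (ger0_norm (_ : 0 <= A^-1 + a^-1)); last by rewrite addr_ge0 ?invr_ge0 ?ltW.
    rewrite mulrDr -[leRHS]/(1 + 1).
    by apply: lerD; rewrite ler_pdivrMr // mul1r // (le_trans st).
  have := ler_normD (k * (s * t * ((A ^+ 2 - Q) / (A ^+ 2 * Q))) + s * t / A * ((k - 1) / A)) (s * t * (A^-1 - a^-1) * (A^-1 + a^-1)).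
  have := ler_normD (k * (s * t * ((A ^+ 2 - Q) / (A ^+ 2 * Q)))) (s * t / A * ((k - 1) / A)).
  by clear -b1 b2 b3; lra.
Qed.

Lemma bip_grad_approx e z : 0 < e <= 1 / 5 -> `|z.1| <= e / 2 + z.2 ^+ 2 -> z.2 ^+ 2 <= 3 / 4 ->
  1 <= sqdist z (1 + e / 2, 0) -> 1 <= sqdist z (- 1 - e / 2, 0) ->
  `|bipx e z - 2 / (e + z.2 ^+ 2)| <= 20 /\
  `|bipy e z + 4 * z.1 * z.2 / (e + z.2 ^+ 2) ^+ 2| <= 32.
Proof.
move=> e05 z1 z2 h1 h2; have /andP[e0 e5] := e05.
have [-> ->] := bip_grad_formula e0 h1 h2; rewrite focusE //.
have l0 := lnfoc_gt0 e0; have f0 := focus_gt0 e0; have /andP[l1 l2] := lnfoc_bounds e0.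
have kb : 1 <= focus e / lnfoc e <= 1 + e / 4.
  rewrite ler_pdivlMr // mul1r l2 /= ler_pdivrMr // mulrC -ler_pdivrMr //; lra.
have [|||b1 b2] := @bipx_approx_aux (e + e ^+ 2 / 4 + z.2 ^+ 2) (e + z.2 ^+ 2) e z.1 z.2
    (focus e / lnfoc e) _ e05 erefl _ _ _ kb erefl.
- lra.
- by apply: (le_trans z1); lra.
- nra.
by split => //; rewrite addrC -normrN opprD opprK addrC.
Qed.

End Bipolar.

(** * Integrals of continuous functions *)

Section Integrals.
Variable R : realType.
Implicit Types (f g : R -> R) (a b c d e h k l r s t x y : R).

Definition Rint a b f : R := \int[@lebesgue_measure R]_(x in `[a, b]) f x.

Definition cont_on a b f := forall x, a <= x <= b -> {for x, continuous f}.

Lemma cont_on_within a b f : cont_on a b f -> {within `[a, b], continuous f}.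
Proof.
move=> cf; apply: continuous_in_subspaceT => x; rewrite inE /= in_itv /= => xab.
exact: cf.
Qed.

Lemma cont_on_integrable a b f : cont_on a b f ->
  (@lebesgue_measure R).-integrable `[a, b] (EFin \o f).
Proof.
by move=> /cont_on_within cf; apply: continuous_compact_integrable; [exact: segment_compact|].
Qed.

Lemma cont_onD a b f g : cont_on a b f -> cont_on a b g -> cont_on a b (fun x => f x + g x).
Proof. by move=> cf cg x xab; apply: cvgD; [exact: cf|exact: cg]. Qed.

Lemma cont_onB a b f g : cont_on a b f -> cont_on a b g -> cont_on a b (fun x => f x - g x).
Proof. by move=> cf cg x xab; apply: cvgB; [exact: cf|exact: cg]. Qed.

Lemma cont_onZ a b k f : cont_on a b f -> cont_on a b (fun x => k * f x).
Proof. by move=> cf x xab; apply: cvgMr; exact: cf. Qed.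

Lemma cont_on_cst a b k : cont_on a b (fun=> k).
Proof. by move=> x xab; exact: cvg_cst. Qed.

Lemma cont_on_sub a b c d f : a <= c -> d <= b -> cont_on a b f -> cont_on c d f.
Proof. by move=> ac db cf x /andP[cx xd]; apply: cf; apply/andP; split; lra. Qed.

Lemma RintD a b f g : cont_on a b f -> cont_on a b g ->
  Rint a b (fun x => f x + g x) = Rint a b f + Rint a b g.
Proof. by move=> cf cg; rewrite /Rint RintegralD //; exact: cont_on_integrable. Qed.

Lemma RintB a b f g : cont_on a b f -> cont_on a b g ->
  Rint a b (fun x => f x - g x) = Rint a b f - Rint a b g.
Proof. by move=> cf cg; rewrite /Rint RintegralB //; exact: cont_on_integrable. Qed.

Lemma RintZ a b k f : cont_on a b f -> Rint a b (fun x => k * f x) = k * Rint a b f.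
Proof. by move=> cf; rewrite /Rint RintegralZl //; exact: cont_on_integrable. Qed.

Lemma Rint_cst a b k : a <= b -> Rint a b (fun=> k) = k * (b - a).
Proof.
move=> ab; rewrite /Rint Rintegral_cst //; congr (_ * _).
have := @lebesgue_measure_itv R `[a, b]; rewrite /= lte_fin => ->.
by case: ltgtP ab => //= -> _; rewrite subrr.
Qed.

Lemma le_Rint a b f g : cont_on a b f -> cont_on a b g ->
  (forall x, a <= x <= b -> f x <= g x) -> Rint a b f <= Rint a b g.
Proof.
move=> cf cg fg; apply: le_Rintegral => //.
- exact: (cont_on_integrable cf).
- exact: (cont_on_integrable cg).
Qed.

Lemma eq_Rint a b f g : (forall x, a <= x <= b -> f x = g x) -> Rint a b f = Rint a b g.
Proof.
by move=> fg; apply: eq_Rintegral => x; rewrite inE /= in_itv /=; exact: fg.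
Qed.

Lemma le_norm_Rint a b f k : a <= b -> cont_on a b f ->
  (forall x, a <= x <= b -> `|f x| <= k) -> `|Rint a b f| <= k * (b - a).
Proof.
move=> ab cf fk; rewrite ler_norml -mulNr -!Rint_cst //; apply/andP; split.
  apply: le_Rint => //; first exact: cont_on_cst.
  by move=> x xab; have := fk x xab; rewrite ler_norml => /andP[].
apply: le_Rint => //; first exact: cont_on_cst.
by move=> x xab; have := fk x xab; rewrite ler_norml => /andP[].
Qed.

Lemma Rint_split a b c f : a <= b <= c -> cont_on a c f -> Rint a c f = Rint a b f + Rint b c f.
Proof.
move=> /andP[ab bc] cf; have := @Rintegral_itvB R f (BLeft a) (BRight c) b (cont_on_integrable cf).
rewrite !bnd_simp => /(_ ab bc) /eqP; rewrite subr_eq => /eqP E.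
rewrite /Rint E addrC; congr (_ + _); apply: Rintegral_itv_obnd_cbnd.
apply: (integrableS _ _ _ (cont_on_integrable (cont_on_sub ab (lexx c) cf))) => //.
by move=> x /=; rewrite !in_itv /= => /andP[/ltW -> ->].
Qed.

Lemma Rint_derive (F f : R -> R) a b : a < b -> cont_on a b f ->
  (forall x, a <= x <= b -> is_derive x 1 F (f x)) -> Rint a b f = F b - F a.
Proof.
move=> ab cf dF; rewrite /Rint /Rintegral (@continuous_FTC2 _ f F) //.
- exact: cont_on_within.
- split.
  + by move=> x; rewrite in_itv /= => /andP[/ltW ax /ltW xb]; have [] := dF x; rewrite ?ax.
  + have /is_derive_continuous : is_derive a 1 F (f a) by apply: dF; rewrite lexx ltW.
    exact: cvg_at_right_filter.
  + have /is_derive_continuous : is_derive b 1 F (f b) by apply: dF; rewrite lexx ltW.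
    exact: cvg_at_left_filter.
- move=> x; rewrite in_itv /= => /andP[/ltW ax /ltW xb]; rewrite derive1E.
  by have [|_ ->] := dF x; rewrite ?ax.
Qed.

Lemma Rint_reflect s a b f : a < b -> cont_on a b f ->
  Rint a b f = Rint (s - b) (s - a) (fun x => f (s - x)).
Proof.
move=> ab cf; pose F (x : R) : R := s - x.
have dF (z : R) : is_derive z 1 F (-1).
  have := is_deriveB (is_derive_cst s z 1) (is_derive_id z 1).
  by rewrite sub0r.
have F' : F^`()%classic = cst (-1).
  by apply/funext => z; rewrite derive1E; have [_ ->] := dF z.
have le_sab : s - b <= s - a by rewrite lerD2l lerN2 ltW.
have := @integration_by_substitution_decreasing R F f (s - b) (s - a) le_sab.
have -> : F (s - b) = b by rewrite /F opprB addrC subrK.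
have -> : F (s - a) = a by rewrite /F opprB addrC subrK.
rewrite F' => H; rewrite /Rint /Rintegral H; first last.
- exact: cont_on_within.
- split.
  + by move=> x _; have [] := dF x.
  + by apply: cvg_at_right_filter; exact: is_derive_continuous (dF _).
  + by apply: cvg_at_left_filter; exact: is_derive_continuous (dF _).
- exact: is_cvg_cst.
- exact: is_cvg_cst.
- by move=> x _; exact: cvg_cst.
- by move=> x y _ _ xy; rewrite /F ltrD2l ltrN2.
congr fine; apply: eq_integral => x _ /=.
by rewrite /F /= opprK mulr1.
Qed.

Lemma compact_bounded (g : R * R -> R) a b c d : a <= b -> c <= d ->
  (forall x y, a <= x <= b -> c <= y <= d -> {for (x, y), continuous g}) ->
  exists2 M : R, 0 <= M & forall x y, a <= x <= b -> c <= y <= d -> `|g (x, y)| <= M.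
Proof.
move=> ab cd cg; pose K : set (R * R) := `[a, b] `*` `[c, d].
have cK : compact K by apply: compact_setX; exact: segment_compact.
have KE x y : K (x, y) <-> a <= x <= b /\ c <= y <= d by rewrite /K /= !in_itv.
have [||p pK pm] := @compact_EVT_max _ R (fun z => `|g z|) K _ cK.
- by exists (a, c); apply/KE; rewrite !lexx.
- apply: continuous_in_subspaceT => -[x y] /set_mem/KE[h1 h2].
  by apply: cvg_norm; exact: cg.
exists `|g p| => // x y h1 h2; apply: pm; apply/mem_set/KE; split => //.
Qed.

Lemma continuous_slice2 (g : R * R -> R) x y : {for (x, y), continuous g} -> {for y, continuous (fun t => g (x, t))}.
Proof.
move=> cg; apply: (@continuous_comp _ _ _ (fun t : R => (x, t))) cg.
exact: (cvg_pair (cvg_cst x) (@cvg_id _ _)).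
Qed.

(** Dominated differentiation: over the smaller interval from [u'] to [v'] the derivative [fr] is
    continuous on a compact rectangle, and its bound there is the dominating constant. *)
Lemma derive_Rint (f fr : R * R -> R) u v c d r0 : u < r0 < v -> c <= d ->
  (forall r t, u < r < v -> c <= t <= d -> {for (r, t), continuous f} /\
     {for (r, t), continuous fr} /\ is_derive r 1 (fun r' => f (r', t)) (fr (r, t))) ->
  is_derive r0 1 (fun r => Rint c d (fun t => f (r, t))) (Rint c d (fun t => fr (r0, t))).
Proof.
move=> /andP[ur rv] cd H; pose u' := (u + r0) / 2; pose v' := (v + r0) / 2.
have u'r : u' < r0 by rewrite /u'; lra.
have rv' : r0 < v' by rewrite /v'; lra.
have uu' : u < u' by rewrite /u'; lra.
have vv' : v' < v by rewrite /v'; lra.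
have [|x y /andP[h1 h2] h3|M M0 HM] := @compact_bounded fr u' v' c d _ cd; first lra.
  by have [|_ []] := H x y _ h3; first by apply/andP; split; lra.
have Ir : (`]u', v'[%classic : set R) r0 by rewrite /= in_itv /= u'r.
have HI r t : (`]u', v'[%classic : set R) r -> (`[c, d]%classic : set R) t -> [/\ u < r < v, c <= t <= d & u' <= r <= v'].
  rewrite /= !in_itv /= => /andP[h1 h2] ->; split => //; apply/andP; split; lra.
have intf r : (`]u', v'[%classic : set R) r -> (@lebesgue_measure R).-integrable `[c, d] (EFin \o (fun t => f (r, t))).
  move=> rI; apply: cont_on_integrable => t tcd.
  have tI : (`[c, d]%classic : set R) t by rewrite /= in_itv.
  have [ruv _ _] := HI r t rI tI; have [cf _] := H r t ruv tcd.
  exact: continuous_slice2.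
have p1E r t : (`]u', v'[%classic : set R) r -> (`[c, d]%classic : set R) t -> partial1of2 (fun r t => f (r, t)) r t = fr (r, t).
  move=> rI tI; have [ruv tcd _] := HI r t rI tI; have [_ [_ [_ <-]]] := H r t ruv tcd.
  by rewrite partial1of2E.
have dominated : forall r t, (`]u', v'[%classic : set R) r -> (`[c, d]%classic : set R) t -> `|partial1of2 (fun r t => f (r, t)) r t| <= cst M t.
  by move=> r t rI tI; rewrite p1E //; have [_ tcd ruv] := HI r t rI tI; exact: HM.
have intM : (@lebesgue_measure R).-integrable `[c, d] (EFin \o cst M).
  by apply: cont_on_integrable; exact: cont_on_cst.
have der : forall r t, (`]u', v'[%classic : set R) r -> (`[c, d]%classic : set R) t -> derivable ((fun r t => f (r, t))^~ t) r 1.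
  move=> r t rI tI; have [ruv tcd _] := HI r t rI tI.
  by have [_ [_ []]] := H r t ruv tcd.
have := @derivable_under_integral R _ _ (@lebesgue_measure R) (fun r t => f (r, t)) _ (measurable_itv `[c, d]) r0 u' v' Ir intf der (cst M) (fun=> M0) intM dominated.
have := @differentiation_under_integral R _ _ (@lebesgue_measure R) (fun r t => f (r, t)) _ (measurable_itv `[c, d]) r0 u' v' Ir intf der (cst M) (fun=> M0) intM dominated.
rewrite derive1E => E1 E2; split => //; rewrite E1; apply: eq_Rintegral => t /set_mem tI.
exact: p1E.
Qed.

End Integrals.

(** * Lower bounds for integrals over the plane *)

Section PlaneMeasure.
Variable R : realType.
Implicit Types (a b c d e h k l r s t x y : R).
Local Notation mu := (@lebesgue_measure R).

(** Measurability refers to the product structure, generated by rectangles; an open set is the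
    countable union of the squares [B i], with rational centres and half sides [1 / (n + 1)], that
    it contains. *)
Lemma open_plane_measurable (A : set (R * R)) : open A -> measurable A.
Proof.
move=> oA.
pose B (i : rat * rat * nat) : set (R * R) :=
  [set z : R * R | `|z.1 - ratr i.1.1| < i.2.+1%:R^-1 /\ `|z.2 - ratr i.1.2| < i.2.+1%:R^-1].
have mB i : measurable (B i).
  have -> : B i = `](ratr i.1.1 - i.2.+1%:R^-1), (ratr i.1.1 + i.2.+1%:R^-1)[%classic `*`
                  `](ratr i.1.2 - i.2.+1%:R^-1), (ratr i.1.2 + i.2.+1%:R^-1)[%classic.
    rewrite /B; move: (i.2.+1%:R^-1) (ratr i.1.1) (ratr i.1.2) => v q1 q2.
    apply/seteqP; split => z /=; rewrite !in_itv /= !ltr_norml.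
      by move=> [/andP[? ?] /andP[? ?]]; split; apply/andP; split; lra.
    by move=> [/andP[? ?] /andP[? ?]]; split; apply/andP; split; lra.
  by apply: measurableX; exact: measurable_itv.
have -> : A = \bigcup_i (if `[< B i `<=` A >] then B i else set0).
  apply/seteqP; split => p; last first.
    by move=> [i _]; case: asboolP => // iA /iA.
  move=> Ap; have /nbhs_boxP[r r0 rA] : nbhs p A by apply: open_nbhs_nbhs; split.
  have [n nr] : exists n : nat, n.+1%:R^-1 < r / 2.
    have r2 : 0 < r / 2 by rewrite divr_gt0.
    by have [n _ /(_ n (leqnn _))] := near_infty_natSinv_lt (PosNum r2); exists n.
  have [v [vE v0 vr]] : exists v : R, [/\ v = n.+1%:R^-1, 0 < v & v < r / 2].
    by exists n.+1%:R^-1; split => //; rewrite invr_gt0.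
  have [q1] : exists q : rat, ratr q \in `](p.1 - v), (p.1 + v)[ by apply: rat_in_itvoo; lra.
  have [q2] : exists q : rat, ratr q \in `](p.2 - v), (p.2 + v)[ by apply: rat_in_itvoo; lra.
  rewrite !in_itv /=; 
  have [x1 x1E] : exists x1 : R, x1 = ratr q1 by exists (ratr q1).
  have [x2 x2E] : exists x2 : R, x2 = ratr q2 by exists (ratr q2).
  rewrite -x1E -x2E.
  move=> /andP[h1 h2] /andP[h3 h4].
  exists (q1, q2, n) => //; case: asboolP; first by move=> _; split => /=; rewrite -vE -?x1E -?x2E ltr_norml; lra.
  case=> z [/=]; rewrite -vE -x1E -x2E !ltr_norml => /andP[? ?] /andP[? ?].
  by rewrite (surjective_pairing z); apply: rA; rewrite ltr_norml; lra.
apply: countable_bigcupT_measurable => [|i]; first exact: countableP.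
by case: ifP.
Qed.

Lemma continuous_plane_measurable (D : set (R * R)) (F : R * R -> R) : open D ->
  (forall p, D p -> {for p, continuous F}) -> measurable_fun D F.
Proof.
move=> oD cF; apply: (measurability _ (RGenOpens.measurableE R)).
move=> _ [_ [a [b ->] <-]]; apply: open_plane_measurable.
rewrite openE => p [Dp Fp].
apply: filterI; first exact: open_nbhs_nbhs.
by apply: cF => //; apply: open_nbhs_nbhs; split => //; exact: interval_open.
Qed.

(** Fubini-Tonelli on the strip [S] inside [D]. Vertical sections are open intervals, as the cell is
    open, whereas the one-dimensional integral is over the closed interval; the end points have
    measure zero. *)
Lemma plane_integral_ge (D : set (R * R)) (F : R * R -> R) (al be c d k : R) : open D ->
  (forall p, D p -> {for p, continuous F}) -> (forall p, 0 <= F p) -> 0 <= k -> al < be -> c < d ->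
  (forall x y, al <= x <= be -> c < y < d -> D (x, y)) ->
  (forall x, al <= x <= be -> cont_on c d (fun y => F (x, y))) ->
  (forall x, al <= x <= be -> k <= Rint c d (fun y => F (x, y))) ->
  ((k * (be - al))%:E <= \int[mu \x mu]_(p in D) (F p)%:E)%E.
Proof.
move=> oD cF F0 k0 ab cd SD cFx kF.
pose S : set (R * R) := `[al, be] `*` `]c, d[.
have mS : measurable S by apply: measurableX; exact: measurable_itv.
have mD := open_plane_measurable oD.
have /measurable_EFinP mF := continuous_plane_measurable oD cF.
have sSD : S `<=` D by move=> [x y]; rewrite /S /= !in_itv /= => -[]; exact: SD.
have step1 : (\int[mu \x mu]_(p in S) (F p)%:E <= \int[mu \x mu]_(p in D) (F p)%:E)%E.
  by apply: ge0_subset_integral => // p _; rewrite lee_fin.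
apply: le_trans step1.
rewrite integral_mkcond.
pose f : R * R -> \bar R := ((fun p => (F p)%:E) \_ S).
have f0 p : (0 <= f p)%E by rewrite /f /patch; case: ifP => // _; rewrite lee_fin.
have mf : measurable_fun setT f.
  by apply/(measurable_restrict _ mS measurableT); rewrite setTI; exact: measurable_funS mF.
have E : (\int[mu \x mu]_p f p = \int[mu]_x fubini_F mu f x)%E by exact: fubini_tonelli1.
rewrite -/f [leRHS]E.
have fubE x : al <= x <= be -> (k%:E <= fubini_F mu f x)%E.
  move=> xab; have cx := cFx x xab.
  have intx := cont_on_integrable cx.
  have -> : fubini_F mu f x = (\int[mu]_(y in `]c, d[) (F (x, y))%:E)%E.
    rewrite /fubini_F [RHS]integral_mkcond; apply: eq_integral => y _.
    rewrite /f /patch; have -> : ((x, y) \in S) = (y \in `]c, d[%classic) => //.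
    apply/idP/idP => [/set_mem[_ h]|/set_mem h]; apply/mem_set => //.
  have -> : (\int[mu]_(y in `]c, d[) (F (x, y))%:E = \int[mu]_(y in `[c, d]) (F (x, y))%:E)%E.
    apply/esym; apply: integral_itv_bndoo; apply/measurable_EFinP; apply: open_continuous_measurable_fun; [exact: interval_open|].
    move=> y; rewrite inE /= in_itv /= => /andP[/ltW cy /ltW yd]; apply: cx; exact/andP.
  have -> : (\int[mu]_(y in `[c, d]) (F (x, y))%:E = (Rint c d (fun y => F (x, y)))%:E)%E.
    rewrite /Rint /Rintegral fineK //; exact: integrable_fin_num.
  by rewrite lee_fin; exact: kF.
have mfub : measurable_fun setT (fubini_F mu f) by exact: measurable_fun_fubini_tonelli_F.
have step2 : (\int[mu]_(x in `[al, be]) k%:E <= \int[mu]_(x in `[al, be]) fubini_F mu f x)%E.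
  apply: ge0_le_integral => //.
  exact: measurable_funTS.
have step3 : (\int[mu]_(x in `[al, be]) fubini_F mu f x <= \int[mu]_x fubini_F mu f x)%E.
  by apply: ge0_subset_integral => // x _; apply: integral_ge0.
apply: le_trans step3; apply: le_trans step2.
rewrite integral_cst // EFinM.
have := @lebesgue_measure_itv R `[al, be]; rewrite /= lte_fin ab => ->.
by rewrite -EFinB.
Qed.

End PlaneMeasure.

(** * The exterior domain *)

Section Exterior.
Variable R : realType.
Variables eps delta : R.
Hypotheses (eps_gt0 : 0 < eps) (delta_gt0 : 0 < delta).
Implicit Types (p q z : R * R) (w wx wy : R * R -> R) (J : set R).
Implicit Types (a b d e h k l r s t x y S : R).

Local Notation E := (Ext eps delta).
Local Notation P := (2 + delta).
Local Notation c := (1 + eps / 2).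

Lemma ExtP x y : E (x, y) <->
  forall n : int, 1 < (x + c) ^+ 2 + (y - n%:~R * P) ^+ 2 /\ 1 < (x - c) ^+ 2 + (y - n%:~R * P) ^+ 2.
Proof.
rewrite /Ext /sqdist /cL /cR /=; have -> : x - (- 1 - eps / 2) = x + c by ring.
by split => H n; have [] := H n.
Qed.

Lemma Ext_shift (m : int) x y : E (x, y) -> E (x, y + m%:~R * P).
Proof.
move=> /ExtP H; apply/ExtP => n; have := H (n - m); rewrite rmorphB /=.
by have -> : y - (n%:~R - m%:~R) * P = y + m%:~R * P - n%:~R * P by ring.
Qed.

Lemma Ext_shift1 x y : E (x, y) -> E (x, y + P).
Proof. by move=> /(Ext_shift 1); rewrite mul1r. Qed.

Lemma Ext_negx x y : E (x, y) -> E (- x, y).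
Proof.
move=> /ExtP H; apply/ExtP => n; have [h1 h2] := H n.
have -> : (- x + c) ^+ 2 = (x - c) ^+ 2 by ring.
by have -> : (- x - c) ^+ 2 = (x + c) ^+ 2 by ring.
Qed.

Lemma Ext_negy x y : E (x, y) -> E (x, - y).
Proof.
move=> /ExtP H; apply/ExtP => n; have := H (- n); rewrite rmorphN /=.
by have -> : (y - - n%:~R * P) ^+ 2 = (- y - n%:~R * P) ^+ 2 by ring.
Qed.

Lemma Ext_far x y : 1 + c < `|x| -> E (x, y).
Proof.
move=> xc; apply/ExtP => n; have sy := sqr_ge0 (y - n%:~R * P); have e0 := eps_gt0.
by move: xc; case: ler0P => x0 xc; split; nra.
Qed.

Lemma Ext_axis y : E (0, y).
Proof.
by apply/ExtP => n; have sy := sqr_ge0 (y - n%:~R * P); have e0 := eps_gt0; split; nra.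
Qed.

Lemma int_dist_half (n : int) : 1 / 2 <= `|1 / 2 - n%:~R : R|.
Proof.
have [n0|n0] := lerP n 0; last first.
  have : (1 : int)%:~R <= n%:~R :> R by rewrite ler_int -gtz0_ge1.
  by rewrite mulr1z => h; rewrite ler0_norm; lra.
have : n%:~R <= (0 : int)%:~R :> R by rewrite ler_int.
by rewrite mulr0z => h; rewrite ger0_norm; lra.
Qed.

(** A horizontal line half way between two rows of disks, along which the outer regions are
    connected to the axis. *)
Lemma Ext_mid x : E (x, P / 2).
Proof.
apply/ExtP => n; have h := int_dist_half n; have d0 := delta_gt0.
have : 1 < (P / 2 - n%:~R * P) ^+ 2.
  have -> : (P / 2 - n%:~R * P) ^+ 2 = P ^+ 2 * `|1 / 2 - n%:~R| ^+ 2.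
    by rewrite real_normK ?num_real//; field.
  have : (1 / 2) ^+ 2 <= `|1 / 2 - n%:~R : R| ^+ 2 by rewrite lerXn2r ?nnegrE.
  by nra.
by have sx := sqr_ge0 (x + c); have sx' := sqr_ge0 (x - c); split; lra.
Qed.

Lemma Ext_inward x y t : E (x, y) -> 0 <= t <= x -> x <= c -> E (t, y).
Proof.
move=> /ExtP H /andP[t0 tx] xc; apply/ExtP => n; have [h1 h2] := H n.
by have sy := sqr_ge0 (y - n%:~R * P); have e0 := eps_gt0; split; nra.
Qed.

Lemma Ext_outward x y t : E (x, y) -> c <= x <= t -> E (t, y).
Proof.
move=> /ExtP H /andP[cx xt]; apply/ExtP => n; have [h1 h2] := H n.
by have sy := sqr_ge0 (y - n%:~R * P); have e0 := eps_gt0; split; nra.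
Qed.

Lemma exists_shift y : exists n : int, `|y + n%:~R * P| <= P / 2.
Proof.
have P0 : 0 < P by have d0 := delta_gt0; lra.
exists (- Num.floor (y / P + 1 / 2)); rewrite rmorphN /=.
have := floor_itv (y / P + 1 / 2); rewrite intrD mulr1z => /andP[].
move: (_%:~R) => n h1 h2.
have yP : y = y / P * P by rewrite divfK // gt_eqF.
rewrite ler_norml; apply/andP; split; rewrite yP; nra.
Qed.

(** An infinite intersection of open conditions, of which only finitely many matter near [p]: for
    [|n| > N], with [N >= |p.2| + 2], the disks of index [n] are at vertical distance more than 1
    from every point within height 1 of [p]. *)
Lemma open_Ext : open E.
Proof.
rewrite openE => p Ep; rewrite /interior.
have near_bounded (Q : int -> R * R -> Prop) (N : nat) : (forall n, \forall z \near p, Q n z) ->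
    \forall z \near p, forall n : int, (`|n| <= N)%N -> Q n z.
  move=> HQ; elim: N => [|N IHN].
    by apply: filterS (HQ 0) => z Q0 n; rewrite leqn0 absz_eq0 => /eqP ->.
  have := HQ N.+1; have := HQ (- (N.+1 : int)); move: IHN.
  apply: filter_app3; near=> z => h1 h2 h3 n; rewrite leq_eqVlt => /orP[/eqP nN|]; last exact: h1.
  have [n0|n0] := lerP 0 n; first by rewrite -(gez0_abs n0) nN.
  by rewrite -[n]opprK -(ltz0_abs n0) nN.
pose N := `|Num.ceil (`|p.2| + 2)|%N.
have NE : `|p.2| + 2 <= N%:R :> R.
  have h := ceil_ge (`|p.2| + 2); apply: (le_trans h).
  by rewrite /N natr_absz ler_int ler_norm.
have h1 : \forall z \near p, forall n : int, (`|n| <= N)%N ->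
    1 < sqdist z (cL eps delta n) /\ 1 < sqdist z (cR eps delta n).
  apply: near_bounded => n; have [g1 g2] := Ep n.
  have g1' := open_nbhs_nbhs (conj (@open_sqdist_gt R (cL eps delta n) 1) g1).
  have g2' := open_nbhs_nbhs (conj (@open_sqdist_gt R (cR eps delta n) 1) g2).
  exact: filterI g1' g2'.
have h2 : \forall z \near p, `|z.2 - p.2| < 1.
  apply/nbhs_boxP; exists 1 => // x y _ //.
apply: filter_app2 h1 h2; near=> z => h1 h2 n.
have [nN|nN] := leqP `|n| N; first exact: h1.
have n1 : N%:R + 1 <= `|n%:~R| :> R.
  by rewrite -intr_norm -abszE -pmulrn natr1 ler_nat.
have zy : `|z.2| <= `|p.2| + 1.
  by have := ler_normD (z.2 - p.2) p.2; rewrite subrK; lra.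
have far : 1 < (z.2 - n%:~R * P) ^+ 2.
  have : `|n%:~R| * P - `|z.2| <= `|z.2 - n%:~R * P|.
    have P0 : 0 <= P by have d0 := delta_gt0; lra.
    have := ler_normB (n%:~R * P - z.2) (- z.2); rewrite opprK subrK normrN distrC normrM (ger0_norm P0); lra.
  move=> h3; have h4 : 1 < `|z.2 - n%:~R * P|.
    have : `|n%:~R| * 2 <= `|n%:~R| * P :> R by rewrite ler_wpM2l // lerDl ltW.
    by have := normr_ge0 p.2; lra.
  rewrite -(real_normK (num_real (z.2 - _))); nra.
rewrite /sqdist /cL /cR /=.
by split; rewrite ltr_wpDl // sqr_ge0.
Unshelve. all: by end_near. Qed.

Lemma not_Ext q : ~ E q -> exists n : int, sqdist q (cL eps delta n) <= 1 \/ sqdist q (cR eps delta n) <= 1.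
Proof.
move=> nE; apply: contrapT => H; apply: nE => n.
by split; rewrite ltNge; apply/negP => h; apply: H; exists n; [left|right].
Qed.

Definition periodic J w := forall x y, E (x, y) -> J x -> w (x, y + P) = w (x, y).

Lemma periodic_shift J w (n : int) x y : periodic J w -> E (x, y) -> J x ->
  w (x, y + n%:~R * P) = w (x, y).
Proof.
move=> pw Exy Jx.
have pos (m : nat) y' : E (x, y') -> w (x, y' + m%:R * P) = w (x, y').
  elim: m y' => [|m IHm] y' Ey; first by rewrite mul0r addr0.
  rewrite -natr1 mulrDl mul1r addrA pw ?IHm //.
  by have := Ext_shift m Ey; rewrite -pmulrn.
case: n => n; first by rewrite -pmulrn; exact: pos.
rewrite NegzE rmorphN /= -pmulrn.
have := pos n.+1 (y - n.+1%:R * P); rewrite subrK mulNr => -> //.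
by have := Ext_shift (- (n.+1 : int)) Exy; rewrite rmorphN /= -pmulrn mulNr.
Qed.

Definition column J : set (R * R) := [set p | E p /\ J p.1].

Lemma open_column J : open J -> open (column J).
Proof.
move=> oJ; have -> : column J = E `&` (fst @^-1` J) by [].
by apply: openI; [exact: open_Ext|apply: open_comp => // p _; exact: cvg_fst].
Qed.

(** The control at infinity allows the column to be cut at [|x| < X'], with [X'] beyond both [X] and
    [p]; in the vertical direction every point has a translate of height at most [P / 2] with the
    same value of [w]. This is the bounded situation of the first maximum principle, up to an error
    [e] that is arbitrary. *)
Lemma column_max J w wx wy S : open J -> harm (column J) w wx wy -> periodic J w ->
  (forall n q, sqdist q (cL eps delta n) = 1 -> forall e, 0 < e -> \forall p \near q, column J p -> w p <= S + e) ->
  (forall n q, sqdist q (cR eps delta n) = 1 -> forall e, 0 < e -> \forall p \near q, column J p -> w p <= S + e) ->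
  (forall q, E q -> ~ J q.1 -> forall e, 0 < e -> \forall p \near q, column J p -> w p <= S + e) ->
  (forall e, 0 < e -> exists X : R, forall p, column J p -> X < `|p.1| -> w p <= S + e) ->
  forall p, column J p -> w p <= S.
Proof.
move=> oJ Hw pw bL bR bJ binf p Gp; apply/ler_addgt0Pr => e e0.
have [X HX] := binf e e0.
pose X' := Num.max X `|p.1| + 1.
have XX' : X < X' by rewrite /X' ltr_pwDr // le_max lexx.
have pX' : `|p.1| < X' by rewrite /X' ltr_pwDr // le_max lexx orbT.
pose J' : set R := J `&` [set x | `|x| < X'].
have oJ' : open J'.
  apply: openI => //.
  have -> : [set x : R | `|x| < X'] = `](- X'), X'[%classic.
    by apply/seteqP; split => x /=; rewrite in_itv /= ltr_norml.
  exact: interval_open.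
have sub : column J' `<=` column J by move=> z [Ez [Jz _]].
have key : forall z, column J' z -> w z - (S + e) <= 0.
  apply: (@harm_max _ (column J') _ _ _ X' (P / 2) (open_column oJ')).
  - exact: (harm_sub sub (harmB Hw (harm_cst (column J) (S + e)))).
  - by move=> z [_ [_ /ltW]].
  - move=> z [Ez [Jz zX]]; have [n nz] := exists_shift z.2.
    rewrite (surjective_pairing z) in Ez.
    exists (z.2 + n%:~R * P); split => //=.
      by split => //=; exact: Ext_shift.
    by rewrite (periodic_shift n pw) // -surjective_pairing.
  move=> q nGq e' e'0.
  have weaken : (\forall z \near q, column J z -> w z <= S + e) -> \forall z \near q, column J' z -> w z - (S + e) <= e'.
    by apply: filterS => z h /sub /h; lra.
  have [Xq|qX] := leP X' `|q.1|.
    have : \forall z \near q, X < `|z.1|.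
      have cn : {for q, continuous (fun z : R * R => `|z.1|)} by apply: cvg_norm; exact: cvg_fst.
      have XqX : X < `|q.1| by lra.
      exact: (@cvgr_gt _ _ _ _ _ _ cn _ XqX).
    by move=> h; apply: weaken; apply: filterS h => z Xz Gz; exact: HX.
  case: (pselect (E q)) => [Eq|/not_Ext[n]].
    by apply: weaken; apply: bJ => // Jq; apply: nGq.
  have inside (ctr : R * R) : sqdist q ctr < 1 -> (forall z, E z -> 1 < sqdist z ctr) ->
      \forall z \near q, column J' z -> w z - (S + e) <= e'.
    move=> zc Gc; have := @near_notin_closed _ _ q (@open_sqdist_lt R ctr 1) zc; apply.
    by move=> u /= uc [/Gc]; lra.
  case; rewrite le_eqVlt => /orP[/eqP h|h].
  - by apply: weaken; exact: bL h e e0.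
  - by apply: inside h _ => z /(_ n)[].
  - by apply: weaken; exact: bR h e e0.
  - by apply: inside h _ => z /(_ n)[].
by have := key p; rewrite subr_le0; apply; split => //; case: Gp.
Qed.

End Exterior.

(** * Behaviour far from the disks *)

Section FarField.
Variable R : realType.
Implicit Types (a b c d e h k l r s t x y : R).

(* The pointwise bound [2 |f| <= eta + f^2 / eta] replaces Cauchy-Schwarz. *)
Lemma energy_bound (f g : R -> R) c d y1 y2 eta : 0 < eta -> c <= y1 <= y2 -> y2 <= d ->
  cont_on c d f -> cont_on c d g -> (forall y, c <= y <= d -> f y ^+ 2 <= g y) ->
  Rint c d g <= eta ^+ 2 -> `|Rint y1 y2 f| <= eta * (d - c + 1) / 2.
Proof.
move=> eta0 /andP[cy1 y12] y2d cf cg fg Eg.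
have cd : c <= d by lra.
pose h y := 2^-1 * eta + (2 * eta)^-1 * g y.
have ch : cont_on c d h by apply: cont_onD; [exact: cont_on_cst|exact: cont_onZ].
have fh y : c <= y <= d -> `|f y| <= h y.
  move=> ycd; have fgy := fg y ycd.
  have key : 2 * eta * `|f y| <= eta ^+ 2 + g y.
    by have := sqr_ge0 (eta - `|f y|); rewrite -(real_normK (num_real (f y))) in fgy; nra.
  have -> : h y = (eta ^+ 2 + g y) / (2 * eta) by rewrite /h; field; rewrite gt_eqF.
  by rewrite ler_pdivlMr ?mulr_gt0// mulrC.
have h0 y : c <= y <= d -> 0 <= h y by move=> /fh; exact: le_trans.
have cs1 : cont_on y1 y2 f by apply: cont_on_sub cf.
have cs2 : cont_on y1 y2 h by apply: cont_on_sub ch.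
have inj y : y1 <= y <= y2 -> c <= y <= d by move=> /andP[? ?]; apply/andP; split; lra.
have step1 : `|Rint y1 y2 f| <= Rint y1 y2 h.
  have chN : cont_on y1 y2 (fun y => -1 * h y) by exact: cont_onZ.
  rewrite ler_norml; apply/andP; split.
    rewrite -mulN1r -RintZ //; apply: le_Rint => // y /inj /fh; rewrite ler_norml => /andP[]; lra.
  by apply: le_Rint => // y /inj /fh; rewrite ler_norml => /andP[].
apply: (le_trans step1).
have hpos a' b' : c <= a' -> a' <= b' -> b' <= d -> 0 <= Rint a' b' h.
  move=> ca ab bd; have -> : 0 = Rint a' b' (fun=> 0) by rewrite Rint_cst // mul0r.
  apply: le_Rint; [exact: cont_on_cst|exact: cont_on_sub ch|].
  by move=> y /andP[? ?]; apply: h0; apply/andP; split; lra.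
have step2 : Rint y1 y2 h <= Rint c d h.
  have E1 : Rint c d h = Rint c y1 h + Rint y1 d h by apply: Rint_split => //; rewrite cy1; lra.
  have E2 : Rint y1 d h = Rint y1 y2 h + Rint y2 d h.
    by apply: Rint_split; [rewrite y12|apply: cont_on_sub ch].
  have := hpos c y1; have := hpos y2 d; rewrite !lexx E1 E2; lra.
apply: (le_trans step2).
have -> : Rint c d h = 2^-1 * eta * (d - c) + (2 * eta)^-1 * Rint c d g.
  rewrite /h RintD; [|exact: cont_on_cst|exact: cont_onZ].
  by rewrite (Rint_cst _ cd) RintZ.
have : (2 * eta)^-1 * Rint c d g <= (2 * eta)^-1 * eta ^+ 2 by rewrite ler_wpM2l // invr_ge0; lra.
have -> : (2 * eta)^-1 * eta ^+ 2 = eta / 2 by field; rewrite gt_eqF.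
lra.
Qed.

Variables (eps delta x1 : R).
Hypotheses (eps_gt0 : 0 < eps) (delta_gt0 : 0 < delta).
Hypothesis x1_ge : 2 + eps / 2 <= x1.
Local Notation P := (2 + delta).
Variables f fx fy fxx fyy : R * R -> R.
Hypothesis df : forall p, x1 < p.1 ->
  [/\ is_derive p.1 1 (fun t => f (t, p.2)) (fx p), is_derive p.2 1 (fun t => f (p.1, t)) (fy p),
      is_derive p.1 1 (fun t => fx (t, p.2)) (fxx p), is_derive p.2 1 (fun t => fy (p.1, t)) (fyy p)
    & fxx p + fyy p = 0].
Hypothesis cont_f : forall p, x1 < p.1 ->
  [/\ {for p, continuous f}, {for p, continuous fx}, {for p, continuous fy}, {for p, continuous fxx} & {for p, continuous fyy}].
Hypothesis per_fy : forall x y, x1 < x -> fy (x, y + P) = fy (x, y).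
Hypothesis energy : forall eta X, 0 < eta -> exists x, [/\ X < x, x1 < x &
  Rint (- (P / 2)) (P / 2) (fun y => fx (x, y) ^+ 2 + fy (x, y) ^+ 2) <= eta ^+ 2].

Let P0 : 0 < P. Proof. by have d0 := delta_gt0; lra. Qed.
Let Pneg : - (P / 2) < P / 2. Proof. by have d0 := P0; lra. Qed.

Let cont_slice x (g : R * R -> R) a b : (forall p, x1 < p.1 -> {for p, continuous g}) -> x1 < x ->
  cont_on a b (fun y => g (x, y)).
Proof. by move=> cg xx1 y _; apply: continuous_slice2; exact: cg. Qed.

Let cfx p (h : x1 < p.1) := let: And5 _ c _ _ _ := cont_f h in c.
Let cfy p (h : x1 < p.1) := let: And5 _ _ c _ _ := cont_f h in c.

Let cenergy x a b : x1 < x -> cont_on a b (fun y => fx (x, y) ^+ 2 + fy (x, y) ^+ 2).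
Proof.
move=> xx1; apply: cont_onD => y yab; apply: cvgM; apply: continuous_slice2; first [exact: cfx|exact: cfy].
Qed.

Lemma far_oscillation x y1 y2 eta : 0 < eta -> x1 < x ->
  Rint (- (P / 2)) (P / 2) (fun y => fx (x, y) ^+ 2 + fy (x, y) ^+ 2) <= eta ^+ 2 ->
  - (P / 2) <= y1 -> y1 <= y2 -> y2 <= P / 2 -> `|f (x, y2) - f (x, y1)| <= eta * (P + 1) / 2.
Proof.
move=> eta0 xx1 Ee h1 + h2; rewrite le_eqVlt => /orP[/eqP ->|y12].
  by rewrite subrr normr0; apply: divr_ge0 => //; apply: mulr_ge0; have := P0; lra.
have cy : cont_on y1 y2 (fun y => fy (x, y)) by exact: cont_slice.
have -> : f (x, y2) - f (x, y1) = Rint y1 y2 (fun y => fy (x, y)).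
  by apply/esym/(@Rint_derive R (fun y => f (x, y))) => // y _; have [] := @df (x, y) xx1.
have -> : P + 1 = P / 2 - - (P / 2) + 1 by field.
apply: (energy_bound (g := fun y => fx (x, y) ^+ 2 + fy (x, y) ^+ 2)) => //.
- by rewrite h1 ltW.
- exact: cont_slice.
- exact: cenergy.
- by move=> y _; rewrite lerDr sqr_ge0.
Qed.

(** The increment over a period is the same on all lines, and it is at most a multiple of [eta] on a
    line of energy [eta^2]. *)
Lemma far_increment (kap : R) : (forall x, x1 < x -> f (x, P / 2) - f (x, - (P / 2)) = kap) -> kap = 0.
Proof.
move=> H; apply/eqP; rewrite -normr_le0; apply/ler_addgt0Pr => e e0; rewrite add0r.
pose eta := e / (P + 1); have P1 : 0 < P + 1 by have := P0; lra.
have eta0 : 0 < eta by exact: divr_gt0.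
have [x [_ xx1 Ee]] := energy 0 eta0.
rewrite -(H x xx1); apply: (le_trans (far_oscillation eta0 xx1 Ee (lexx _) (ltW Pneg) (lexx _))).
have -> : eta * (P + 1) / 2 = e / 2 by rewrite /eta; field; rewrite gt_eqF.
by lra.
Qed.

(** The second derivative of the integral is that of [fxx = - fyy] over a period, which vanishes by
    periodicity of [fy]. The slope is thus constant, and it is arbitrarily small on lines of small
    energy, hence zero. *)
Lemma far_mean_const : exists k : R, forall x, x1 < x -> Rint (- (P / 2)) (P / 2) (fun y => f (x, y)) = k.
Proof.
pose F x := Rint (- (P / 2)) (P / 2) (fun y => f (x, y)).
pose D x := Rint (- (P / 2)) (P / 2) (fun y => fx (x, y)).
have dF x : x1 < x -> is_derive x 1 F (D x).
  move=> xx1; apply: (@derive_Rint R f fx x1 (x + 1)); [by rewrite xx1; lra|exact: ltW|].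
  move=> r t /andP[rx1 _] _; have [? ? _ _ _] := @cont_f (r, t) rx1; split => //; split => //.
  by have [] := @df (r, t) rx1.
have dD x : x1 < x -> is_derive x 1 D 0.
  move=> xx1; have -> : 0 = Rint (- (P / 2)) (P / 2) (fun y => fxx (x, y)).
    have cyy : cont_on (- (P / 2)) (P / 2) (fun y => fyy (x, y)).
      by apply: cont_slice => // p px1; have [] := cont_f px1.
    rewrite (@eq_Rint _ _ _ _ (fun y => -1 * fyy (x, y))); last first.
      by move=> y _; have [_ _ _ _] := @df (x, y) xx1; lra.
    rewrite RintZ // (_ : Rint _ _ _ = fy (x, P / 2) - fy (x, - (P / 2))); last first.
      by apply: (@Rint_derive R (fun y => fy (x, y))) => // y _; have [] := @df (x, y) xx1.
    have := @per_fy x (- (P / 2)) xx1; have -> : - (P / 2) + P = P / 2 by field.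
    by move=> ->; rewrite subrr mulr0.
  apply: (@derive_Rint R fx fxx x1 (x + 1)); [by rewrite xx1; lra|exact: ltW|].
  move=> r t /andP[rx1 _] _; have [_ ? _ ? _] := @cont_f (r, t) rx1; split => //; split => //.
  by have [] := @df (r, t) rx1.
have const (g dg : R -> R) : (forall x, x1 < x -> is_derive x 1 g (dg x)) -> (forall x, x1 < x -> dg x = 0) ->
    forall x y, x1 < x -> x < y -> g y = g x.
  move=> dgg dg0 x y xx1 xy.
  have dgg' z : x <= z <= y -> is_derive z 1 g (dg z).
    by move=> /andP[xz _]; apply: dgg; lra.
  have [z [/andP[xz _] E]] := mean_value xy dgg'.
  by move: E; rewrite dg0 ?mul0r; [move/eqP; rewrite subr_eq0 => /eqP|lra].
have const' (g dg : R -> R) : (forall x, x1 < x -> is_derive x 1 g (dg x)) -> (forall x, x1 < x -> dg x = 0) ->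
    forall x y, x1 < x -> x1 < y -> g y = g x.
  move=> dgg dg0 x y xx1 yx1; have [xy|yx|->//] := ltgtP x y; first exact: (const g dg).
  by apply/esym; exact: (const g dg).
have D0 x : x1 < x -> D x = 0.
  move=> xx1; apply/eqP; rewrite -normr_le0; apply/ler_addgt0Pr => e e0; rewrite add0r.
  pose eta := e / (P + 1); have P1 : 0 < P + 1 by have := P0; lra.
  have eta0 : 0 < eta by exact: divr_gt0.
  have [x' [_ x'x1 Ee]] := energy 0 eta0.
  rewrite (const' D (fun=> 0) dD _ x' x) //.
  have := @energy_bound (fun y => fx (x', y)) _ (- (P / 2)) (P / 2) (- (P / 2)) (P / 2) eta eta0 _ (lexx _) _ _ _ Ee.
  rewrite lexx (ltW Pneg) => /(_ isT) h; apply: (le_trans (h _ _ _)).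
  - exact: cont_slice.
  - exact: cenergy.
  - by move=> y _; rewrite lerDl sqr_ge0.
  have -> : eta * (P / 2 - - (P / 2) + 1) / 2 = e / 2 by rewrite /eta; field; rewrite gt_eqF //; lra.
  by lra.
exists (F (x1 + 1)) => x xx1; apply: (const' F D dF D0) => //; lra.
Qed.

Hypothesis per_f : forall x y, x1 < x -> f (x, y + P) = f (x, y).

Let perE (n : int) x y : x1 < x -> f (x, y + n%:~R * P) = f (x, y).
Proof.
move=> xx1; pose g (p : R * R) := f (x, p.2).
have -> : f (x, y + n%:~R * P) = g (x, y + n%:~R * P) by [].
rewrite (@periodic_shift R eps delta [set: R] g) // => [x' y' _ _|]; first exact: per_f.
apply: Ext_far => //; have e0 := eps_gt0; have h := x1_ge; rewrite ger0_norm; lra.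
Qed.

(** On a line of small energy the oscillation is small, and since the mean is [k] the whole line is
    close to [k]. Such lines exist arbitrarily far, though not every line is known to be one;
    between two of them the maximum principle transfers the bound. *)
Lemma far_limit : exists k : R,
  (forall x, x1 < x -> Rint (- (P / 2)) (P / 2) (fun y => f (x, y)) = k * P) /\
  (forall e, 0 < e -> exists X, forall x y, X < x -> `|f (x, y) - k| <= e).
Proof.
have [K HK] := far_mean_const; pose k := K / P; exists k.
have KE : K = k * P by rewrite /k divfK // gt_eqF.
split => [x xx1|]; first by rewrite HK.
have line e X : 0 < e -> exists x, [/\ X < x, x1 < x & forall y, `|f (x, y) - k| <= e].
  move=> e0; pose eta := e / (P + 1); have P1 : 0 < P + 1 by have := P0; lra.
  have eta0 : 0 < eta by exact: divr_gt0.
  have [x [Xx xx1 Ee]] := energy X eta0; exists x; split => // y.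
  have [n yn] := @exists_shift R delta delta_gt0 y; rewrite -(perE n y xx1).
  move: (y + _) yn => {}y; rewrite ler_norml => /andP[y1 y2].
  have etaE : eta * (P + 1) / 2 = e / 2 by rewrite /eta; field; rewrite gt_eqF.
  have osc t : - (P / 2) <= t <= P / 2 -> `|f (x, y) - f (x, t)| <= e.
    move=> /andP[t1 t2]; have [ty|/ltW yt] := leP t y.
      by apply: (le_trans (far_oscillation eta0 xx1 Ee t1 ty y2)); lra.
    by rewrite distrC; apply: (le_trans (far_oscillation eta0 xx1 Ee y1 yt t2)); lra.
  have cfl : cont_on (- (P / 2)) (P / 2) (fun t => f (x, t)).
    by apply: cont_slice => // p px1; have [] := cont_f px1.
  have : `|Rint (- (P / 2)) (P / 2) (fun t => f (x, y) - f (x, t))| <= e * (P / 2 - - (P / 2)).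
    by apply: le_norm_Rint => //; [exact: ltW|apply: cont_onB => //; exact: cont_on_cst].
  rewrite RintB //; last exact: cont_on_cst.
  rewrite (@Rint_cst R _ _ (f (x, y)) (ltW Pneg)) (HK x xx1) KE; have -> : P / 2 - - (P / 2) = P by field.
  by rewrite -mulrBl normrM (gtr0_norm P0) ler_pM2r.
move=> e e0; have [x0 [_ x01 H0]] := line e x1 e0.
exists x0 => x y x0x; have [x2 [xx2 x21 H2]] := line e x e0.
have Hf : harm [set p : R * R | x1 < p.1] f fx fy.
  exists fxx, fyy => p /= px1; have [? ? ? ? ?] := df px1.
  by split => //; have [] := cont_f px1.
pose J : set R := `]x0, x2[%classic.
have oJ : open J by exact: interval_open.
have JE t : J t <-> x0 < t < x2 by rewrite /J /= in_itv.
have sub : column eps delta J `<=` [set p : R * R | x1 < p.1].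
  by move=> p [_ /JE/andP[? _]] /=; lra.
have Exy : column eps delta J (x, y).
  split; last by apply/JE; rewrite /= x0x.
  by apply: Ext_far => //; have e'0 := eps_gt0; have h := x1_ge; rewrite ger0_norm; lra.
have main (sg : R) : (forall p, x1 < p.1 -> `|f p - k| <= e -> sg * (f p - k) <= e) -> sg * (f (x, y) - k) <= e.
  move=> Hsg.
  have Hh : harm (column eps delta J) (fun p => sg * (f p - k)) (fun p => sg * (fx p - 0)) (fun p => sg * (fy p - 0)).
    by apply: harmZ; apply: harmB; [exact: harm_sub Hf|exact: harm_cst].
  pose w p := sg * (f p - k).
  have nobd (ctr : int -> R * R) : (forall n, `|(ctr n).1| = 1 + eps / 2) ->
     forall n q, sqdist q (ctr n) = 1 -> forall e', 0 < e' -> \forall p \near q, column eps delta J p -> w p <= e + e'.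
    move=> Hctr n q qc e' e'0; have qx1 : q.1 < x0.
      have : (q.1 - (ctr n).1) ^+ 2 <= 1 by rewrite -qc /sqdist lerDl sqr_ge0.
      have := Hctr n; have h := x1_ge; have e0' := eps_gt0.
      have : (ctr n).1 <= `|(ctr n).1| by exact: ler_norm.
      nra.
    apply: filterS (near_fst (P := fun t => t < x0) _); last exact: lt_nbhsl.
    by move=> p /= p1 [_ /JE/andP[? _]]; lra.
  apply: (@column_max R eps delta delta_gt0 J w _ _ e oJ Hh) => //.
  - by move=> x' y' _ /JE/andP[x'1 _]; rewrite /w per_f //; lra.
  - by apply: nobd => n; rewrite ler0_norm /=; have := eps_gt0; lra.
  - by apply: nobd => n; rewrite ger0_norm /=; have := eps_gt0; lra.
  - move=> q _ nJ e' e'0.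
    have endpt t : x1 < t -> q.1 = t -> (forall y, `|f (t, y) - k| <= e) -> \forall p \near q, column eps delta J p -> w p <= e + e'.
      move=> t1 qt Ht; have qx1 : x1 < q.1 by rewrite qt.
      have cw : {for q, continuous (fun p => w p - e)}.
        apply: cvgB; last exact: cvg_cst.
        by apply: cvgMr; apply: cvgB; [have [] := cont_f qx1|exact: cvg_cst].
      have wq : w q - e <= 0.
        by rewrite subr_le0; apply: Hsg => //; rewrite (surjective_pairing q) qt.
      by have := near_le_continuous cw wq e'0; apply: filterS => p h _; lra.
    have [q1|q1|q1] := ltgtP q.1 x0; last exact: endpt q1 H0.
      apply: filterS (near_fst (P := fun t => t < x0) _); last exact: lt_nbhsl.
      by move=> p /= p1 [_ /JE/andP[? _]]; lra.
    have [q2|q2|q2] := ltgtP q.1 x2; last exact: endpt q2 H2.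
      by exfalso; apply: nJ; apply/JE; rewrite q1.
    apply: filterS (near_fst (P := fun t => x2 < t) _); last exact: lt_nbhsr.
    by move=> p /= p1 [_ /JE/andP[_ ?]]; lra.
  - move=> e' e'0; exists x2 => p [_ /JE/andP[p1 p2]]; rewrite ger0_norm; first lra.
    by have := eps_gt0; have := x1_ge; lra.
have M1 := main 1 _; have M2 := main (-1) _.
rewrite ler_norml; apply/andP; split.
  by have := M2 _; rewrite mulN1r lerNl; apply => p _; rewrite mulN1r lerNl ler_norml => /andP[].
by have := M1 _; rewrite mul1r; apply => p _; rewrite mul1r ler_norml => /andP[].
Qed.

End FarField.

(** * Periodicity and far field of a solution *)

Section SolutionFacts.
Variable R : realType.
Implicit Types (p q z : R * R) (w : R * R -> R) (e h k l r s t x y X : R).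

Lemma derivable_is_derive (f : R -> R) x : derivable f x 1 -> is_derive x 1 f (derive1 f x).
Proof. by move=> df; split => //; rewrite derive1E. Qed.

Lemma harmonic_on_harm (U : set (R * R)) (u : R * R -> R) : harmonic_on U u -> harm U u (dx u) (dy u).
Proof.
move=> H; exists (dx (dx u)), (dy (dy u)) => p Up.
have [[d1 [d2 [d3 [d4 [d5 d6]]]]] [[c0 _] lap]] := H p Up.
split; [exact: c0|exact: (derivable_is_derive d1)|exact: (derivable_is_derive d2)|].
by split; [exact: (derivable_is_derive d3)|exact: (derivable_is_derive d6)|exact: lap].
Qed.

Lemma dx_linear (a b : R) p : dx (fun p => a * p.1 + b * p.2) p = a.
Proof.
rewrite /dx /= derive1E.
have h : is_derive p.1 1 (fun t : R => a * t + b * p.2) a.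
  by apply: is_derive_eq; rewrite /GRing.scale /=; ring.
by case: h.
Qed.

Lemma dy_linear (a b : R) p : dy (fun p => a * p.1 + b * p.2) p = b.
Proof.
rewrite /dy /= derive1E.
have h : is_derive p.2 1 (fun t : R => a * p.1 + b * t) b.
  by apply: is_derive_eq; rewrite /GRing.scale /=; ring.
by case: h.
Qed.

Variables eps delta : R.
Hypotheses (eps_gt0 : 0 < eps) (delta_gt0 : 0 < delta).
Local Notation E := (Ext eps delta).
Local Notation P := (2 + delta).
Local Notation c := (1 + eps / 2).

Lemma Cell_sub_Ext : Cell eps delta `<=` E.
Proof.
move=> p [p2 [pL pR]] n.
have [->//|n0] := eqVneq n 0.
have far : 1 < (p.2 - n%:~R * P) ^+ 2.
  have n1 : 1 <= `|n%:~R : R|.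
    by rewrite -intr_norm -(mulr1z (1 : R)) ler_int -gtz0_ge1 normr_gt0.
  have d0 := delta_gt0.
  have h : P - `|p.2| <= `|p.2 - n%:~R * P|.
    have h1 := ler_normB (p.2 - n%:~R * P) p.2.
    have E1 : p.2 - n%:~R * P - p.2 = - (n%:~R * P) by ring.
    rewrite E1 normrN normrM (ger0_norm (_ : 0 <= P)) in h1; last lra.
    have : P <= `|n%:~R| * P by rewrite ler_peMl //; lra.
    by lra.
  rewrite -(real_normK (num_real (p.2 - _))).
  have h4 : 1 < `|p.2 - n%:~R * P| by lra.
  by nra.
by rewrite /sqdist /cL /cR /=; split; rewrite ltr_wpDl // sqr_ge0.
Qed.

Lemma open_Cell : open (Cell eps delta).
Proof.
have -> : Cell eps delta = (snd @^-1` `](- (1 + delta / 2)), (1 + delta / 2)[%classic) `&`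
  ([set p | 1 < sqdist p (cL eps delta 0)] `&` [set p | 1 < sqdist p (cR eps delta 0)]).
  by apply/seteqP; split => p /=; rewrite /Cell /= in_itv /= ltr_norml.
apply: openI; last by apply: openI; exact: open_sqdist_gt.
by apply: open_comp => [p _|]; [exact: cvg_snd|exact: interval_open].
Qed.

(** Connectedness of the exterior domain through explicit paths. A point with [|x| <= c] goes
    horizontally to the axis; any other first moves outward by 2, past all disks, then vertically to
    the height [P / 2], and back to the axis along that line. *)
Lemma Ext_constant (g gx gy : R * R -> R) :
  (forall p, E p -> is_derive p.1 1 (fun t => g (t, p.2)) (gx p)) ->
  (forall p, E p -> is_derive p.2 1 (fun t => g (p.1, t)) (gy p)) ->
  (forall p, E p -> gx p = 0) -> (forall p, E p -> gy p = 0) ->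
  forall p, E p -> g p = g (0, 0).
Proof.
move=> dgx dgy gx0 gy0.
have hor x y t : x < y -> (forall s, x <= s <= y -> E (s, t)) -> g (x, t) = g (y, t).
  move=> xy Es; have D s : x <= s <= y -> is_derive s 1 (fun s => g (s, t)) (gx (s, t)) by move=> /Es /dgx.
  have [z [/andP[h1 h2] EE]] := mean_value xy D.
  have Ez : E (z, t) by apply: Es; rewrite !ltW.
  by apply/esym/eqP; rewrite -subr_eq0 EE gx0 ?mul0r.
have ver x y t : (forall s, E (t, s)) -> g (t, x) = g (t, y).
  move=> Es.
  have lt x' y' : x' < y' -> g (t, x') = g (t, y').
    move=> xy; have D s : x' <= s <= y' -> is_derive s 1 (fun s => g (t, s)) (gy (t, s)) by move=> _; exact: dgy (Es s).
    have [z [_ EE]] := mean_value xy D.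
    by apply/esym/eqP; rewrite -subr_eq0 EE gy0 ?mul0r //; exact: Es.
  by have [xy|yx|->//] := ltgtP x y; [exact: lt|apply/esym; exact: lt].
have e0 := eps_gt0.
have axis y : g (0, y) = g (0, 0) by apply: ver => s; exact: Ext_axis.
have right x y : 0 < x -> E (x, y) -> g (x, y) = g (0, 0).
  move=> x0 Exy; have [xc|/ltW cx] := leP x c.
    by rewrite -(axis y); apply/esym; apply: hor => // s s0x; exact: (Ext_inward eps_gt0 Exy).
  have h1 : g (x, y) = g (x + 2, y).
    apply: hor; first lra.
    by move=> s /andP[s1 s2]; apply: (Ext_outward eps_gt0 Exy); rewrite cx.
  have h2 : g (x + 2, y) = g (x + 2, P / 2).
    by apply: ver => s; apply: Ext_far => //; rewrite ger0_norm; lra.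
  have h3 : g (0, P / 2) = g (x + 2, P / 2).
    by apply: hor => [|s _]; [lra|exact: Ext_mid].
  by rewrite h1 h2 -h3.
have left x y : x < 0 -> E (x, y) -> g (x, y) = g (0, 0).
  move=> x0 Exy; have Exy' := Ext_negx Exy.
  have [xc|/ltW cx] := leP (- x) c.
    rewrite -(axis y); apply: hor => // s /andP[s1 s2].
    rewrite -[s]opprK; apply: Ext_negx; apply: (Ext_inward eps_gt0 Exy') => //.
    by apply/andP; split; lra.
  have h1 : g (x - 2, y) = g (x, y).
    apply: hor; first lra.
    move=> s /andP[s1 s2]; rewrite -[s]opprK; apply: Ext_negx.
    by apply: (Ext_outward eps_gt0 Exy'); rewrite cx; lra.
  have h2 : g (x - 2, y) = g (x - 2, P / 2).
    by apply: ver => s; apply: Ext_far => //; rewrite ler0_norm; lra.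
  have h3 : g (x - 2, P / 2) = g (0, P / 2).
    by apply: hor => [|s _]; [lra|exact: Ext_mid].
  by rewrite -h1 h2 h3.
move=> [x y] Exy; have [x0|x0|x0] := ltgtP x 0; [exact: left|exact: right|by rewrite x0].
Qed.

(** [sg] is 1 or -1 and selects the end of the strip. The exact value of the mean on each line is
    kept next to the limit: it is what forces a function bounded by its own limit to be constant on
    lines. *)
Definition far_limit_at sg (w : R * R -> R) (a b : R) := exists k : R,
  (forall x, 2 + eps / 2 < x -> Rint (- (P / 2)) (P / 2) (fun y => w (sg * x, y) - a * (sg * x) - b * y) = k * P) /\
  (forall e, 0 < e -> exists X, forall x y, X < x -> `|w (sg * x, y) - a * (sg * x) - b * y - k| <= e).

Section FarBehaviour.
Variables (a b : R) (u ux uy uxx uyy : R * R -> R).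
Hypothesis u_derive : forall p, E p ->
  [/\ is_derive p.1 1 (fun t => u (t, p.2)) (ux p), is_derive p.2 1 (fun t => u (p.1, t)) (uy p),
      is_derive p.1 1 (fun t => ux (t, p.2)) (uxx p), is_derive p.2 1 (fun t => uy (p.1, t)) (uyy p)
    & uxx p + uyy p = 0].
Hypothesis u_cont : forall p, E p ->
  [/\ {for p, continuous u}, {for p, continuous ux}, {for p, continuous uy},
      {for p, continuous uxx} & {for p, continuous uyy}].
Hypothesis u_per : forall x y, E (x, y) -> ux (x, y) = ux (x, y + P) /\ uy (x, y) = uy (x, y + P).
Let Fsq p := (ux p - a) ^+ 2 + (uy p - b) ^+ 2.
Hypothesis u_energy : (\int[(@lebesgue_measure R) \x (@lebesgue_measure R)]_(p in Cell eps delta) (Fsq p)%:E < +oo)%E.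

Let cont_Fsq p : E p -> {for p, continuous Fsq}.
Proof.
move=> Ep; have [_ cx cy _ _] := u_cont Ep.
by apply: cvgD; apply: cvgM; apply: cvgB => //; exact: cvg_cst.
Qed.

(** Otherwise all lines beyond some abscissa carry energy at least [eta^2], and strips of growing
    width inside the cell make the energy exceed any finite value. *)
Lemma energy_line sg (eta X : R) : `|sg| = 1 -> 0 < eta -> exists x, [/\ X < x, 2 + eps / 2 < x &
  Rint (- (P / 2)) (P / 2) (fun y => Fsq (sg * x, y)) <= eta ^+ 2].
Proof.
move=> sg1 eta0; apply: contrapT => H.
have e0 := eps_gt0; have d0 := delta_gt0.
pose X' := Num.max X (2 + eps / 2) + 1.
have X'1 : X < X' by rewrite /X' ltr_pwDr // le_max lexx.
have X'2 : 2 + eps / 2 < X' by rewrite /X' ltr_pwDr // le_max lexx orbT.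
have big x : X' <= x -> eta ^+ 2 <= Rint (- (P / 2)) (P / 2) (fun y => Fsq (sg * x, y)).
  move=> X'x; rewrite leNgt; apply/negP => h; apply: H; exists x; split; [lra|lra|exact: ltW].
have far x y : X' <= `|x| -> E (x, y) by move=> h; apply: Ext_far => //; lra.
have eta2 : 0 < eta ^+ 2 by rewrite exprn_gt0.
have main (n : R) : 0 < n -> ((eta ^+ 2 * n)%:E <= \int[(@lebesgue_measure R) \x (@lebesgue_measure R)]_(p in Cell eps delta) (Fsq p)%:E)%E.
  move=> n0; pose al := if 0 < sg then X' else - (X' + n); pose be := if 0 < sg then X' + n else - X'.
  have ben : be - al = n by rewrite /al /be; case: ifP => _; ring.
  have inx x : al <= x <= be -> exists2 t, X' <= t & x = sg * t.
    rewrite /al /be; move: sg1; case: ltrP => s0 sg1 /andP[h1 h2].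
      by exists x => //; rewrite -(gtr0_norm s0) sg1 mul1r.
    exists (- x); first lra.
    by have : sg = -1; [rewrite -sg1 ler0_norm // opprK|move=> ->; ring].
  rewrite -ben; apply: (@plane_integral_ge R _ Fsq al be (- (P / 2)) (P / 2)).
  - exact: open_Cell.
  - by move=> p /Cell_sub_Ext; exact: cont_Fsq.
  - by move=> p; rewrite addr_ge0 ?sqr_ge0.
  - exact: ltW.
  - by rewrite -subr_gt0 ben.
  - lra.
  - move=> x y /inx[t Xt ->] /andP[y1 y2].
    have Et : E (sg * t, y) by apply: far; rewrite normrM sg1 mul1r ler_normr Xt.
    have := Et 0; rewrite /Cell /= => h; split; last exact: h.
    by rewrite ltr_norml; apply/andP; split; lra.
  - move=> x /inx[t Xt ->] y _; apply: continuous_slice2; apply: cont_Fsq.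
    by apply: far; rewrite normrM sg1 mul1r ler_normr Xt.
  - by move=> x /inx[t Xt ->]; exact: big.
have I0 : (0 <= \int[(@lebesgue_measure R) \x (@lebesgue_measure R)]_(p in Cell eps delta) (Fsq p)%:E)%E.
  by apply: integral_ge0 => p _; rewrite lee_fin addr_ge0 ?sqr_ge0.
move: main I0 u_energy; case: integral => [I| |] // main; rewrite !lee_fin => I0 _.
(* A strip of this width carries energy at least [I + 1]. *)
have I1 : 0 < (I + 1) / eta ^+ 2 by rewrite divr_gt0 //; lra.
have := main _ I1; rewrite lee_fin mulrC divfK ?gt_eqF //; lra.
Qed.

Let f sg p := u (sg * p.1, p.2) - a * (sg * p.1) - b * p.2.
Let fx sg p := sg * (ux (sg * p.1, p.2) - a).
Let fy sg p := uy (sg * p.1, p.2) - b.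
Let fxx sg p := uxx (sg * p.1, p.2).
Let fyy sg p := uyy (sg * p.1, p.2).

(** For [sg = -1] the left end is reflected to the right, so the analysis at infinity is done once;
    the energy density is invariant under this reflection. *)
Let far_data sg (x1 := 2 + eps / 2) : `|sg| = 1 ->
  [/\ forall p, x1 < p.1 ->
      [/\ is_derive p.1 1 (fun t => f sg (t, p.2)) (fx sg p), is_derive p.2 1 (fun t => f sg (p.1, t)) (fy sg p),
      is_derive p.1 1 (fun t => fx sg (t, p.2)) (fxx sg p), is_derive p.2 1 (fun t => fy sg (p.1, t)) (fyy sg p)
      & fxx sg p + fyy sg p = 0],
    forall p, x1 < p.1 ->
     [/\ {for p, continuous (f sg)}, {for p, continuous (fx sg)}, {for p, continuous (fy sg)},
       {for p, continuous (fxx sg)} & {for p, continuous (fyy sg)}],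
    forall x y, x1 < x -> fy sg (x, y + P) = fy sg (x, y) &
    forall eta X, 0 < eta -> exists x, [/\ X < x, x1 < x &
      Rint (- (P / 2)) (P / 2) (fun y => fx sg (x, y) ^+ 2 + fy sg (x, y) ^+ 2) <= eta ^+ 2]].
Proof.
move=> sg1; have e0 := eps_gt0.
have Ep p : x1 < p.1 -> E (sg * p.1, p.2).
  by move=> p1; apply: Ext_far => //; rewrite normrM sg1 mul1r ger0_norm; rewrite /x1 in p1; lra.
have sg2 : sg * sg = 1 by have := real_normK (num_real sg); rewrite sg1 expr1n => /esym; rewrite expr2.
have comp (g : R * R -> R) p : {for (sg * p.1, p.2), continuous g} -> {for p, continuous (fun p => g (sg * p.1, p.2))}.
  move=> cg; apply: (@continuous_comp _ _ _ (fun p : R * R => (sg * p.1, p.2))) cg.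
  by apply: continuous_pair2; [apply: cvgMr; exact: cvg_fst|exact: cvg_snd].
have dcomp (g : R -> R) t d : is_derive (sg * t) 1 g d -> is_derive t 1 (fun t => g (sg * t)) (sg * d).
  move=> dg; have dg' : is_derive (sg * t + 0) 1 g d by rewrite addr0.
  by have := is_derive_affine_comp dg'; under eq_fun do rewrite addr0.
split.
- move=> p p1; have [d1 d2 d3 d4 lap] := u_derive (Ep p p1).
  split; last exact: lap.
  + have D1 := dcomp (fun t => u (t, p.2)) p.1 _ d1.
    have D2 : is_derive p.1 1 (fun t : R => a * (sg * t)) (a * sg).
      by apply: is_derive_eq; rewrite /GRing.scale /=; ring.
    have := is_deriveB (is_deriveB D1 D2) (is_derive_cst (b * p.2) p.1 1).
    by move/is_derive_eq; apply; rewrite /fx; ring.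
  + have D2 : is_derive p.2 1 (fun t : R => b * t) b.
      by apply: is_derive_eq; rewrite /GRing.scale /=; ring.
    have := is_deriveB (is_deriveB d2 (is_derive_cst (a * (sg * p.1)) p.2 1)) D2.
    by move/is_derive_eq; apply; rewrite /fy subr0.
  + have D1 := dcomp (fun t => ux (t, p.2)) p.1 _ d3.
    have := is_deriveZ sg (is_deriveB D1 (is_derive_cst a p.1 1)).
    by move/is_derive_eq; apply; rewrite /fxx /GRing.scale /= subr0 mulrA sg2 mul1r.
  + have := is_deriveB d4 (is_derive_cst b p.2 1).
    by move/is_derive_eq; apply; rewrite /fyy subr0.
- move=> p p1; have [c0 c1 c2 c3 c4] := u_cont (Ep p p1).
  split.
  + apply: cvgB; first apply: cvgB; first exact: (comp u).
      by apply: cvgMr; apply: cvgMr; exact: cvg_fst.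
    by apply: cvgMr; exact: cvg_snd.
  + by apply: cvgMr; apply: cvgB; [exact: (comp ux)|exact: cvg_cst].
  + by apply: cvgB; [exact: (comp uy)|exact: cvg_cst].
  + exact: (comp uxx).
  + exact: (comp uyy).
- by move=> x y x1x; rewrite /fy /=; have [_ <-] := u_per (Ep (x, y) x1x).
- move=> eta X eta0; have [x [Xx x1x Ee]] := energy_line X sg1 eta0.
  exists x; split => //; rewrite (_ : Rint _ _ _ = Rint (- (P / 2)) (P / 2) (fun y => Fsq (sg * x, y))) //.
  by apply: eq_Rint => y _; rewrite /fx /fy /Fsq /= exprMn expr2 sg2 mul1r.
Qed.

(** The difference [g] of [u] and its translate has zero gradient, hence is constant on the
    connected exterior. Minus [b P], this constant is the increment over a period of [u - a x - b y]
    on every far line, which the finite energy forces to vanish. *)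
Lemma quasiperiodic x y : E (x, y) -> u (x, y + P) = u (x, y) + b * P.
Proof.
have e0 := eps_gt0; have d0 := delta_gt0.
pose g p := u (p.1, p.2 + P) - u p.
have dcomp (h : R -> R) t d : is_derive (t + P) 1 h d -> is_derive t 1 (fun t => h (t + P)) d.
  move=> dh; have dh' : is_derive (1 * t + P) 1 h d by rewrite mul1r.
  by have := is_derive_affine_comp dh'; rewrite mul1r; under eq_fun do rewrite mul1r.
have Hc p : E p -> g p = g (0, 0).
  apply: (@Ext_constant g (fun p => ux (p.1, p.2 + P) - ux p) (fun p => uy (p.1, p.2 + P) - uy p)).
  - move=> q Eq; have Eq' : E (q.1, q.2 + P) by apply: Ext_shift1; rewrite -surjective_pairing.
    have [d1 _ _ _ _] := u_derive Eq; have [d1' _ _ _ _] := u_derive Eq'.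
    exact: is_deriveB.
  - move=> q Eq; have Eq' : E (q.1, q.2 + P) by apply: Ext_shift1; rewrite -surjective_pairing.
    have [_ d1 _ _ _] := u_derive Eq; have [_ d1' _ _ _] := u_derive Eq'.
    exact: (is_deriveB (dcomp (fun t => u (q.1, t)) _ _ d1')).
  - by move=> [x' y'] /u_per[/= -> _]; rewrite subrr.
  - by move=> [x' y'] /u_per[/= _ ->]; rewrite subrr.
have kE : g (0, 0) = b * P.
  have [h1 h2 h3 h4] := far_data (normr1 R).
  apply/eqP; rewrite -subr_eq0; apply/eqP.
  apply: (@far_increment R delta (2 + eps / 2) delta_gt0 (f 1) (fx 1) (fy 1) (fxx 1) (fyy 1) h1 h2 h4) => x' x1.
  rewrite /f /= !mul1r.
  have Ex : E (x', - (P / 2)) by apply: Ext_far => //; rewrite ger0_norm; lra.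
  rewrite -(Hc _ Ex) /g /=; have -> : - (P / 2) + P = P / 2 by field.
  by field.
by move=> Exy; have := Hc _ Exy; rewrite kE /g /= => <-; ring.
Qed.

Lemma far_limits sg : `|sg| = 1 -> far_limit_at sg u a b.
Proof.
move=> sg1; have [h1 h2 h3 h4] := far_data sg1.
apply: (@far_limit R eps delta (2 + eps / 2) eps_gt0 delta_gt0 (lexx _) (f sg) (fx sg) (fy sg) (fxx sg) (fyy sg) h1 h2 h3 h4) => x y x1.
rewrite /f /= quasiperiodic; first ring.
by apply: Ext_far => //; have e0 := eps_gt0; rewrite normrM sg1 mul1r ger0_norm; lra.
Qed.

End FarBehaviour.

Variables (a b : R) (u : R * R -> R).
Hypothesis Hu : solution eps delta (fun p => a * p.1 + b * p.2) u.

Let Hharm : harmonic_on E u. Proof. by case: Hu. Qed.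

Let u_per x y : E (x, y) -> dx u (x, y) = dx u (x, y + P) /\ dy u (x, y) = dy u (x, y + P).
Proof. by case: Hu => _ _ _ _; apply. Qed.

Let u_energy : (\int[(@lebesgue_measure R) \x (@lebesgue_measure R)]_(p in Cell eps delta)
  ((dx u p - a) ^+ 2 + (dy u p - b) ^+ 2)%:E < +oo)%E.
Proof.
case: Hu => _ _ _ + _.
by congr (_ < _)%E; apply: eq_integral => p _; rewrite dx_linear dy_linear.
Qed.

Let u_C2 p : E p ->
  [/\ is_derive p.1 1 (fun t => u (t, p.2)) (dx u p), is_derive p.2 1 (fun t => u (p.1, t)) (dy u p),
      is_derive p.1 1 (fun t => dx u (t, p.2)) (dx (dx u) p), is_derive p.2 1 (fun t => dy u (p.1, t)) (dy (dy u) p)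
    & dx (dx u) p + dy (dy u) p = 0] /\
  [/\ {for p, continuous u}, {for p, continuous (dx u)}, {for p, continuous (dy u)},
      {for p, continuous (dx (dx u))} & {for p, continuous (dy (dy u))}].
Proof.
move=> Ep; have [[d1 [d2 [d3 [d4 [d5 d6]]]]] [[c0 [c1 [c2 [c3 [c4 [c5 c6]]]]]] lap]] := Hharm Ep.
split; last by split; [exact: c0|exact: c1|exact: c2|exact: c3|exact: c6].
split; [exact: (derivable_is_derive d1)|exact: (derivable_is_derive d2)|
  exact: (derivable_is_derive d3)|exact: (derivable_is_derive d6)|exact: lap].
Qed.

Lemma solution_quasiperiodic x y : E (x, y) -> u (x, y + P) = u (x, y) + b * P.
Proof.
exact: (@quasiperiodic a b u _ _ _ _ (fun p Ep => (u_C2 Ep).1) (fun p Ep => (u_C2 Ep).2) u_per u_energy).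
Qed.

Lemma solution_far sg : `|sg| = 1 -> far_limit_at sg u a b.
Proof.
exact: (@far_limits a b u _ _ _ _ (fun p Ep => (u_C2 Ep).1) (fun p Ep => (u_C2 Ep).2) u_per u_energy).
Qed.

End SolutionFacts.

(** * Circle means *)

Section CircleMean.
Variable R : realType.
Implicit Types (p q z : R * R) (e h k l r s t x y X : R).

Lemma mean_value_ne (f df : R -> R) x y :
  (forall s, Num.min x y <= s <= Num.max x y -> is_derive s 1 f (df s)) ->
  exists c, Num.min x y <= c <= Num.max x y /\ f y - f x = df c * (y - x).
Proof.
have [xy|yx|->] := ltgtP x y => H.
- have [c [/andP[c1 c2] E]] := mean_value xy H; exists c; split => //; apply/andP; split; exact: ltW.
- have [c [/andP[c1 c2] E]] := mean_value yx H; exists c; split; first by apply/andP; split; exact: ltW.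
  by rewrite -opprB E -mulrN opprB.
- by exists y; rewrite lexx; split => //; rewrite !subrr mulr0.
Qed.

Lemma between (z d w : R) : Num.min z (z + d) <= w <= Num.max z (z + d) -> `|w - z| <= `|d|.
Proof.
have [d0|/ltW d0] := lerP 0 d.
  have -> : Num.min z (z + d) = z by apply/min_idPl; rewrite lerDl.
  have -> : Num.max z (z + d) = z + d by apply/max_idPr; rewrite lerDl.
  by move=> /andP[h1 h2]; rewrite !ger0_norm; lra.
have -> : Num.min z (z + d) = z + d by apply/min_idPr; rewrite gerDl.
have -> : Num.max z (z + d) = z by apply/max_idPl; rewrite gerDl.
by move=> /andP[h1 h2]; rewrite !ler0_norm; lra.
Qed.

(** The chain rule from continuous partial derivatives: the increment is split into a horizontal and
    a vertical step, and the mean value theorem is applied to each. *)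
Lemma directional_derive (U : set (R * R)) (u ux uy : R * R -> R) x0 y0 al be s0 : open U ->
  U (x0 + s0 * al, y0 + s0 * be) ->
  (forall p, U p -> is_derive p.1 1 (fun t => u (t, p.2)) (ux p)) ->
  (forall p, U p -> is_derive p.2 1 (fun t => u (p.1, t)) (uy p)) ->
  (forall p, U p -> {for p, continuous ux}) -> (forall p, U p -> {for p, continuous uy}) ->
  is_derive s0 1 (fun s => u (x0 + s * al, y0 + s * be))
    (ux (x0 + s0 * al, y0 + s0 * be) * al + uy (x0 + s0 * al, y0 + s0 * be) * be).
Proof.
move=> oU; set p := (x0 + s0 * al, y0 + s0 * be) => Up dux duy cux cuy.
apply/is_derive1P => e e0.
pose K := `|al| + `|be| + 1.
have K0 : 0 < K by have := normr_ge0 al; have := normr_ge0 be; rewrite /K; lra.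
have alK : `|al| <= K by have := normr_ge0 be; rewrite /K; lra.
have beK : `|be| <= K by have := normr_ge0 al; rewrite /K; lra.
have abK : `|al| + `|be| <= K by rewrite /K; lra.
have eK : 0 < e / K by exact: divr_gt0.
have /continuous_boxP/(_ _ eK)[r1 r10 H1] := cux p Up.
have /continuous_boxP/(_ _ eK)[r2 r20 H2] := cuy p Up.
have /nbhs_boxP[r3 r30 H3] : nbhs p U by exact: open_nbhs_nbhs.
pose r := Num.min r1 (Num.min r2 r3).
have r0 : 0 < r by rewrite !lt_min r10 r20.
have rr1 : r <= r1 by rewrite ge_min lexx.
have rr2 : r <= r2 by rewrite !ge_min lexx orbT.
have rr3 : r <= r3 by rewrite !ge_min lexx !orbT.
exists (r / K); first exact: divr_gt0.
move=> h; rewrite ltr_pdivlMr // => hK.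
have -> : x0 + (s0 + h) * al = p.1 + h * al by rewrite /p /=; ring.
have -> : y0 + (s0 + h) * be = p.2 + h * be by rewrite /p /=; ring.
have hal : `|h * al| < r by rewrite normrM (le_lt_trans _ hK) // ler_wpM2l.
have hbe : `|h * be| < r by rewrite normrM (le_lt_trans _ hK) // ler_wpM2l.
have [|c [/between c1 E1]] := @mean_value_ne (fun t => u (t, p.2 + h * be)) (fun t => ux (t, p.2 + h * be)) p.1 (p.1 + h * al).
  move=> s /between hs; apply: (dux (s, p.2 + h * be)); apply: H3; last by rewrite addrC addKr; exact: lt_le_trans rr3.
  exact: le_lt_trans hs (lt_le_trans hal rr3).
have [|c' [/between c2 E2]] := @mean_value_ne (fun t => u (p.1, t)) (fun t => uy (p.1, t)) p.2 (p.2 + h * be).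
  move=> s /between hs; apply: (duy (p.1, s)); apply: H3; first by rewrite subrr normr0.
  exact: le_lt_trans hs (lt_le_trans hbe rr3).
rewrite (surjective_pairing p) /= in E1 E2 *.
have -> : u (p.1 + h * al, p.2 + h * be) - u (p.1, p.2) - (ux (p.1, p.2) * al + uy (p.1, p.2) * be) * h =
  (ux (c, p.2 + h * be) - ux (p.1, p.2)) * (h * al) + (uy (p.1, c') - uy (p.1, p.2)) * (h * be).
  have -> : u (p.1 + h * al, p.2 + h * be) - u (p.1, p.2) =
    (u (p.1 + h * al, p.2 + h * be) - u (p.1, p.2 + h * be)) + (u (p.1, p.2 + h * be) - u (p.1, p.2)) by ring.
  by rewrite E1 E2; ring.
apply: (le_trans (ler_normD _ _)); rewrite !normrM.
have b1 : `|ux (c, p.2 + h * be) - ux (p.1, p.2)| <= e / K.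
  rewrite -surjective_pairing; apply/ltW/H1; first by apply: (le_lt_trans c1); exact: lt_le_trans rr1.
  by rewrite addrC addKr; exact: lt_le_trans rr1.
have b2 : `|uy (p.1, c') - uy (p.1, p.2)| <= e / K.
  rewrite -surjective_pairing; apply/ltW/H2; first by rewrite subrr normr0.
  by apply: (le_lt_trans c2); exact: lt_le_trans rr2.
have h1 : `|ux (c, p.2 + h * be) - ux (p.1, p.2)| * (`|h| * `|al|) <= e / K * (`|h| * `|al|).
  by apply: ler_wpM2r => //; exact: mulr_ge0.
have h2 : `|uy (p.1, c') - uy (p.1, p.2)| * (`|h| * `|be|) <= e / K * (`|h| * `|be|).
  by apply: ler_wpM2r => //; exact: mulr_ge0.
apply: (le_trans (lerD h1 h2)); rewrite -!mulrDr.
have -> : e * `|h| = e / K * (`|h| * K) by field; rewrite gt_eqF.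
by rewrite ler_wpM2l ?(ltW eK) // ler_wpM2l.
Qed.

Definition circ (ctr : R * R) r t : R * R := (ctr.1 + r * cos t, ctr.2 + r * sin t).

Lemma sqdist_circ ctr r t : sqdist (circ ctr r t) ctr = r ^+ 2.
Proof.
rewrite /sqdist /circ /= !(addrC _.1) !(addrC _.2) !addrK !exprMn -mulrDr.
by rewrite cos2Dsin2 mulr1.
Qed.

Lemma continuous_circ ctr (p : R * R) : {for p, continuous (fun z : R * R => circ ctr z.1 z.2)}.
Proof.
apply: continuous_pair2; apply: cvgD; try exact: cvg_cst; apply: cvgM; try exact: cvg_fst.
  by apply: continuous_comp; [exact: cvg_snd|exact: continuous_cos].
by apply: continuous_comp; [exact: cvg_snd|exact: continuous_sin].
Qed.

Variable U : set (R * R).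
Hypothesis openU : open U.

Definition boundary_value (w : R * R -> R) ctr k := forall q, sqdist q ctr = 1 ->
  forall e, 0 < e -> \forall p \near q, U p -> `|w p - k| <= e.

Variables (u ux uy : R * R -> R) (ctr : R * R) (k r0 : R).
Hypothesis r0_gt0 : 0 < r0.
Hypothesis circU : forall r t, 1 < r < 1 + r0 -> U (circ ctr r t).
Hypothesis u_dx : forall p, U p -> is_derive p.1 1 (fun t => u (t, p.2)) (ux p).
Hypothesis u_dy : forall p, U p -> is_derive p.2 1 (fun t => u (p.1, t)) (uy p).
Hypothesis u_c : forall p, U p -> {for p, continuous u}.
Hypothesis ux_c : forall p, U p -> {for p, continuous ux}.
Hypothesis uy_c : forall p, U p -> {for p, continuous uy}.
Hypothesis u_bd : boundary_value u ctr k.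
Hypothesis u_flux : forall e, 0 < e -> exists2 d : R, 0 < d & forall r, 1 < r < 1 + d ->
  `|Rint 0 (2 * pi) (fun t => ux (circ ctr r t) * cos t + uy (circ ctr r t) * sin t)| <= e.

Let M r := Rint 0 (2 * pi) (fun t => u (circ ctr r t)).

Let pi2 : 0 < 2 * pi :> R. Proof. by apply: mulr_gt0 => //; exact: pi_gt0. Qed.

Let cont_g (w : R * R -> R) r t : (forall p, U p -> {for p, continuous w}) -> 1 < r < 1 + r0 ->
  {for (r, t), continuous (fun z : R * R => w (circ ctr z.1 z.2))}.
Proof.
move=> cw rI; apply: (@continuous_comp _ _ _ (fun z : R * R => circ ctr z.1 z.2) w); first exact: continuous_circ.
by apply: cw; exact: circU.
Qed.

Lemma circ_cont_on (w : R * R -> R) r a b : (forall p, U p -> {for p, continuous w}) -> 1 < r < 1 + r0 ->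
  cont_on a b (fun t => w (circ ctr r t)).
Proof.
by move=> cw rI t _; apply: (@continuous_slice2 R (fun z => w (circ ctr z.1 z.2))); exact: cont_g.
Qed.

Let dM r : 1 < r < 1 + r0 ->
  is_derive r 1 M (Rint 0 (2 * pi) (fun t => ux (circ ctr r t) * cos t + uy (circ ctr r t) * sin t)).
Proof.
move=> rI.
apply: (@derive_Rint R (fun z => u (circ ctr z.1 z.2))
  (fun z => ux (circ ctr z.1 z.2) * cos z.2 + uy (circ ctr z.1 z.2) * sin z.2) 1 (1 + r0)) => //; first exact: ltW.
move=> s t sI _; split; first exact: cont_g.
split.
  apply: cvgD; apply: cvgM; try exact: cont_g.
    by apply: continuous_comp; [exact: cvg_snd|exact: continuous_cos].
  by apply: continuous_comp; [exact: cvg_snd|exact: continuous_sin].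
exact: (@directional_derive U u ux uy ctr.1 ctr.2 (cos t) (sin t) s openU (circU t sI) u_dx u_dy ux_c uy_c).
Qed.

Let M_limit e : 0 < e -> exists2 d : R, 0 < d & forall r, 1 < r < 1 + d -> `|M r - k * (2 * pi)| <= e.
Proof.
move=> e0; pose e' := e / (2 * pi); have e'0 : 0 < e' by exact: divr_gt0.
(* The boundary limits are given point by point; compactness of the parameter interval makes them
   uniform along the circle. *)
have := (@compact_near_coveringP _ (`[0, 2 * pi]%classic : set R)).1 (@segment_compact R 0 (2 * pi)).
move=> /(_ R (nbhs (1 : R)) (fun r t => U (circ ctr r t) -> `|u (circ ctr r t) - k| <= e') _) [].
  move=> t _.
  have c1 : sqdist (circ ctr 1 t) ctr = 1 by rewrite sqdist_circ expr1n.
  have h := u_bd c1 e'0.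
  have cc : {for (t, 1 : R), continuous (fun z : R * R => circ ctr z.2 z.1)}.
    apply: (@continuous_comp _ _ _ (fun z : R * R => (z.2, z.1)) (fun z : R * R => circ ctr z.1 z.2)).
      by apply: continuous_pair2; [exact: cvg_snd|exact: cvg_fst].
    exact: continuous_circ.
  exact: (cc _ h).
move=> d /= d0 Hd; exists (Num.min d r0); first by rewrite lt_min d0.
move=> r /andP[r1 rd].
have rd' : r < 1 + d by apply: (lt_le_trans rd); rewrite lerD2l ge_min lexx.
have rr0 : r < 1 + r0 by apply: (lt_le_trans rd); rewrite lerD2l ge_min lexx orbT.
have rI : 1 < r < 1 + r0 by rewrite r1.
have cu : cont_on 0 (2 * pi) (fun t => u (circ ctr r t)) by exact: circ_cont_on.
have := @le_norm_Rint R 0 (2 * pi) (fun t => u (circ ctr r t) - k) e' (ltW pi2).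
rewrite RintB //; last exact: cont_on_cst.
rewrite (Rint_cst k (ltW pi2)) subr0 /e' divfK ?gt_eqF // => H.
rewrite /M; apply: H; first by apply: cont_onB => //; exact: cont_on_cst.
move=> t tI; apply: (Hd r) => //; last exact: circU.
by rewrite /ball /= distrC ger0_norm; lra.
Qed.

(** The derivative in [r] of the integral [M r] is the integral of the radial derivative, at most
    [e] near [r = 1]; the mean value theorem between [s] and [r], with [s] so close to 1 that [M s]
    is within [e'] of its limit, gives the estimate up to the arbitrary [e']. *)
Lemma circle_mean e : 0 < e -> exists2 d : R, 0 < d & forall r, 1 < r < 1 + d -> 1 < r < 1 + r0 /\
  `|Rint 0 (2 * pi) (fun t => u (circ ctr r t)) - k * (2 * pi)| <= e * (r - 1).
Proof.
move=> e0; have [d d0 Hd] := u_flux e0.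
exists (Num.min d r0); first by rewrite lt_min d0.
move=> r /andP[r1 rd].
have rd' : r < 1 + d by apply: (lt_le_trans rd); rewrite lerD2l ge_min lexx.
have rr0 : r < 1 + r0 by apply: (lt_le_trans rd); rewrite lerD2l ge_min lexx orbT.
split; first by rewrite r1.
apply/ler_addgt0Pr => e' e'0.
have [d' d'0 Hd'] := M_limit e'0.
pose s := 1 + Num.min (d' / 2) ((r - 1) / 2).
have s1 : 1 < s by rewrite ltrDl lt_min !divr_gt0 // subr_gt0.
have sd : s < 1 + d' by rewrite ltrD2l gt_min; apply/orP; left; lra.
have sr : s < r.
  have : Num.min (d' / 2) ((r - 1) / 2) <= (r - 1) / 2 by rewrite ge_min lexx orbT.
  by rewrite /s; lra.
have D x : s <= x <= r -> is_derive x 1 M (Rint 0 (2 * pi) (fun t => ux (circ ctr x t) * cos t + uy (circ ctr x t) * sin t)).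
  by move=> /andP[sx xr]; apply: dM; apply/andP; split; lra.
have [z [/andP[sz zr] EE]] := mean_value sr D.
have hz : `|Rint 0 (2 * pi) (fun t => ux (circ ctr z t) * cos t + uy (circ ctr z t) * sin t)| <= e.
  by apply: Hd; apply/andP; split; lra.
have h1 : `|M r - M s| <= e * (r - 1).
  rewrite EE normrM (gtr0_norm (_ : 0 < r - s)); last lra.
  by apply: ler_pM => //; lra.
have h2 : `|M s - k * (2 * pi)| <= e' by apply: Hd'; rewrite s1.
have -> : Rint 0 (2 * pi) (fun t => u (circ ctr r t)) - k * (2 * pi) = (M r - M s) + (M s - k * (2 * pi)) by rewrite /M; ring.
by apply: (le_trans (ler_normD _ _)); exact: lerD.
Qed.

(** The lower half-circle is folded onto the upper one by the substitution of [2 pi - t] for [t],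
    which is the form adapted to functions even in [y]. *)
Lemma circle_mean_half e : ctr.2 = 0 -> 0 < e -> exists2 d : R, 0 < d & forall r, 1 < r < 1 + d -> 1 < r < 1 + r0 /\
  `|Rint 0 pi (fun t => u (ctr.1 + r * cos t, r * sin t) + u (ctr.1 + r * cos t, - (r * sin t))) - k * (2 * pi)| <= e * (r - 1).
Proof.
move=> c2 e0; have [d d0 Hd] := circle_mean e0; exists d => // r /Hd[rI]; split => //.
move: b; congr (`|_ - _| <= _).
have cu a b : cont_on a b (fun t => u (circ ctr r t)) by exact: circ_cont_on.
have p0 := @pi_gt0 R.
have pI : (0 : R) <= (pi : R) <= 2 * pi by apply/andP; split; lra.
have pL : pi < 2 * pi :> R by lra.
rewrite (Rint_split pI (cu _ _)) (Rint_reflect (2 * pi) pL (cu _ _)).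
have -> : 2 * pi - 2 * pi = 0 :> R by ring.
have -> : 2 * pi - pi = pi :> R by ring.
rewrite -RintD; first last.
- move=> t _; apply: (@continuous_comp _ _ _ (fun t : R => 2 * pi - t) (fun t => u (circ ctr r t))).
    by apply: cvgB; [exact: cvg_cst|exact: cvg_id].
  by apply: (cu (2 * pi - t) (2 * pi - t)); rewrite lexx.
- exact: cu.
apply: eq_Rint => t _; rewrite /circ c2 !add0r.
rewrite (_ : cos (2 * pi - t) = cos t); last by rewrite mulr_natl cosB cos2pi sin2pi; ring.
rewrite (_ : sin (2 * pi - t) = - sin t); last by rewrite mulr_natl sinB cos2pi sin2pi; ring.
by rewrite mulrN.
Qed.

End CircleMean.

(** * The odd part of a solution *)

Section Profiles.
Variable R : realType.
Implicit Types (p q z : R * R) (w v : R * R -> R) (e h k l r s t x y X : R).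
Variables eps delta : R.
Hypotheses (eps_gt0 : 0 < eps) (delta_gt0 : 0 < delta).
Local Notation E := (Ext eps delta).
Local Notation P := (2 + delta).
Local Notation c := (1 + eps / 2).
Local Notation rho := (Num.min eps delta).

Lemma rho_gt0 : 0 < rho. Proof. by rewrite lt_min eps_gt0. Qed.

(** The gaps have width at least [min eps delta]; circles of radius below [1 + rho] about a central
    disk therefore stay in the exterior domain. *)
Lemma center_dist (ctr : R * R) (n : int) : ctr = cL eps delta 0 \/ ctr = cR eps delta 0 ->
  forall ctr', ctr' = cL eps delta n \/ ctr' = cR eps delta n -> ctr' = ctr \/ (2 + rho) ^+ 2 <= sqdist ctr ctr'.
Proof.
have e0 := eps_gt0; have d0 := delta_gt0; have r0 := rho_gt0.
have re : rho <= eps by rewrite ge_min lexx.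
have rd : rho <= delta by rewrite ge_min lexx orbT.
have nP : n != 0 -> (2 + rho) ^+ 2 <= (0 - n%:~R * P) ^+ 2.
  move=> n0; have n1 : 1 <= `|n%:~R : R|.
    by rewrite -intr_norm -(mulr1z (1 : R)) ler_int -gtz0_ge1 normr_gt0.
  rewrite sub0r sqrrN exprMn -(real_normK (num_real n%:~R)).
  have h1 : 1 <= `|n%:~R : R| ^+ 2 by rewrite expr_ge1.
  have h2 : (2 + rho) ^+ 2 <= P ^+ 2 by rewrite lerXn2r ?nnegrE; lra.
  by apply: (le_trans h2); rewrite ler_peMl // sqr_ge0.
have xd : (2 + rho) ^+ 2 <= (2 + eps) ^+ 2 by rewrite lerXn2r ?nnegrE; lra.
move=> [->|->] ctr' [->|->]; rewrite /sqdist /cL /cR /= ?mul0r.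
- have [->|/nP h] := eqVneq n 0; [left; by rewrite mul0r|right].
  by rewrite subrr expr0n add0r.
- right; have := sqr_ge0 (0 - n%:~R * P).
  have -> : -1 - eps / 2 - (1 + eps / 2) = - (2 + eps) by field.
  by rewrite sqrrN; lra.
- right; have := sqr_ge0 (0 - n%:~R * P).
  have -> : 1 + eps / 2 - (-1 - eps / 2) = 2 + eps by field.
  by lra.
- have [->|/nP h] := eqVneq n 0; [left; by rewrite mul0r|right].
  by rewrite subrr expr0n add0r.
Qed.

Lemma Ext_circ (ctr : R * R) r t : ctr = cL eps delta 0 \/ ctr = cR eps delta 0 ->
  1 < r < 1 + rho -> E (circ ctr r t).
Proof.
move=> Hc /andP[r1 rr] n.
have main ctr' : ctr' = cL eps delta n \/ ctr' = cR eps delta n -> 1 < sqdist (circ ctr r t) ctr'.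
  move=> Hc'; have [->|far] := center_dist Hc Hc'; first by rewrite sqdist_circ; nra.
  rewrite ltNge; apply/negP => h.
  have h1 : sqdist ctr (circ ctr r t) <= r ^+ 2 by rewrite sqdistC sqdist_circ.
  have h2 : sqdist (circ ctr r t) ctr' <= 1 ^+ 2 by rewrite expr1n.
  have r0 : 0 <= r by lra.
  have := sqdist_triangle r0 ler01 h1 h2.
  have : (r + 1) ^+ 2 < (2 + rho) ^+ 2 by rewrite ltrXn2r ?nnegrE //; lra.
  by lra.
by split; apply: main; [left|right].
Qed.

(** The two integrals differ by the factor [- r], and [r >= 1], so dropping it can only decrease the
    absolute value. *)
Lemma flux_eps (fx fy : R * R -> R) (ctr : R * R) :
  (forall r, 1 < r < 1 + rho -> cont_on 0 (2 * pi) (fun t => fx (circ ctr r t) * cos t + fy (circ ctr r t) * sin t)) ->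
  (fun r => \int[@lebesgue_measure R]_(t in `[0, 2 * pi]%classic)
     (- (fx (ctr.1 + r * cos t, ctr.2 + r * sin t) * cos t +
         fy (ctr.1 + r * cos t, ctr.2 + r * sin t) * sin t) * r)) r @[r --> 1^'+] --> (0 : R) ->
  forall e, 0 < e -> exists2 d : R, 0 < d & forall r, 1 < r < 1 + d ->
  `|Rint 0 (2 * pi) (fun t => fx (circ ctr r t) * cos t + fy (circ ctr r t) * sin t)| <= e.
Proof.
move=> cf /cvgrPdist_le H e e0; have := H e e0.
rewrite /at_right near_withinE => /nbhs_ballP[d /= d0 Hd].
exists (Num.min d rho); first by rewrite lt_min d0 rho_gt0.
move=> r /andP[r1 rd].
have rd' : r < 1 + d by apply: (lt_le_trans rd); rewrite lerD2l ge_min lexx.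
have rr : r < 1 + rho by apply: (lt_le_trans rd); rewrite lerD2l ge_min lexx orbT.
have := Hd r; rewrite /ball /= distrC ger0_norm ?subr_ge0 ?(ltW r1) // ltrBlDl => /(_ rd' r1).
rewrite sub0r normrN.
have rI : 1 < r < 1 + rho by rewrite r1.
have -> : \int[@lebesgue_measure R]_(t in `[0, 2 * pi]%classic)
     (- (fx (ctr.1 + r * cos t, ctr.2 + r * sin t) * cos t +
         fy (ctr.1 + r * cos t, ctr.2 + r * sin t) * sin t) * r) =
   - r * Rint 0 (2 * pi) (fun t => fx (circ ctr r t) * cos t + fy (circ ctr r t) * sin t).
  rewrite -RintZ; last exact: cf.
  by apply: eq_Rint => t _; rewrite /circ; ring.
rewrite normrM normrN (ger0_norm (_ : 0 <= r)); last lra.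
by apply: le_trans; apply: ler_peMl => //; exact: ltW.
Qed.

Lemma cont_on_opp (f : R -> R) s : cont_on (- s) s f -> cont_on (- s) s (fun y => f (- y)).
Proof.
move=> cf y /andP[y1 y2]; apply: (@continuous_comp _ _ _ (fun t : R => - t)); first by apply: cvgN; exact: cvg_id.
by apply: cf; apply/andP; split; lra.
Qed.

Lemma Rint_opp (f : R -> R) s : - s < s -> cont_on (- s) s f ->
  Rint (- s) s (fun y => f (- y)) = Rint (- s) s f.
Proof.
move=> ss cf; rewrite [RHS](Rint_reflect 0 ss cf) !sub0r opprK.
by apply: eq_Rint => y _; rewrite sub0r.
Qed.

Section FromSolution.
Variables (a b : R) (u : R * R -> R).
Hypothesis Hu : solution eps delta (fun p => a * p.1 + b * p.2) u.

Let u_C2 p : E p ->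
  [/\ is_derive p.1 1 (fun t => u (t, p.2)) (dx u p), is_derive p.2 1 (fun t => u (p.1, t)) (dy u p),
      {for p, continuous u}, {for p, continuous (dx u)} & {for p, continuous (dy u)}].
Proof.
have H : harmonic_on E u by case: Hu.
move=> Ep; have [[d1 [d2 _]] [[c0 [c1 [c2 _]]] _]] := H p Ep.
by split; [exact: (derivable_is_derive d1)|exact: (derivable_is_derive d2)|exact: c0|exact: c1|exact: c2].
Qed.

Lemma const_on_circle_boundary_value w ctr : const_on_circle E w ctr -> exists k, boundary_value E w ctr k.
Proof.
move=> [k Hk]; exists k => q qc e e0; have := Hk q qc => /cvgrPdist_le /(_ e e0).
by rewrite near_withinE; apply: filterS => p h /h; rewrite distrC.
Qed.

Lemma boundary_value_shift w ctr k (n : int) :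
  (forall x y (n : int), E (x, y) -> w (x, y + n%:~R * P) = w (x, y) + n%:~R * (b * P)) ->
  boundary_value E w ctr k -> boundary_value E w (ctr.1, ctr.2 + n%:~R * P) (k + n%:~R * (b * P)).
Proof.
move=> Hw bw q qc e e0.
have qc' : sqdist (q.1, q.2 - n%:~R * P) ctr = 1 by rewrite -[RHS]qc /sqdist /=; ring.
have /nbhs_boxP[r r0 Hr] := bw _ qc' e e0.
apply/nbhs_boxP; exists r => // x y hx hy Exy.
have Exy' : E (x, y - n%:~R * P).
  by have := Ext_shift (- n) Exy; rewrite rmorphN /= mulNr.
have := Hw x (y - n%:~R * P) n Exy'; rewrite subrK => ->.
rewrite opprD addrACA subrr addr0; apply: Hr => //=.
by rewrite opprB addrA subrK.
Qed.

Lemma solution_shift (n : int) x y : E (x, y) -> u (x, y + n%:~R * P) = u (x, y) + n%:~R * (b * P).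
Proof.
move=> Exy; have := @periodic_shift R eps delta [set: R] (fun p => u p - b * p.2) n x y _ Exy I.
have pw : periodic eps delta [set: R] (fun p => u p - b * p.2).
  by move=> x' y' Exy' _ /=; rewrite (solution_quasiperiodic eps_gt0 delta_gt0 Hu) //; ring.
by move=> /(_ pw) /= h; have -> : u (x, y + n%:~R * P) = u (x, y + n%:~R * P) - b * (y + n%:~R * P) + b * (y + n%:~R * P); [ring|rewrite h; ring].
Qed.

Lemma solution_boundary : exists kL kR : R,
  (forall n : int, boundary_value E u (cL eps delta n) (kL + n%:~R * (b * P))) /\
  (forall n : int, boundary_value E u (cR eps delta n) (kR + n%:~R * (b * P))).
Proof.
case: Hu => _ [/const_on_circle_boundary_value[kL HL] /const_on_circle_boundary_value[kR HR]] _ _ _.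
exists kL, kR; split => n.
  have := boundary_value_shift (n := n) (fun x y m => @solution_shift m x y) HL.
  by rewrite /cL /= mul0r add0r.
have := boundary_value_shift (n := n) (fun x y m => @solution_shift m x y) HR.
by rewrite /cR /= mul0r add0r.
Qed.

Lemma solution_circle_mean (ctr : R * R) k e : ctr = cL eps delta 0 \/ ctr = cR eps delta 0 ->
  boundary_value E u ctr k -> 0 < e ->
  exists2 d : R, 0 < d & forall r, 1 < r < 1 + d -> 1 < r < 1 + rho /\
  `|Rint 0 pi (fun t => u (ctr.1 + r * cos t, r * sin t) + u (ctr.1 + r * cos t, - (r * sin t))) - k * (2 * pi)| <= e * (r - 1).
Proof.
move=> Hc bk e0.
have zf : zero_flux u ctr by case: Hu => _ _ [? ?] _ _; case: Hc => ->.
have c2 : ctr.2 = 0 by case: Hc => ->; rewrite /cL /cR /= mul0r.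
have circE r t : 1 < r < 1 + rho -> E (circ ctr r t) by exact: Ext_circ.
apply: (@circle_mean_half R E (@open_Ext R eps delta delta_gt0) u (dx u) (dy u) ctr k rho rho_gt0 circE) => //.
- by move=> p /u_C2[].
- by move=> p /u_C2[].
- by move=> p /u_C2[].
- by move=> p /u_C2[].
- by move=> p /u_C2[].
apply: flux_eps zf => r rI.
have cc w : (forall p, E p -> {for p, continuous w}) -> cont_on 0 (2 * pi) (fun t => w (circ ctr r t)).
  by move=> cw; exact: (@circ_cont_on R E ctr rho circE w r 0 (2 * pi) cw rI).
have cx := cc (dx u) (fun p Ep => let: And5 _ _ _ h _ := u_C2 Ep in h).
have cy := cc (dy u) (fun p Ep => let: And5 _ _ _ _ h := u_C2 Ep in h).
move=> t tI; apply: cvgD; apply: cvgM; [exact: cx|exact: continuous_cos|exact: cy|exact: continuous_sin].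
Qed.

(* The part of the solution that is odd in x and even in y: it solves the problem for H = a x and does not see b. *)
Definition profile w p : R := 4^-1 * (w p + w (p.1, - p.2) - w (- p.1, p.2) - w (- p.1, - p.2)).

(** Oddness in [x] enters as the Dirichlet condition on the axis, so that only the right half plane
    is ever considered; evenness in [y] allows the zero flux to be stated on the upper half-circle,
    in its integrated form. All the conditions are linear in [(a, d, v)]. *)
Definition odd_profile (a d : R) v :=
 [/\ exists vx vy, harm E v vx vy,
     forall x y, E (x, y) -> v (x, y + P) = v (x, y),
     forall n, boundary_value E v (cR eps delta n) d,
     forall y, v (0, y) = 0 &
     far_limit_at eps delta 1 v a 0 /\
     forall e, 0 < e -> exists2 t : R, 0 < t & forall r, 1 < r < 1 + t -> 1 < r < 1 + rho /\
       `|Rint 0 pi (fun t => v (circ (cR eps delta 0) r t)) - d * pi| <= e * (r - 1)].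

Lemma boundary_value_reflect w (s1 s2 : R) ctr k : `|s1| = 1 -> `|s2| = 1 -> 
  boundary_value E w (s1 * ctr.1, s2 * ctr.2) k -> boundary_value E (fun p => w (s1 * p.1, s2 * p.2)) ctr k.
Proof.
move=> n1 n2 bw q qc e e0.
have sq1 : s1 ^+ 2 = 1 by rewrite -(real_normK (num_real s1)) n1 expr1n.
have sq2 : s2 ^+ 2 = 1 by rewrite -(real_normK (num_real s2)) n2 expr1n.
have qc' : sqdist (s1 * q.1, s2 * q.2) (s1 * ctr.1, s2 * ctr.2) = 1.
  by rewrite -[RHS]qc /sqdist /= -!mulrBr !exprMn sq1 sq2 !mul1r.
have /nbhs_boxP[r r0 Hr] := bw _ qc' e e0.
apply/nbhs_boxP; exists r => // x y hx hy Exy; apply: Hr => /=.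
- by rewrite -mulrBr normrM n1 mul1r.
- by rewrite -mulrBr normrM n2 mul1r.
have S (s t : R) : `|s| = 1 -> s * t = t \/ s * t = - t.
  by case: (ltrP 0 s) => s0; [rewrite gtr0_norm // => ->; left; rewrite mul1r
    |rewrite ler0_norm // => h; right; rewrite -[s]opprK h mulN1r].
by case: (S s1 x n1) => ->; case: (S s2 y n2) => -> //; [exact: Ext_negy|exact: Ext_negx|apply: Ext_negx; exact: Ext_negy].
Qed.

Lemma solution_profile kL kR :
  (forall n : int, boundary_value E u (cL eps delta n) (kL + n%:~R * (b * P))) ->
  (forall n : int, boundary_value E u (cR eps delta n) (kR + n%:~R * (b * P))) ->
  odd_profile a ((kR - kL) / 2) (profile u).
Proof.
move=> HL HR.
have e0 := eps_gt0; have d0 := delta_gt0.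
have n1 : `|1 : R| = 1 by exact: normr1.
have nN1 : `|-1 : R| = 1 by rewrite normrN normr1.
have sN1 : (-1) ^+ 2 = 1 :> R by rewrite sqrrN expr1n.
have s1 : 1 ^+ 2 = 1 :> R by exact: expr1n.
have Hh := harmonic_on_harm (let: And5 h _ _ _ _ := Hu in h).
have refl (i j : R) : (i = 1 \/ i = -1) -> (j = 1 \/ j = -1) -> forall p, E p -> E (i * p.1 + 0, j * p.2 + 0).
  move=> Hi Hj [x y] Exy /=; rewrite !addr0.
  by case: Hi => ->; case: Hj => ->; rewrite ?mul1r ?mulN1r //; [exact: Ext_negy|exact: Ext_negx|apply: Ext_negx; exact: Ext_negy].
have h2 := harm_sub (refl 1 (-1) (or_introl erefl) (or_intror erefl)) (harm_isometry 0 0 s1 sN1 Hh).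
have h3 := harm_sub (refl (-1) 1 (or_intror erefl) (or_introl erefl)) (harm_isometry 0 0 sN1 s1 Hh).
have h4 := harm_sub (refl (-1) (-1) (or_intror erefl) (or_intror erefl)) (harm_isometry 0 0 sN1 sN1 Hh).
split.
- do 2 eexists; apply: (harm_ext (harmZ 4^-1 (harmB (harmB (harmD Hh h2) h3) h4))) => p //=.
  by rewrite /profile /= !mul1r !mulN1r !addr0.
- move=> x y Exy; rewrite /profile /=.
  rewrite (solution_quasiperiodic eps_gt0 delta_gt0 Hu) // (solution_quasiperiodic eps_gt0 delta_gt0 Hu (Ext_negx Exy)).
  have q x' : E (x', y) -> u (x', - (y + P)) = u (x', - y) - b * P.
    move=> Ex'; have Ey := Ext_negy (Ext_shift1 Ex').
    have := solution_quasiperiodic eps_gt0 delta_gt0 Hu Ey.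
    by have -> : - (y + P) + P = - y; [ring|move=> ->; rewrite addrK].
  by rewrite !q //; [ring|exact: Ext_negx].
- move=> n q qc e e0'.
  (* Reflection in the [x]-axis exchanges the indices [n] and [- n], so the multiples of [b P] in
     the four boundary values cancel. *)
  have cLn m : (-1 * (cR eps delta m).1, 1 * (cR eps delta m).2) = cL eps delta m.
    by rewrite /cL /cR /=; congr (_, _); ring.
  have cRn m : (1 * (cR eps delta m).1, -1 * (cR eps delta m).2) = cR eps delta (- m).
    by rewrite /cL /cR /= rmorphN /=; congr (_, _); ring.
  have cLn' m : (-1 * (cR eps delta m).1, -1 * (cR eps delta m).2) = cL eps delta (- m).
    by rewrite /cL /cR /= rmorphN /=; congr (_, _); ring.
  have b1 := HR n q qc e e0'.
  have b2 : boundary_value E (fun p => u (1 * p.1, -1 * p.2)) (cR eps delta n) (kR + (- n)%:~R * (b * P)).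
    by apply: boundary_value_reflect => //; rewrite cRn; exact: HR.
  have b3 : boundary_value E (fun p => u (-1 * p.1, 1 * p.2)) (cR eps delta n) (kL + n%:~R * (b * P)).
    by apply: boundary_value_reflect => //; rewrite cLn; exact: HL.
  have b4 : boundary_value E (fun p => u (-1 * p.1, -1 * p.2)) (cR eps delta n) (kL + (- n)%:~R * (b * P)).
    by apply: boundary_value_reflect => //; rewrite cLn'; exact: HL.
  move: (b2 q qc e e0') (b3 q qc e e0') (b4 q qc e e0') => {}b2 {}b3 {}b4.
  apply: (@filterS _ (nbhs q) (nbhs_filter q) _ _ _ (@filterI _ (nbhs q) (nbhs_filter q) _ _ (@filterI _ (nbhs q) (nbhs_filter q) _ _ b1 b2) (@filterI _ (nbhs q) (nbhs_filter q) _ _ b3 b4))) => p [[g1 g2] [g3 g4]] Ep.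
  move: (g1 Ep) (g2 Ep) (g3 Ep) (g4 Ep); rewrite /profile !mul1r !mulN1r rmorphN /= mulNr.
  rewrite !ler_norml => /andP[? ?] /andP[? ?] /andP[? ?] /andP[? ?].
  by apply/andP; split; lra.
- by move=> y; rewrite /profile /= oppr0; ring.
split.
- have [kp [mp lp]] := solution_far eps_gt0 delta_gt0 Hu n1.
  have [km [mm lm]] := solution_far eps_gt0 delta_gt0 Hu nN1.
  exists ((kp - km) / 2); split.
    move=> x x1.
    pose Fp y := u (1 * x, y) - a * (1 * x) - b * y.
    pose Fm y := u (-1 * x, y) - a * (-1 * x) - b * y.
    have cF (s : R) : `|s| = 1 -> cont_on (- (P / 2)) (P / 2) (fun y => u (s * x, y) - a * (s * x) - b * y).
      move=> ns y _; have Ex : E (s * x, y) by apply: Ext_far => //; rewrite normrM ns mul1r ger0_norm; lra.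
      apply: cvgB; last by apply: cvgMr; exact: cvg_id.
      by apply: cvgB; [apply: continuous_slice2; have [] := u_C2 Ex|exact: cvg_cst].
    have cFp : cont_on (- (P / 2)) (P / 2) Fp by exact: cF.
    have cFm : cont_on (- (P / 2)) (P / 2) Fm by exact: cF.
    have cFp' := cont_on_opp cFp; have cFm' := cont_on_opp cFm.
    rewrite (@eq_Rint _ _ _ _ (fun y => 4^-1 * (Fp y + Fp (- y) - Fm y - Fm (- y)))); last first.
      by move=> y _; rewrite /profile /Fp /Fm /= !mul1r !mulN1r; field.
    have PP : - (P / 2) < P / 2 by lra.
    have c1 := cont_onD cFp cFp'; have c2 := cont_onB c1 cFm; have c3 := cont_onB c2 cFm'.
    rewrite (RintZ _ c3) (RintB c2 cFm') (RintB c1 cFm) (RintD cFp cFp').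
    rewrite !Rint_opp //; have -> : Rint (- (P / 2)) (P / 2) Fp = kp * P by exact: mp.
    have -> : Rint (- (P / 2)) (P / 2) Fm = km * P by exact: mm.
    by field.
  move=> e e0'; have [Xp HXp] := lp e e0'; have [Xm HXm] := lm e e0'.
  exists (Num.max Xp Xm) => x y; rewrite gt_max => /andP[xp xm].
  move: (HXp x y xp) (HXp x (- y) xp) (HXm x y xm) (HXm x (- y) xm).
  rewrite /profile /= !mul1r !mulN1r !ler_norml => /andP[? ?] /andP[? ?] /andP[? ?] /andP[? ?].
  by apply/andP; split; lra.
- move=> e e0'.
  have bR0 : boundary_value E u (cR eps delta 0) kR by have := HR 0; rewrite mulr0z mul0r addr0.
  have bL0 : boundary_value E u (cL eps delta 0) kL by have := HL 0; rewrite mulr0z mul0r addr0.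
  have [tR tR0 HtR] := @solution_circle_mean (cR eps delta 0) kR e (or_intror erefl) bR0 e0'.
  have [tL tL0 HtL] := @solution_circle_mean (cL eps delta 0) kL e (or_introl erefl) bL0 e0'.
  exists (Num.min tR tL); first by rewrite lt_min tR0.
  move=> r /andP[r1 rt].
  have rR : 1 < r < 1 + tR by rewrite r1 (lt_le_trans rt) // lerD2l ge_min lexx.
  have rL : 1 < r < 1 + tL by rewrite r1 (lt_le_trans rt) // lerD2l ge_min lexx orbT.
  have [rI hR] := HtR r rR; have [_ hL] := HtL r rL; split => //.
  have cc (s : R) ctr : (s = 1 \/ s = -1) -> ctr = cL eps delta 0 \/ ctr = cR eps delta 0 -> cont_on 0 pi (fun t => u (ctr.1 + r * cos t, s * (r * sin t))).
    move=> Hs Hc t _.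
    apply: (@continuous_comp _ _ _ (fun t : R => (ctr.1 + r * cos t, s * (r * sin t))) u).
      have c1 : {for t, continuous (fun t : R => ctr.1 + r * cos t)}.
        by apply: cvgD; [exact: cvg_cst|apply: cvgMr; exact: continuous_cos].
      have c2 : {for t, continuous (fun t : R => s * (r * sin t))}.
        by apply: cvgMr; apply: cvgMr; exact: continuous_sin.
      exact: (cvg_pair c1 c2).
    have Ec := Ext_circ t Hc rI.
    have c0 : ctr.2 = 0 by case: Hc => ->; rewrite /cL /cR /= mul0r.
    rewrite /circ c0 add0r in Ec.
    have Es : E (ctr.1 + r * cos t, s * (r * sin t)) by case: Hs => ->; rewrite ?mul1r ?mulN1r //; exact: Ext_negy.
    by have [] := u_C2 Es.
  pose g ctr t := u ((ctr : R * R).1 + r * cos t, r * sin t) + u (ctr.1 + r * cos t, - (r * sin t)).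
  have cg ctr : ctr = cL eps delta 0 \/ ctr = cR eps delta 0 -> cont_on 0 pi (g ctr).
    move=> Hc; have h1' := cc 1 ctr (or_introl erefl) Hc; have h2' := cc (-1) ctr (or_intror erefl) Hc.
    have := cont_onD h1' h2'; rewrite /g; under eq_fun do rewrite mul1r mulN1r.
    by [].
  have cgR := cg _ (or_intror erefl); have cgL := cg _ (or_introl erefl).
  have cgL' : cont_on 0 pi (fun t => g (cL eps delta 0) (pi - t)).
    move=> t /andP[t0 t1]; apply: (@continuous_comp _ _ _ (fun t : R => pi - t)).
      by apply: cvgB; [exact: cvg_cst|exact: cvg_id].
    by apply: cgL; apply/andP; split; lra.
  (* The reflection in the [y]-axis sends the right circle to the left one and acts on the angle as
     [pi - t]. *)
  rewrite (@eq_Rint _ _ _ _ (fun t => 4^-1 * (g (cR eps delta 0) t - g (cL eps delta 0) (pi - t)))); last first.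
    move=> t _; rewrite /profile /g /circ /cL /cR /= !mul0r !add0r cosB sinB cospi sinpi.
    rewrite (_ : -1 - eps / 2 + r * (-1 * cos t + 0 * sin t) = - (1 + eps / 2 + r * cos t)); last by ring.
    by rewrite (_ : r * (0 * cos t - -1 * sin t) = r * sin t); ring.
  rewrite (RintZ _ (cont_onB cgR cgL')) (RintB cgR cgL').
  have -> : Rint 0 pi (fun t => g (cL eps delta 0) (pi - t)) = Rint 0 pi (g (cL eps delta 0)).
    by rewrite [RHS](Rint_reflect pi (@pi_gt0 R) cgL) subrr subr0.
  move: hR hL; rewrite -/(g (cR eps delta 0)) -/(g (cL eps delta 0)).
  move: (Rint 0 pi (g (cR eps delta 0))) (Rint 0 pi (g (cL eps delta 0))) => IR IL.
  rewrite !ler_norml => /andP[? ?] /andP[? ?]; have r10 : 0 <= e * (r - 1) by rewrite mulr_ge0 //; lra.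
  by apply/andP; split; lra.
Qed.

End FromSolution.

End Profiles.

(** * Hopf's lemma, decay of the bipolar potential, contact with a disk *)

Section Comparison.
Variable R : realType.
Implicit Types (p q z : R * R) (w v : R * R -> R) (e h k l r s t x y X S : R).

Lemma one_sub_cos_le s : 1 - cos s <= s ^+ 2 / 2.
Proof.
suff pos x : 0 < x -> 1 - cos x <= x ^+ 2 / 2.
  have [s0|s0|->] := ltgtP s 0; [|exact: pos|by rewrite cos0 subrr expr0n mul0r].
  by rewrite -cosN -sqrrN; apply: pos; lra.
move=> x0.
have sin_le y : 0 < y -> sin y <= y.
  move=> y0; have [c [_ E]] := @mean_value R sin cos 0 y y0 (fun t _ => is_derive_sin t).
  by move: E; rewrite sin0 !subr0 => ->; rewrite ler_piMl ?cos_le1 // ltW.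
have [|c [/andP[c0 cx] E]] := @mean_value R (fun y => y ^+ 2 / 2 + cos y) (fun y => y - sin y) 0 x x0.
  move=> y _; have h : is_derive y 1 (fun y : R => y ^+ 2 / 2) y.
    by apply: is_derive_eq; rewrite /GRing.scale /=; field.
  by apply: is_deriveD; exact: is_derive_cos.
have : 0 <= (c - sin c) * (x - 0) by apply: mulr_ge0; [rewrite subr_ge0; exact: sin_le|rewrite subr0 ltW].
by rewrite -E cos0 expr0n /= mul0r; lra.
Qed.

(** On [0 < s <= 1] the bound holds with [s^2 / 4]; beyond, monotonicity of the cosine gives
    [1 - cos s >= 1 - cos 1 >= 1 / 4], and [s^2 <= 16]. *)
Lemma one_sub_cos_ge s : 0 <= s <= pi -> s ^+ 2 / 64 <= 1 - cos s.
Proof.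
have small x : 0 < x <= 1 -> x ^+ 2 / 4 <= 1 - cos x.
  move=> /andP[x0 x1].
  have sin_ge y : 0 < y <= 1 -> y / 2 <= sin y.
    move=> /andP[y0 y1]; have [c [/andP[c0 cy] E]] := @mean_value R sin cos 0 y y0 (fun t _ => is_derive_sin t).
    move: E; rewrite sin0 !subr0 => ->; have := one_sub_cos_le c.
    have c1 : c ^+ 2 <= 1 by rewrite expr_le1 //; lra.
    have c2 : 0 <= c by lra.
    by nra.
  have [|c [/andP[c0 cx] E]] := @mean_value R (fun y => - cos y - y ^+ 2 / 4) (fun y => sin y - y / 2) 0 x x0.
    move=> y _; have h : is_derive y 1 (fun y : R => y ^+ 2 / 4) (y / 2).
      by apply: is_derive_eq; rewrite /GRing.scale /=; field.
    have h2 := is_deriveN (is_derive_cos y); rewrite opprK in h2.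
    exact: is_deriveB.
  have : 0 <= (sin c - c / 2) * (x - 0) by apply: mulr_ge0; [rewrite subr_ge0; apply: sin_ge; rewrite c0; lra|rewrite subr0 ltW].
  by rewrite -E cos0 expr0n /= mul0r; lra.
move=> /andP[s0 spi].
have [->|sn0] := eqVneq s 0; first by rewrite cos0 subrr expr0n mul0r.
have sp : 0 < s by rewrite lt_neqAle eq_sym sn0.
have [s1|s1] := lerP s 1.
  by have := small s; rewrite sp s1 => /(_ isT); have := sqr_ge0 s; lra.
have h1 := small 1; rewrite ltr01 lexx in h1; have {}h1 := h1 isT.
have pi4 : pi < 4 :> R by have := @pihalf_lt2 R; lra.
have cs : cos s <= cos 1.
  have p2 := @pi_ge2 R.
  by apply/ltW; rewrite ltr_cos // in_itv /= ?spi ?s0 // ler01; lra.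
have : s ^+ 2 <= 16 by nra.
move: h1; rewrite expr1n; lra.
Qed.

(** The classical barrier in the annulus between the radii [1 / 2] and 1: [- (k / 2) ln |z - z0|^2]
    vanishes on the outer circle and equals [k ln 2 <= k] on the inner one. *)
Lemma hopf_ball z0 w wx wy k : harm [set z | sqdist z z0 < 1] w wx wy -> 0 <= k ->
  (forall z, sqdist z z0 < 1 -> 0 <= w z) ->
  (forall z, sqdist z z0 <= (1 / 2) ^+ 2 -> k <= w z) ->
  forall z, (1 / 2) ^+ 2 < sqdist z z0 < 1 -> k * (- ln (sqdist z z0) / 2) <= w z.
Proof.
move=> H k0 w0 wk.
pose A : set (R * R) := [set z | (1 / 2) ^+ 2 < sqdist z z0] `&` [set z | sqdist z z0 < 1].
have oA : open A by apply: openI; [exact: open_sqdist_gt|exact: open_sqdist_lt].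
have ln4 : - ln ((1 / 2) ^+ 2) <= 2 :> R.
  rewrite -lnV ?posrE ?exprn_gt0 //; have -> : ((1 / 2) ^+ 2)^-1 = (1 + 1) ^+ 2 :> R by field.
  by rewrite lnXn //; have := @le_ln1Dx R 1; rewrite mulr2n; lra.
pose F z := k / 2 * - ln (sqdist z z0) - w z.
have HF : exists Fx Fy, harm A F Fx Fy.
  do 2 eexists; apply: harmB; last by apply: harm_sub H => z [].
  have Az z : A z -> 0 < sqdist z z0 by move=> [/= h _]; apply: lt_trans h; rewrite exprn_gt0.
  have hl := harm_log Az.
  by apply: (harm_ext (harmZ (- (k / 2)) hl)) => p; first by rewrite mulrN mulNr.
have [Fx [Fy {}HF]] := HF.
have key : forall z, A z -> F z <= 0.
  pose X := Num.max `|z0.1| `|z0.2| + 1.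
  apply: (@harm_max_bounded R A F Fx Fy X oA HF).
    move=> z [_ /=]; rewrite /sqdist => zq.
    have bnd (a b : R) : a ^+ 2 + b ^+ 2 < 1 -> `|a| <= 1.
      move=> h; have := sqr_ge0 b; rewrite ler_norml => hb; apply/andP; split; nra.
    have h1 := bnd _ _ zq; rewrite addrC in zq; have h2 := bnd _ _ zq.
    have := ler_normD (z.1 - z0.1) z0.1; have := ler_normD (z.2 - z0.2) z0.2.
    have : `|z0.1| <= Num.max `|z0.1| `|z0.2| by rewrite le_max lexx.
    have : `|z0.2| <= Num.max `|z0.1| `|z0.2| by rewrite le_max lexx orbT.
    by rewrite !subrK /X; lra.
  move=> q nAq e e0.
  have cl : 0 < sqdist q z0 -> {for q, continuous (fun z => k / 2 * - ln (sqdist z z0))}.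
    move=> q0; apply: cvgMr; apply: cvgN; apply: (@continuous_comp _ _ _ (fun z => sqdist z z0) (@ln R)).
      exact: continuous_sqdist.
    exact: continuous_ln.
  have [q1|q1|q1] := ltgtP (sqdist q z0) 1; first last.
  - have q0 : 0 < sqdist q z0 by rewrite q1.
    have h0 : k / 2 * - ln (sqdist q z0) <= 0 by rewrite q1 ln1 oppr0 mulr0.
    have := near_le_continuous (cl q0) h0 e0; apply: filterS => z hz [_ z1].
    by rewrite /F; have := w0 z z1; lra.
  - have := @near_notin_closed R _ q (@open_sqdist_gt R z0 1) q1; apply.
    by move=> z /= z1 [_ /= z2]; lra.
  have [q2|q2|q2] := ltgtP (sqdist q z0) ((1 / 2) ^+ 2).
  - have := @near_notin_closed R _ q (@open_sqdist_lt R z0 _) q2; apply.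
    by move=> z /= z1 [/= z2 _]; lra.
  - by exfalso; apply: nAq.
  - have q0 : 0 < sqdist q z0 by rewrite q2 exprn_gt0.
    have cw : {for q, continuous w} by apply: (harm_continuous H).
    have cF : {for q, continuous F} by apply: cvgB => //; exact: cl.
    have Fq : F q <= 0.
      have := wk q; rewrite q2 lexx => /(_ isT) h; rewrite /F q2.
      have : k / 2 * - ln ((1 / 2) ^+ 2) <= k / 2 * 2 by rewrite ler_wpM2l //; lra.
      lra.
    by have := near_le_continuous cF Fq e0; apply: filterS => z hz _.
move=> z /andP[z1 z2]; have := key z (conj z1 z2); rewrite /F; lra.
Qed.

(** The squared distances to the foci differ by [4 (focus e) x], and [ln (1 + X) <= X]. Since [bip]
    is not periodic, this decay is what controls it at large heights. *)
Lemma bip_decay e z : 0 < e <= 1 -> 0 < z.1 -> z.2 != 0 -> 1 <= sqdist z (1 + e / 2, 0) ->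
  bip e z <= 4 * z.1 / z.2 ^+ 2.
Proof.
move=> /andP[e0 e1] x0 y0 z1; have l0 := lnfoc_gt0 e0; have f0 := focus_gt0 e0.
have /andP[l1 _] := lnfoc_bounds e0.
have z2 : 1 <= sqdist z (- 1 - e / 2, 0) by apply: (le_trans z1); rewrite /sqdist /=; nra.
have [g1 g2] := bip_domain e0 z1 z2.
have y2 : 0 < z.2 ^+ 2 by rewrite exprn_even_gt0.
rewrite /bip -ln_div ?posrE // ler_pdivrMr ?mulr_gt0 //.
have -> : sqdist z (- focus e, 0) / sqdist z (focus e, 0) = 1 + 4 * focus e * z.1 / sqdist z (focus e, 0).
  have -> : sqdist z (- focus e, 0) = sqdist z (focus e, 0) + 4 * focus e * z.1 by rewrite /sqdist /=; ring.
  by field; rewrite gt_eqF.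
have n0 : 0 <= 4 * focus e * z.1 by apply: mulr_ge0; [apply: mulr_ge0 => //; exact: ltW|exact: ltW].
have q0 : 0 <= 4 * focus e * z.1 / sqdist z (focus e, 0) by apply: divr_ge0 => //; exact: ltW.
apply: (le_trans (le_ln1Dx _)); first lra.
apply: (@le_trans _ _ (4 * focus e * z.1 / z.2 ^+ 2)).
  apply: ler_wpM2l => //; rewrite lef_pV2 ?posrE //.
  by rewrite /sqdist /= subr0 lerDr sqr_ge0.
have -> : 4 * z.1 / z.2 ^+ 2 * (2 * lnfoc e) = 4 * (2 * lnfoc e) * z.1 / z.2 ^+ 2 by field; rewrite y0.
rewrite ler_pdivrMr // divfK ?gt_eqF // ler_pM2r // ler_pM2l //.
move: l1; rewrite ler_pdivrMr ?addr_gt0 ?divr_gt0 //; nra.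
Qed.

Variables eps delta : R.
Hypotheses (eps_gt0 : 0 < eps) (delta_gt0 : 0 < delta).
Local Notation E := (Ext eps delta).
Local Notation P := (2 + delta).
Local Notation c := (1 + eps / 2).

(** The form of the maximum principle for comparisons involving a function that is not periodic: the
    region is bounded instead. *)
Lemma ext_max_bounded (G : set (R * R)) w wx wy S X : open G -> G `<=` E -> harm G w wx wy ->
  (forall p, G p -> `|p.1| <= X /\ `|p.2| <= X) ->
  (forall n q, sqdist q (cL eps delta n) = 1 -> forall e, 0 < e -> \forall p \near q, G p -> w p <= S + e) ->
  (forall n q, sqdist q (cR eps delta n) = 1 -> forall e, 0 < e -> \forall p \near q, G p -> w p <= S + e) ->
  (forall q, E q -> ~ G q -> forall e, 0 < e -> \forall p \near q, G p -> w p <= S + e) ->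
  forall p, G p -> w p <= S.
Proof.
move=> oG GE Hw GX bL bR bG p Gp; rewrite -subr_le0.
have HS := harmB Hw (harm_cst G S).
apply: (harm_max_bounded oG HS GX) Gp => q nGq e e0.
have weaken : (\forall z \near q, G z -> w z <= S + e) -> \forall z \near q, G z -> w z - S <= e.
  by apply: filterS => z h /h; lra.
case: (pselect (E q)) => [Eq|/not_Ext[n]]; first by apply: weaken; exact: bG.
have inside (ctr : R * R) : sqdist q ctr < 1 -> (forall z, E z -> 1 < sqdist z ctr) ->
    \forall z \near q, G z -> w z - S <= e.
  move=> zc Gc; have := @near_notin_closed _ _ q (@open_sqdist_lt R ctr 1) zc; apply.
  by move=> u /= uc /GE /Gc; lra.
case; rewrite le_eqVlt => /orP[/eqP h|h].
- by apply: weaken; exact: bL h e e0.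
- by apply: inside h _ => z /(_ n)[].
- by apply: weaken; exact: bR h e e0.
- by apply: inside h _ => z /(_ n)[].
Qed.

(* On a vertical line where w <= k has mean k, w is equal to k; the lines x > x1 = 2 + eps/2 come arbitrarily close to the boundary point (x1, 0) of a disk. *)
Lemma touch_bound w k S :
  (forall p, 2 + eps / 2 < p.1 -> {for p, continuous w}) ->
  (forall x, 2 + eps / 2 < x -> Rint (- (P / 2)) (P / 2) (fun y => w (x, y)) = k * P) ->
  (forall p, 2 + eps / 2 < p.1 -> w p <= k) ->
  (forall e, 0 < e -> \forall p \near (2 + eps / 2, 0 : R), 2 + eps / 2 < p.1 -> w p <= S + e) ->
  k <= S.
Proof.
move=> cw mw wk bw; have d0 := delta_gt0.
have line x : 2 + eps / 2 < x -> w (x, 0) = k.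
  move=> xx1; apply/eqP; rewrite eq_le wk //= leNgt; apply/negP => wlt.
  have cs : {for 0, continuous (fun y => w (x, y))} by apply: continuous_slice2; exact: cw.
  pose eta := (k - w (x, 0)) / 2; have eta0 : 0 < eta by rewrite /eta; lra.
  have /cvgrPdist_lt /(_ _ eta0) := cs => /nbhs_ballP[r /= r0 Hr].
  pose s := Num.min (r / 2) (P / 4).
  have s0 : 0 < s by rewrite lt_min; apply/andP; split; lra.
  have sr : s < r by rewrite /s gt_min; apply/orP; left; lra.
  have sP : s < P / 2 by rewrite /s gt_min; apply/orP; right; lra.
  have cl a' b' : cont_on a' b' (fun y => w (x, y)) by move=> y _; apply: continuous_slice2; exact: cw.
  have i1 : - (P / 2) <= 0 <= P / 2 by apply/andP; split; lra.
  have i2 : 0 <= s <= P / 2 by apply/andP; split; lra.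
  have := mw x xx1; rewrite (Rint_split i1 (cl _ _)) (Rint_split i2 (cl _ _)).
  have b1 : Rint (- (P / 2)) 0 (fun y => w (x, y)) <= k * (P / 2).
    have -> : k * (P / 2) = Rint (- (P / 2)) 0 (fun=> k) by rewrite Rint_cst; [ring|lra].
    by apply: le_Rint => // [|y _]; [exact: cont_on_cst|exact: wk].
  have b2 : Rint 0 s (fun y => w (x, y)) <= (k - eta) * s.
    have -> : (k - eta) * s = Rint 0 s (fun=> k - eta) by rewrite Rint_cst; [ring|lra].
    apply: le_Rint => // [|y /andP[y0 ys]]; first exact: cont_on_cst.
    have := Hr y; rewrite /ball /= sub0r normrN ger0_norm // => h.
    have := h ltac:(lra); rewrite ltr_norml /eta => /andP[]; lra.
  have b3 : Rint s (P / 2) (fun y => w (x, y)) <= k * (P / 2 - s).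
    have -> : k * (P / 2 - s) = Rint s (P / 2) (fun=> k) by rewrite Rint_cst //; lra.
    by apply: le_Rint => // [|y _]; [exact: cont_on_cst|exact: wk].
  have : 0 < eta * s by exact: mulr_gt0.
  by nra.
apply/ler_addgt0Pr => e e0; have /nbhs_boxP[r /= r0 Hr] := bw e e0.
rewrite -(line (2 + eps / 2 + r / 2)); last by lra.
by apply: Hr; rewrite /= ?subrr ?normr0 //; [rewrite ger0_norm; lra|lra].
Qed.

End Comparison.

(** * Linear combinations of profiles; maximum principles with unknown limits at infinity *)

Section ProfileCalculus.
Variable R : realType.
Implicit Types (p q z : R * R) (w v : R * R -> R) (e h k l r s t x y X S : R).

Lemma near_fst_lt q r : q.1 < r -> \forall p \near q, p.1 < r.
Proof.
move=> qr; apply/nbhs_boxP; exists (r - q.1); first by rewrite subr_gt0.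
by move=> x y /=; rewrite ltr_norml => /andP[_]; rewrite ltrD2r.
Qed.

Lemma near_fst_gt q r : r < q.1 -> \forall p \near q, r < p.1.
Proof.
move=> qr; apply/nbhs_boxP; exists (q.1 - r); first by rewrite subr_gt0.
by move=> x y /=; rewrite ltr_norml => /andP[]; lra.
Qed.

Lemma sqdist_right_half (cc x y r : R) : sqdist (x, y) (cc, r) = 1 -> cc - 1 <= x <= cc + 1.
Proof.
rewrite /sqdist /= => h; have := sqr_ge0 (y - r) => h2; apply/andP; split; nra.
Qed.

Variables eps delta : R.
Hypotheses (eps_gt0 : 0 < eps) (delta_gt0 : 0 < delta).
Local Notation E := (Ext eps delta).
Local Notation P := (2 + delta).
Local Notation c := (1 + eps / 2).
Local Notation right := [set x : R | 0 < x].

Lemma open_right : open right.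
Proof. exact: open_gt. Qed.

Lemma far_limit_comb sg w w' (a b a' b' s s' : R) : `|sg| = 1 ->
  (forall p, E p -> {for p, continuous w}) -> (forall p, E p -> {for p, continuous w'}) ->
  far_limit_at eps delta sg w a b -> far_limit_at eps delta sg w' a' b' ->
  far_limit_at eps delta sg (fun p => s * w p + s' * w' p) (s * a + s' * a') (s * b + s' * b').
Proof.
move=> sg1 cw cw' [k [Hk Lk]] [k' [Hk' Lk']]; exists (s * k + s' * k'); split.
  move=> x x1.
  have cl (u : R * R -> R) aa bb : (forall p, E p -> {for p, continuous u}) ->
      cont_on (- (P / 2)) (P / 2) (fun y => u (sg * x, y) - aa * (sg * x) - bb * y).
    move=> cu y _; have e0 := eps_gt0.
    have Ex : E (sg * x, y) by apply: Ext_far => //; rewrite normrM sg1 mul1r ger0_norm; lra.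
    apply: cvgB; last by apply: cvgMr; exact: cvg_id.
    by apply: cvgB; [apply: continuous_slice2; exact: cu|exact: cvg_cst].
  rewrite (@eq_Rint _ _ _ _ (fun y => s * (w (sg * x, y) - a * (sg * x) - b * y) + s' * (w' (sg * x, y) - a' * (sg * x) - b' * y))); last by move=> y _; ring.
  rewrite RintD; [|exact: cont_onZ (cl _ _ _ cw)|exact: cont_onZ (cl _ _ _ cw')].
  by rewrite (RintZ _ (cl _ _ _ cw)) (RintZ _ (cl _ _ _ cw')) Hk // Hk' //; ring.
move=> e e0; pose N := `|s| + `|s'| + 1; have N0 : 0 < N by rewrite /N; have := normr_ge0 s; have := normr_ge0 s'; lra.
have eN : 0 < e / N by exact: divr_gt0.
have [X HX] := Lk _ eN; have [X' HX'] := Lk' _ eN; exists (Num.max X X') => x y.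
rewrite gt_max => /andP[hx hx'].
have -> : s * w (sg * x, y) + s' * w' (sg * x, y) - (s * a + s' * a') * (sg * x) - (s * b + s' * b') * y - (s * k + s' * k') =
  s * (w (sg * x, y) - a * (sg * x) - b * y - k) + s' * (w' (sg * x, y) - a' * (sg * x) - b' * y - k') by ring.
apply: (le_trans (ler_normD _ _)); rewrite !normrM.
have h1 := ler_wpM2l (normr_ge0 s) (HX x y hx); have h2 := ler_wpM2l (normr_ge0 s') (HX' x y hx').
have -> : e = N * (e / N) by rewrite mulrC divfK // gt_eqF.
by apply: (le_trans (lerD h1 h2)); rewrite -mulrDl ler_wpM2r //; [exact: ltW|rewrite /N; lra].
Qed.

Lemma far_limit_affine sg w (a b : R) : far_limit_at eps delta sg w a b ->
  far_limit_at eps delta sg (fun p => w p - (a * p.1 + b * p.2)) 0 0.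
Proof.
move=> [k [Hk Lk]]; exists k; split.
  by move=> x /Hk <-; apply: eq_Rint => y _ /=; ring.
move=> e /Lk[X HX]; exists X => x y /(HX x y); congr (`|_| <= _) => /=; ring.
Qed.

(** Combinations with coefficients of any sign turn the one-sided estimates, proved for nonnegative
    [a], into statements for all [a] and into the uniqueness of the ratio of [d] to [a]. *)
Lemma odd_profile_comb (a a' d d' s s' : R) v v' :
  odd_profile eps delta a d v -> odd_profile eps delta a' d' v' ->
  odd_profile eps delta (s * a + s' * a') (s * d + s' * d') (fun p => s * v p + s' * v' p).
Proof.
move=> [[vx [vy Hv]] pv bv v0 [fv mv]] [[vx' [vy' Hv']] pv' bv' v0' [fv' mv']].
pose N := `|s| + `|s'| + 1; have N0 : 0 < N by rewrite /N; have := normr_ge0 s; have := normr_ge0 s'; lra.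
have comb (A B e : R) : `|A| <= e / N -> `|B| <= e / N -> `|s * A + s' * B| <= e.
  move=> hA hB; apply: (le_trans (ler_normD _ _)); rewrite !normrM.
  have e0 : 0 <= e / N := le_trans (normr_ge0 A) hA.
  have h1 := ler_wpM2l (normr_ge0 s) hA; have h2 := ler_wpM2l (normr_ge0 s') hB.
  have -> : e = N * (e / N) by rewrite mulrC divfK // gt_eqF.
  by apply: (le_trans (lerD h1 h2)); rewrite -mulrDl ler_wpM2r //; rewrite /N; lra.
split.
- by do 2 eexists; apply: harmD; apply: harmZ; [exact: Hv|exact: Hv'].
- by move=> x y Exy; rewrite pv // pv'.
- move=> n q qc e e0; have eN : 0 < e / N by exact: divr_gt0.
  apply: (@filterS _ (nbhs q) (nbhs_filter q) _ _ _ (@filterI _ (nbhs q) (nbhs_filter q) _ _ (bv n q qc _ eN) (bv' n q qc _ eN))) => p [h1 h2] Ep.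
  by have := comb _ _ _ (h1 Ep) (h2 Ep); congr (`|_| <= _); ring.
- by move=> y; rewrite v0 v0'; ring.
split.
  have cv p : E p -> {for p, continuous v} by exact: harm_continuous Hv.
  have cv' p : E p -> {for p, continuous v'} by exact: harm_continuous Hv'.
  by have := far_limit_comb s s' (@normr1 R) cv cv' fv fv'; rewrite !mulr0 addr0.
move=> e e0; have eN : 0 < e / N by exact: divr_gt0.
have [t t0 Ht] := mv _ eN; have [t' t0' Ht'] := mv' _ eN.
exists (Num.min t t'); first by rewrite lt_min t0.
move=> r /andP[r1 rt].
have rR : 1 < r < 1 + t by rewrite r1 (lt_le_trans rt) // lerD2l ge_min lexx.
have rL : 1 < r < 1 + t' by rewrite r1 (lt_le_trans rt) // lerD2l ge_min lexx orbT.
have [rI h] := Ht r rR; have [_ h'] := Ht' r rL; split => //.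
have cc (u ux uy : R * R -> R) : harm E u ux uy -> cont_on 0 pi (fun t => u (circ (cR eps delta 0) r t)).
  move=> Hu; apply: (@circ_cont_on R E (cR eps delta 0) (Num.min eps delta)) rI => [r' t'' rI'|p Ep].
    by apply: Ext_circ => //; right.
  exact: (harm_continuous Hu).
rewrite RintD; [|exact: cont_onZ (cc _ _ _ Hv)|exact: cont_onZ (cc _ _ _ Hv')].
rewrite (RintZ _ (cc _ _ _ Hv)) (RintZ _ (cc _ _ _ Hv')).
move: h h'; set A := Rint _ _ _; set B := Rint _ _ _ => h h'.
have r10 : r - 1 != 0 by rewrite gt_eqF // subr_gt0.
have eE x : x = e * (r - 1) -> e / N * (r - 1) = x / N by move=> ->; ring.
rewrite (eE _ erefl) in h h'.
by have := comb _ _ _ h h'; congr (`|_| <= _); ring.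
Qed.

(** The limit [k] at infinity is not prescribed. If it exceeded [S], then [w <= k] would hold
    everywhere while [w] has mean [k] on each far line, and the contact with the disk would give
    [k <= S]. *)
Lemma half_max w wx wy S : harm (column eps delta right) w wx wy -> periodic eps delta right w ->
  (forall n q, sqdist q (cR eps delta n) = 1 -> forall e, 0 < e -> \forall p \near q, column eps delta right p -> w p <= S + e) ->
  (forall q, E q -> q.1 = 0 -> forall e, 0 < e -> \forall p \near q, column eps delta right p -> w p <= S + e) ->
  far_limit_at eps delta 1 w 0 0 ->
  forall p, column eps delta right p -> w p <= S.
Proof.
move=> Hw pw bR b0 [k [mk lk]]; have e0 := eps_gt0.
have Gfar p : 2 + eps / 2 < p.1 -> column eps delta right p.
  case: p => x y /= x1; split => /=; last lra.
  by apply: Ext_far => //; rewrite ger0_norm; lra.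
have mx T : S <= T -> k <= T -> forall p, column eps delta right p -> w p <= T.
  move=> ST kT; apply: (@column_max R eps delta delta_gt0 right w wx wy T open_right Hw pw).
  - move=> n [x y] /sqdist_right_half /andP[_ xq] e _.
    have q0 : (x, y).1 < 0 by move: xq => /=; lra.
    by apply: filterS (near_fst_lt q0) => p p0 [_ /= p1]; lra.
  - by move=> n q qc e ep; apply: filterS (bR n q qc e ep) => p h /h; lra.
  - move=> q Eq /= /negP; rewrite -leNgt le_eqVlt => /orP[/eqP q0|q0] e ep.
      by apply: filterS (b0 q Eq q0 e ep) => p h /h; lra.
    by apply: filterS (near_fst_lt q0) => p p0 [_ /= p1]; lra.
  - move=> e ep; have [X HX] := lk e ep; exists X => -[x y] [_ /= x0]; rewrite gtr0_norm // => Xx.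
    by have := HX x y Xx; rewrite !mul0r !subr0 mul1r ler_norml => /andP[]; lra.
have [kS|Sk] := lerP k S; first exact: mx.
suff : k <= S by lra.
apply: (@touch_bound R eps delta delta_gt0 w k S).
- by move=> p p1; apply: (harm_continuous Hw); exact: Gfar.
- by move=> x x1; rewrite -(mk x x1); apply: eq_Rint => y _; rewrite !mul0r !subr0 mul1r.
- by move=> p p1; apply: (mx k) => //; [exact: ltW|exact: Gfar].
- move=> e ep; apply: filterS (bR 0 (2 + eps / 2, 0) _ e ep) => [p h p1|]; first by apply: h; exact: Gfar.
  by rewrite /sqdist /= mulr0z mul0r; ring.
Qed.

(** Same argument with two unknown limits: the larger one is handled by contact with a disk on its
    side, and the smaller is then below [S] as well. *)
Lemma full_max w wx wy S : harm E w wx wy -> periodic eps delta setT w ->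
  (forall n q, sqdist q (cL eps delta n) = 1 -> forall e, 0 < e -> \forall p \near q, E p -> w p <= S + e) ->
  (forall n q, sqdist q (cR eps delta n) = 1 -> forall e, 0 < e -> \forall p \near q, E p -> w p <= S + e) ->
  far_limit_at eps delta 1 w 0 0 -> far_limit_at eps delta (-1) w 0 0 ->
  forall p, E p -> w p <= S.
Proof.
move=> Hw pw bL bR [k [mk lk]] [l [ml ll]]; have e0 := eps_gt0.
have Gfar s p : `|s| = 1 -> 2 + eps / 2 < p.1 -> E (s * p.1, p.2).
  by move=> s1 p1; apply: Ext_far => //; rewrite normrM s1 mul1r ger0_norm; lra.
have colE : column eps delta setT = E by apply/seteqP; split => p; [case|].
have mx T : S <= T -> k <= T -> l <= T -> forall p, E p -> w p <= T.
  move=> ST kT lT; have := @column_max R eps delta delta_gt0 setT w wx wy T; rewrite colE; apply => //.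
  - exact: openT.
  - by move=> n q qc e ep; apply: filterS (bL n q qc e ep) => p h /h; lra.
  - by move=> n q qc e ep; apply: filterS (bR n q qc e ep) => p h /h; lra.
  - by move=> q _ /(_ I).
  - move=> e ep; have [X HX] := lk e ep; have [Y HY] := ll e ep.
    exists (Num.max X Y) => -[x y] _ /=; rewrite gt_max => /andP[Xx Yx].
    have [x0|x0] := lerP 0 x.
      move: Xx; rewrite ger0_norm // => /(HX x y); rewrite !mul0r !subr0 mul1r ler_norml => /andP[]; lra.
    move: Yx; rewrite ltr0_norm // => /(HY (- x) y); rewrite !mul0r !subr0 mulN1r opprK ler_norml => /andP[]; lra.
have nN1 : `|-1 : R| = 1 by rewrite normrN normr1.
have far_le (s kk : R) : `|s| = 1 -> kk <= S \/ (forall p, E p -> w p <= kk) ->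
    (forall x, 2 + eps / 2 < x -> Rint (- (P / 2)) (P / 2) (fun y => w (s * x, y) - 0 * (s * x) - 0 * y) = kk * P) ->
    (forall e, 0 < e -> \forall p \near (2 + eps / 2, 0 : R), 2 + eps / 2 < p.1 -> w (s * p.1, p.2) <= S + e) -> kk <= S.
  move=> s1 [//|wk] mkk bkk.
  apply: (@touch_bound R eps delta delta_gt0 (fun p => w (s * p.1, p.2)) kk S) => //.
  - move=> p p1; apply: (@continuous_comp _ _ _ (fun p : R * R => (s * p.1, p.2)) w).
      by apply: continuous_pair2; [apply: cvgMr; exact: cvg_fst|exact: cvg_snd].
    by apply: (harm_continuous Hw); exact: Gfar.
  - by move=> x x1; rewrite -(mkk x x1); apply: eq_Rint => y _; rewrite !mul0r !subr0.
  - by move=> p p1; apply: wk; exact: Gfar.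
have bk e : 0 < e -> \forall p \near (2 + eps / 2, 0 : R), 2 + eps / 2 < p.1 -> w (1 * p.1, p.2) <= S + e.
  move=> ep; apply: filterS (bR 0 (2 + eps / 2, 0) _ e ep) => [[x y] h p1|]; last by rewrite /sqdist /= mulr0z mul0r; ring.
  by have := @Gfar 1 (x, y) (normr1 _) p1; rewrite /= !mul1r.
have bl e : 0 < e -> \forall p \near (2 + eps / 2, 0 : R), 2 + eps / 2 < p.1 -> w (-1 * p.1, p.2) <= S + e.
  move=> ep; have qc : sqdist (- 2 - eps / 2, 0) (cL eps delta 0) = 1 by rewrite /sqdist /= mulr0z mul0r; ring.
  have /nbhs_boxP[r r0 Hr] := bL 0 _ qc e ep; apply/nbhs_boxP; exists r => // x y hx hy /= x1.
  apply: Hr => //; last exact: (@Gfar (-1) (x, y)).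
  by rewrite mulN1r /= (_ : - x - (- 2 - eps / 2) = - (x - (2 + eps / 2))) ?normrN //; ring.
have [lk'|kl] := lerP l k.
  have kS : k <= S.
    apply: (far_le 1 k (normr1 _) _ mk bk); have [kS|Sk] := lerP k S; first by left.
    by right; apply: mx => //; exact: ltW.
  by apply: mx => //; exact: le_trans kS.
have lS : l <= S.
  apply: (far_le (-1) l nN1 _ ml bl); have [kS|Sk] := lerP l S; first by left.
  by right; apply: mx => //; exact: ltW.
by apply: mx => //; apply: le_trans lS; exact: ltW.
Qed.

End ProfileCalculus.

(** * The jump between the two columns *)

Section ProfileEstimates.
Variable R : realType.
Implicit Types (p q z : R * R) (w v : R * R -> R) (e h k l r s t x y X S : R).
Variables eps delta : R.
Hypotheses (eps_gt0 : 0 < eps) (delta_gt0 : 0 < delta) (eps_small : eps <= 1 / 10 / 20).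
Local Notation E := (Ext eps delta).
Local Notation P := (2 + delta).
Local Notation c := (1 + eps / 2).
Local Notation right := [set x : R | 0 < x].
Local Notation C0 := (cR eps delta 0).
Local Notation G := (column eps delta right).

Lemma near_imp q (A B : R * R -> Prop) : (\forall p \near q, A p) -> (forall p, A p -> B p) -> \forall p \near q, B p.
Proof. by move=> qA AB; exact: (@filterS _ (nbhs q) (nbhs_filter q) _ _ AB qA). Qed.

Lemma near_imp2 q (A A' B : R * R -> Prop) : (\forall p \near q, A p) -> (\forall p \near q, A' p) ->
  (forall p, A p -> A' p -> B p) -> \forall p \near q, B p.
Proof. by move=> qA qA' AB; apply: near_imp (@filterI _ (nbhs q) (nbhs_filter q) _ _ qA qA') _ => p []; exact: AB. Qed.

Lemma column_ball z0 : 0 <= z0.1 -> (forall n, 4 <= sqdist z0 (cR eps delta n)) ->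
  1 < z0.1 -> forall z, sqdist z z0 < 1 -> G z.
Proof.
move=> z00 far z01 z zz.
have out ctr : 4 <= sqdist z0 ctr -> 1 < sqdist z ctr.
  move=> h; rewrite ltNge; apply/negP => zc.
  have h1 : sqdist z0 z < 1 ^+ 2 by rewrite sqdistC expr1n.
  have h2 : sqdist z ctr <= 1 ^+ 2 by rewrite expr1n.
  by have := sqdist_triangle_lt ler01 ler01 h1 h2; lra.
split => [n|].
  split; apply: out; last exact: far.
  by apply: (le_trans (far n)); rewrite /sqdist /=; have e0 := eps_gt0; nra.
by move: zz => /=; rewrite /sqdist; have := sqr_ge0 (z.2 - z0.2); nra.
Qed.

Lemma cos_ge_right t : 0 <= t <= 2 / 5 -> 23 / 25 <= cos t.
Proof. by move=> /andP[t0 t1]; have := one_sub_cos_le t; nra. Qed.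

Lemma sin_le_self t : 0 <= t -> sin t <= t.
Proof.
rewrite le_eqVlt => /orP[/eqP<-|t0]; first by rewrite sin0.
have [u [_ Eu]] := @mean_value R sin cos 0 t t0 (fun t _ => is_derive_sin t).
by move: Eu; rewrite sin0 !subr0 => ->; rewrite ler_piMl ?cos_le1 // ltW.
Qed.

(** This is the centre of the unit ball tangent to the disk from outside at angle [t]. For another
    row, [2 cos t >= 46 / 25] and [|2 sin t - n P| >= 2 - 4 / 5] already give a squared distance
    above 4, so that ball meets no disk. *)
Lemma circ2_far t n : 0 <= t <= 2 / 5 -> 4 <= sqdist (circ C0 2 t) (cR eps delta n).
Proof.
move=> ht; have /andP[t0 t1] := ht.
have [->|n0] := eqVneq n 0; first by rewrite sqdist_circ; lra.
have hc := cos_ge_right ht; have hs := sin_le_self t0.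
have s0 : 0 <= sin t by apply: sin_ge0_pi; have := @pi_ge2 R; lra.
have d0 := delta_gt0.
rewrite /sqdist /circ /= mulr0z mul0r add0r.
have -> : 1 + eps / 2 + 2 * cos t - (1 + eps / 2) = 2 * cos t by ring.
have hx : (2 * (23 / 25)) ^+ 2 <= (2 * cos t) ^+ 2 by rewrite lerXn2r ?nnegrE; lra.
suff : (6 / 5) ^+ 2 <= (2 * sin t - n%:~R * P) ^+ 2 by lra.
have [n1|n1] := lerP n 0.
  have : n%:~R <= (-1)%:~R :> R by rewrite ler_int; case: n n0 n1 => -[].
  by rewrite rmorphN /= mulr1z => h; rewrite lerXn2r ?nnegrE; nra.
have : 1%:~R <= n%:~R :> R by rewrite ler_int; case: n n0 n1.
by rewrite mulr1z => h; rewrite -[leRHS]sqrrN opprB lerXn2r ?nnegrE; nra.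
Qed.

(** The bound [eps / 20] is small against the half gap [eps / 2]: the circles stay in [x > 0], at a
    distance from the axis comparable with [eps] at least. *)
Definition small_radius : R := Num.min (Num.min eps delta) (eps / 20).

Lemma small_radius_gt0 : 0 < small_radius.
Proof. by rewrite lt_min rho_gt0 //=; exact: divr_gt0. Qed.

Lemma small_radiusP r : 1 < r < 1 + small_radius -> [/\ 1 < r < 1 + Num.min eps delta, 1 < r & r < 1 + eps / 20].
Proof.
move=> /andP[r1 rr]; rewrite r1; split => //.
  by apply: (lt_le_trans rr); rewrite lerD2l ge_min lexx.
by apply: (lt_le_trans rr); rewrite lerD2l ge_min lexx orbT.
Qed.

Lemma circ_column r t : 1 < r < 1 + small_radius -> G (circ C0 r t).
Proof.
move=> /small_radiusP[rI r1 r2]; split; first by apply: Ext_circ => //; right.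
by rewrite /circ /=; have := cos_geN1 t; have e0 := eps_gt0; nra.
Qed.

Lemma circ_column_cont w wx wy r a b : harm G w wx wy -> 1 < r < 1 + small_radius ->
  cont_on a b (fun t => w (circ C0 r t)).
Proof.
move=> Hw; apply: (@circ_cont_on R G C0 small_radius) => [r' t rI|p Gp]; first exact: circ_column.
exact: (harm_continuous Hw).
Qed.

(* Hopf's lemma on the balls of radius 1 touching the disk along the arc |t| <= 2/5 away from the gaps. *)
Lemma hopf_integral w wx wy k r : harm G w wx wy -> 0 <= k -> (forall p, G p -> 0 <= w p) ->
  (forall p, G p -> 2 + eps / 2 + 3 / 10 <= p.1 -> k <= w p) -> 1 < r < 1 + small_radius ->
  2 / 5 * k * (r - 1) <= Rint 0 pi (fun t => w (circ C0 r t)).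
Proof.
move=> Hw k0 w0 wk rs; have [rI r1 r2] := small_radiusP rs; have e0 := eps_gt0; have e5 := eps_small.
have cw a b := @circ_column_cont w wx wy r a b Hw rs.
have p2 := @pi_ge2 R.
have i1 : (0 : R) <= 2 / 5 <= (pi : R) by apply/andP; split; lra.
rewrite (Rint_split i1 (cw _ _)).
have h1 : 2 / 5 * k * (r - 1) <= Rint 0 (2 / 5) (fun t => w (circ C0 r t)).
  have -> : 2 / 5 * k * (r - 1) = Rint 0 (2 / 5) (fun=> k * (r - 1)) by rewrite Rint_cst; lra.
  apply: le_Rint; [exact: cont_on_cst|exact: cw|move=> t ht].
  have hc := cos_ge_right ht.
  pose z0 := circ C0 2 t.
  have z01 : 1 < z0.1 by rewrite /z0 /circ /=; lra.
  have ball := @column_ball z0 (ltW (lt_trans ltr01 z01)) (fun n => circ2_far n ht) z01.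
  (* The point lies on the ray from [C0] through [z0], at distance [2 - r] from [z0]; the Hopf
     factor is then [- ln (2 - r)], which is at least [r - 1]. *)
  have zr : sqdist (circ C0 r t) z0 = (2 - r) ^+ 2.
    rewrite /z0 /circ /sqdist /= -[RHS]mulr1 -(cos2Dsin2 t); ring.
  have H := @hopf_ball R z0 w wx wy k (harm_sub ball Hw) k0 (fun z hz => w0 z (ball z hz)).
  (* On this ball [x >= 1 + eps / 2 + 46 / 25 - 1 / 2], beyond the threshold
     [2 + eps / 2 + 3 / 10]. *)
  have inner z : sqdist z z0 <= (1 / 2) ^+ 2 -> k <= w z.
    move=> hz; apply: wk; first by apply: ball; lra.
    have := sqr_ge0 (z.2 - z0.2); move: hz; rewrite /sqdist /z0 /circ /= => hz hz2.
    have : (z.1 - (1 + eps / 2 + 2 * cos t)) ^+ 2 <= (1 / 2) ^+ 2 by lra.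
    by move=> h; nra.
  apply: le_trans (H inner (circ C0 r t) _); last by rewrite zr; apply/andP; split; nra.
  apply: ler_wpM2l => //; rewrite zr lnXn; last lra.
  have := @le_ln1Dx R (1 - r); have -> : 1 + (1 - r) = 2 - r by ring.
  by move=> h; have {}h := h ltac:(lra); rewrite mulr2n; lra.
have h2 : 0 <= Rint (2 / 5) pi (fun t => w (circ C0 r t)).
  have -> : (0 : R) = Rint (2 / 5) pi (fun=> 0) by rewrite Rint_cst ?mul0r; lra.
  by apply: le_Rint; [exact: cont_on_cst|exact: cw|move=> t _; apply: w0; exact: circ_column].
by lra.
Qed.

Lemma cR0E : C0 = (1 + eps / 2, 0). Proof. by rewrite /cR mulr0z mul0r. Qed.
Lemma cL0E : cL eps delta 0 = (- 1 - eps / 2, 0). Proof. by rewrite /cL mulr0z mul0r. Qed.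

Lemma column_bip p : G p -> [/\ 1 < sqdist p (1 + eps / 2, 0), 1 < sqdist p (- 1 - eps / 2, 0) & bip eps p <= 1].
Proof.
case=> Ep /= p0; have [] := Ep 0; rewrite cR0E cL0E => h1 h2; split => //.
by rewrite -subr_ge0; apply: bip_compl_ge0 => //; exact: ltW.
Qed.

Lemma harm_bip_column : harm G (bip eps) (bipx eps) (bipy eps).
Proof. by apply: harm_bip => // z /column_bip[]. Qed.

(** Near [t = pi], where the circle faces the gap, it is close to the parabola
    [x = eps / 2 + (pi - t)^2 / 2]; the lower constant is weak enough to hold on the whole
    half-circle. *)
Lemma circ_fst_bounds r t : 1 < r < 1 + small_radius -> 0 <= t <= pi ->
  (eps + (pi - t) ^+ 2) / 64 <= (circ C0 r t).1 <= eps / 2 + (pi - t) ^+ 2 / 2 * r.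
Proof.
move=> /small_radiusP[_ r1 r2] /andP[t0 t1]; have e0 := eps_gt0; have e5 := eps_small.
have ht : 0 <= pi - t <= pi by apply/andP; split; lra.
have h1 := one_sub_cos_le (pi - t); have h2 := one_sub_cos_ge ht.
have ct : cos t = - cos (pi - t) by rewrite addrC cosDpi cosN opprK.
rewrite /circ /= ct; have s2 := sqr_ge0 (pi - t); set C := cos _ in h1 h2 *; set S := _ ^+ 2 in h1 h2 s2 *.
have h3 : (r - 1) * S >= 0 by apply: mulr_ge0 => //; lra.
by apply/andP; split; nra.
Qed.

(** The integrand is at most [(r^2 - 1) / x], with [r^2 - 1 <= 3 (r - 1)] and
    [x >= (sqrt eps + pi - t)^2 / 128]. The resulting majorant has an explicit primitive, and
    [24 * 16 = 3 * 128]. *)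
Lemma bip_compl_integral r : 1 < r < 1 + small_radius ->
  Rint 0 pi (fun t => 1 - bip eps (circ C0 r t)) <= 24 * 16 * (r - 1) / Num.sqrt eps.
Proof.
move=> rs; have [_ r1 r2] := small_radiusP rs; have e0 := eps_gt0; have e5 := eps_small.
pose q := Num.sqrt eps; have q0 : 0 < q by rewrite sqrtr_gt0.
have qE : q ^+ 2 = eps by rewrite sqr_sqrtr // ltW.
have p0 := @pi_gt0 R.
pose f t := 24 * 16 * (r - 1) * (q + pi - t) ^- 2.
pose F t := 24 * 16 * (r - 1) * (q + pi - t)^-1.
have den t : 0 <= t <= pi -> 0 < q + pi - t by move=> /andP[t0 t1]; lra.
have dF t : 0 <= t <= pi -> is_derive t 1 F (f t).
  move=> /den ht.
  have h0 : is_derive t 1 (fun t : R => q + pi - t) (-1).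
    by have := is_deriveB (is_derive_cst (q + pi) t 1) (is_derive_id t 1); rewrite sub0r.
  have := is_deriveZ (24 * 16 * (r - 1)) (@is_deriveV _ (fun t : R => q + pi - t) _ _ _ (lt0r_neq0 ht) h0).
  by move/is_derive_eq; apply; rewrite /f /GRing.scale /= mulrN1 opprK.
have cf : cont_on 0 pi f.
  move=> t /den ht; apply: cvgMr; apply: cvgV; first by rewrite expf_neq0 // gt_eqF.
  have cs : {for t, continuous (fun t : R => q + pi - t)} by apply: cvgB; [exact: cvg_cst|exact: cvg_id].
  exact: (cvgM cs cs).
have cb : cont_on 0 pi (fun t => 1 - bip eps (circ C0 r t)).
  by apply: cont_onB; [exact: cont_on_cst|exact: (circ_column_cont harm_bip_column)].
apply: (@le_trans _ _ (Rint 0 pi f)).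
  apply: le_Rint => // t ht; have /andP[x1 x2] := circ_fst_bounds rs ht.
  have Gp := circ_column t rs; have [s1 _ _] := column_bip Gp; have x0 : 0 < (circ C0 r t).1 := Gp.2.
  have e1 : 0 < eps <= 1 by rewrite e0; lra.
  apply: (le_trans (bip_compl_le e1 x0 (ltW s1))).
  rewrite -cR0E sqdist_circ ler_pdivrMr // /f.
  have dt := den t ht; set D := q + pi - t in dt *.
  have D2 : 0 < D ^+ 2 by exact: exprn_gt0.
  have hD : D ^+ 2 <= 2 * (eps + (pi - t) ^+ 2).
    by rewrite -qE /D; have := sqr_ge0 (q - (pi - t)); nra.
  have : D ^+ 2 / (64 * 2) <= (circ C0 r t).1 by lra.
  set x := (circ C0 r t).1 => hx.
  rewrite mulrAC ler_pdivlMr //.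
  have K0 : 0 <= 24 * 16 * (r - 1) by apply: mulr_ge0; lra.
  have := ler_wpM2l K0 hx.
  have : (r ^+ 2 - 1) * D ^+ 2 <= 3 * (r - 1) * D ^+ 2 by apply: ler_wpM2r; [exact: ltW|nra].
  lra.
rewrite (Rint_derive p0 cf dF) /F addrK subr0.
have : 0 <= 24 * 16 * (r - 1) / (q + pi) by apply: divr_ge0; lra.
by rewrite -/q; lra.
Qed.

Section Profile.
Variables (a d : R) (v : R * R -> R).
Hypothesis Hv : odd_profile eps delta a d v.

Let Hh : exists vx vy, harm E v vx vy. Proof. by case: Hv. Qed.
Let pv x y : E (x, y) -> v (x, y + P) = v (x, y). Proof. by case: Hv => _ h _ _ _; exact: h. Qed.
Let bv n : boundary_value E v (cR eps delta n) d. Proof. by case: Hv. Qed.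
Let v_axis y : v (0, y) = 0. Proof. by case: Hv. Qed.
Let fv : far_limit_at eps delta 1 v a 0. Proof. by case: Hv => _ _ _ _ []. Qed.
Let mv e : 0 < e -> exists2 t : R, 0 < t & forall r, 1 < r < 1 + t -> 1 < r < 1 + Num.min eps delta /\
       `|Rint 0 pi (fun t => v (circ C0 r t)) - d * pi| <= e * (r - 1).
Proof. by case: Hv => _ _ _ _ [_]; apply. Qed.

Let HhG : exists vx vy, harm G v vx vy.
Proof. by have [vx [vy h]] := Hh; exists vx, vy; apply: harm_sub h => p []. Qed.

Let v_cont p : E p -> {for p, continuous v}.
Proof. by have [vx [vy h]] := Hh => Ep; exact: (harm_continuous h). Qed.

(* lra reifies every hypothesis of the context, so the proofs below discard the irrelevant ones. *)
Local Ltac narrow := clear - R eps delta eps_gt0 delta_gt0 eps_small a d v Hv Hh pv bv v_axis fv mv HhG v_cont.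

Lemma profile_axis_near q e : E q -> q.1 = 0 -> 0 < e -> \forall p \near q, `|v p| <= e.
Proof.
move=> Eq q0 e0; have /continuous_boxP /(_ e e0) [r r0 Hr] := v_cont Eq.
have vq : v q = 0 by case: q Eq q0 {Hr} => x y /= _ ->.
by apply/nbhs_boxP; exists r => // x y hx hy; have := Hr x y hx hy; rewrite vq subr0; exact: ltW.
Qed.

(** After subtraction of [a x] the function has a finite limit at infinity, vanishes on the axis and
    is at most [d] on the circles. *)
Lemma profile_upper : 0 <= a -> 0 <= d -> forall p, G p -> v p <= d + a * p.1.
Proof.
move=> a0 d0 p Gp; rewrite -lerBlDr.
have [vx [vy H]] := HhG.
have HA := harm_affine G a 0 0.
have HB := harm_ext (harmB H HA).
have HW : harm G (fun p => v p - (a * p.1 + 0 * p.2)) _ _ := HB _ _ _ (fun p => congr1 (fun x => v p - x) (addr0 _)) (fun=> erefl) (fun=> erefl).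
suff : v p - (a * p.1 + 0 * p.2) <= d by rewrite mul0r addr0.
have := @half_max R eps delta eps_gt0 delta_gt0 _ _ _ d HW; move=> /(_ _ _ _ _ p Gp); apply.
- by move=> x y Exy _; rewrite pv // !mul0r.
- move=> n q qc e e0; apply: near_imp (bv qc e0) _ => z h [/h + /= z0].
  by rewrite ler_norml mul0r addr0 => /andP[_ h2]; have := mulr_ge0 a0 (ltW z0); lra.
- move=> q Eq q0 e e0; apply: filterS (profile_axis_near Eq q0 e0) => z; rewrite ler_norml => /andP[_ h] [_ /= z0].
  by rewrite mul0r addr0; have := mulr_ge0 a0 (ltW z0); lra.
- exact: far_limit_affine.
Qed.

(** A first comparison bounds [a x - v] from above, so [v] is nonnegative for large [x]; its infimum
    is then governed by the axis and the circles alone. *)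
Lemma profile_lower : 0 < a -> forall p, G p -> Num.min 0 d <= v p.
Proof.
move=> a0; have e0 := eps_gt0.
have [vx [vy H]] := HhG.
have first p : G p -> a * p.1 - v p <= Num.max 0 (a * (2 + eps / 2) - d).
  move=> Gp; set S := Num.max _ _.
  have HA := harm_affine G a 0 0.
  have [wx [wy HW]] : exists wx wy, harm G (fun p => -1 * v p + 1 * (a * p.1)) wx wy.
    by do 2 eexists; apply: (harm_ext (harmD (harmZ (-1) H) HA)) => z //; rewrite mul1r mul0r !addr0.
  have S0 : 0 <= S by rewrite le_max lexx.
  have Sd : a * (2 + eps / 2) - d <= S by rewrite le_max lexx orbT.
  have := @half_max R eps delta eps_gt0 delta_gt0 _ _ _ S HW; move=> /(_ _ _ _ _ p Gp).
  have -> : -1 * v p + 1 * (a * p.1) = a * p.1 - v p by ring.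
  apply.
  - by move=> x y Exy _; rewrite pv.
  - move=> n q qc e ep; have ea : 0 < e / 2 by exact: divr_gt0.
    have eA : 0 < e / 2 / a by exact: divr_gt0.
    have qx : q.1 < 2 + eps / 2 + e / 2 / a.
      by case: q qc => x y /sqdist_right_half /andP[_] /=; lra.
    apply: near_imp2 (bv qc ea) (near_fst_lt qx) _ => z h hz [/h + _].
    rewrite ler_norml => /andP[h1 _].
    have : a * z.1 <= a * (2 + eps / 2) + e / 2.
      have -> : e / 2 = a * (e / 2 / a) by rewrite [RHS]mulrC divfK // gt_eqF.
      by rewrite -mulrDr ler_wpM2l // ltW.
    by lra.
  - move=> q Eq q0 e ep; have ea : 0 < e / 2 by exact: divr_gt0.
    have eA : 0 < e / 2 / a by exact: divr_gt0.
    have qx : q.1 < e / 2 / a by rewrite q0.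
    apply: near_imp2 (profile_axis_near Eq q0 ea) (near_fst_lt qx) _ => z h hz _.
    have : a * z.1 <= e / 2.
      by have -> : e / 2 = a * (e / 2 / a); [rewrite [RHS]mulrC divfK // gt_eqF|rewrite ler_wpM2l // ltW].
    by move: h; rewrite ler_norml => /andP[h1 _]; lra.
  - have cx p0 : E p0 -> {for p0, continuous (fun p : R * R => a * p.1)} by move=> _; apply: cvgMr; exact: cvg_fst.
    have fa : far_limit_at eps delta 1 (fun p => a * p.1) a 0.
      exists 0; split; last by move=> e /ltW ep; exists 0 => x y _; rewrite mul0r (_ : _ - _ - _ - _ = 0) ?normr0 //=; ring.
      move=> x _; rewrite (@eq_Rint _ _ _ _ (fun=> 0)); last by move=> y _ /=; ring.
      by rewrite Rint_cst ?mul0r //; have := delta_gt0; lra.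
    have := far_limit_comb eps_gt0 (-1) 1 (@normr1 R) (fun p Ep => v_cont Ep) cx fv fa.
    by rewrite mulN1r mul1r addNr !mulr0 addr0.
move=> p Gp; rewrite -lerN2; set m := Num.min 0 d.
have m0 : m <= 0 by rewrite ge_min lexx.
have md : m <= d by rewrite ge_min lexx orbT.
have HW := harm_ext (harmZ (-1) H).
have {}HW : harm G (fun p => - v p) _ _ := HW _ _ _ (fun p => mulN1r _) (fun=> erefl) (fun=> erefl).
have := @column_max R eps delta delta_gt0 right _ _ _ (- m) (@open_right R) HW.
move=> /(_ _ _ _ _ _ p Gp); apply.
- by move=> x y Exy _; rewrite pv.
- move=> n [x y] /sqdist_right_half /andP[_ xq] e _.
  have q0 : (x, y).1 < 0 by move: xq => /=; lra.
  by apply: filterS (near_fst_lt q0) => z z0 [_ /= z1]; lra.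
- move=> n q qc e ep; apply: near_imp (bv qc ep) _ => z h [/h + _]; rewrite ler_norml => /andP[]; lra.
- move=> q Eq /= /negP; rewrite -leNgt le_eqVlt => /orP[/eqP q0|q0] e ep.
    by apply: filterS (profile_axis_near Eq q0 ep) => z; rewrite ler_norml => /andP[] h1 _ _; lra.
  by apply: filterS (near_fst_lt q0) => z z0 [_ /= z1]; lra.
- move=> e ep; set S := Num.max _ _ in first; exists (S / a) => z Gz; have := first z Gz.
  case: Gz => _ /= z0; rewrite gtr0_norm // ltr_pdivrMr // mulrC; lra.
Qed.

(** Comparison with an affine function of slope [a] on the half plane to the right of the disks,
    whose edge is [x1]. There [v >= m], and the slopes agree at infinity, where only the additive
    constants have to be ordered. *)
Lemma profile_growth : 0 < a -> forall p, G p -> 2 + eps / 2 < p.1 -> Num.min 0 d + a * (p.1 - (2 + eps / 2)) <= v p.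
Proof.
move=> a0 p Gp px; have e0 := eps_gt0; have d0 := delta_gt0; set m := Num.min 0 d; set x1 := 2 + eps / 2.
have low := profile_lower a0; rewrite -/m in low.
have [vx [vy H]] := HhG.
have oJ : open [set x : R | x1 < x] by exact: open_gt.
pose J := [set x : R | x1 < x].
have sub : column eps delta J `<=` G by move=> z [Ez z1]; split => //=; move: z1; rewrite /J /x1 /=; lra.
have HA := harm_affine (column eps delta J) a 0 (m - a * x1).
have HW := harmB HA (harm_sub sub H).
rewrite -subr_le0.
have -> : m + a * (p.1 - x1) - v p = a * p.1 + 0 * p.2 + (m - a * x1) - v p by ring.
have GJ : column eps delta J p by case: Gp.
have edge q : q.1 <= x1 -> forall e, 0 < e -> \forall z \near q, column eps delta J z ->
    a * z.1 + 0 * z.2 + (m - a * x1) - v z <= 0 + e.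
  move=> q1 e ep; have ea : 0 < e / a by exact: divr_gt0.
  have qx : q.1 < x1 + e / a by lra.
  apply: filterS (near_fst_lt qx) => z z1 Jz; have := low z (sub z Jz).
  have : a * z.1 <= a * x1 + e.
    have -> : e = a * (e / a) by rewrite [RHS]mulrC divfK // gt_eqF.
    by rewrite -mulrDr ler_wpM2l // ltW.
  lra.
have := @column_max R eps delta delta_gt0 J _ _ _ 0 oJ HW.
move=> /(_ _ _ _ _ _ p GJ); apply.
- by move=> x y Exy _; rewrite pv //; ring.
- by move=> n [x y] /sqdist_right_half /andP[_ xq]; apply: edge; move: xq => /=; rewrite /x1; lra.
- by move=> n [x y] /sqdist_right_half /andP[_ xq]; apply: edge; move: xq => /=; rewrite /x1; lra.
- by move=> q Eq /= /negP; rewrite -leNgt; exact: edge.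
move=> e ep; have [k [mk lk]] := fv.
(* [k] is the mean of [v - a x] on every far line; on lines with [x] tending to [x1] the bound
   [v >= m] gives the claim. *)
have kl : m - a * x1 <= k.
  apply/ler_addgt0Pr => s s0; have sa : 0 < s / a by exact: divr_gt0.
  pose x := x1 + s / a; have xx : x1 < x by rewrite /x; lra.
  have P0 : 0 < P by lra.
  suff : (m - a * x) * P <= k * P by rewrite ler_pM2r // /x mulrDr (mulrC a (s / a)) divfK ?gt_eqF //; lra.
  rewrite -(mk x xx).
  have cl : cont_on (- (P / 2)) (P / 2) (fun y => v (1 * x, y) - a * (1 * x) - 0 * y).
    move=> y _; have Ex : E (1 * x, y) by apply: Ext_far => //; rewrite mul1r ger0_norm; move: xx; rewrite /x1; lra.
    by apply: cvgB; [apply: cvgB; [apply: continuous_slice2; exact: v_cont|exact: cvg_cst]|apply: cvgMr; exact: cvg_id].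
  have : Rint (- (P / 2)) (P / 2) (fun=> m - a * x) <= Rint (- (P / 2)) (P / 2) (fun y => v (1 * x, y) - a * (1 * x) - 0 * y).
    apply: le_Rint => // [|y _]; first exact: cont_on_cst.
    have Gx : G (x, y) by apply: sub; split => //; apply: Ext_far => //; rewrite ger0_norm; move: xx; rewrite /x1; lra.
    by have := low _ Gx; rewrite mul1r; lra.
  rewrite Rint_cst; last lra.
  by have -> : P / 2 - - (P / 2) = P by field.
have [X HX] := lk e ep; exists X => -[x y] [_ xJ]; have {xJ} : 2 + eps / 2 < x by exact: xJ.
move=> xJ; rewrite ger0_norm /=; last lra.
by move=> /(HX x y); rewrite mul1r ler_norml => /andP[]; lra.
Qed.

(** If [d <= 0], then [v - d] is nonnegative and at least [3 a / 10] for
    [x >= 2 + eps / 2 + 3 / 10]. Hopf's lemma makes its integral over the half-circle at least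
    [3 a (r - 1) / 25], more than the tolerance [a (r - 1) / 10] of the flux condition. *)
Lemma profile_pos : 0 < a -> 0 < d.
Proof.
move=> a0; rewrite ltNge; apply/negP => d0.
have md : Num.min 0 d = d by apply/min_idPr.
have low := profile_lower a0; have grow := profile_growth a0; rewrite md in low grow.
have [vx [vy H]] := HhG.
have HW := harmB H (harm_cst G d).
have a10 : 0 < a / 10 by exact: divr_gt0.
have [t t0 Ht] := mv a10; have sr := small_radius_gt0.
pose r := 1 + Num.min t small_radius / 2.
have m0 : 0 < Num.min t small_radius by rewrite lt_min t0.
have m1 : Num.min t small_radius <= t by rewrite ge_min lexx.
have m2 : Num.min t small_radius <= small_radius by rewrite ge_min lexx orbT.
have rs : 1 < r < 1 + small_radius by apply/andP; split; rewrite /r; lra.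
have rt : 1 < r < 1 + t by apply/andP; split; rewrite /r; lra.
have k0 : 0 <= 3 / 10 * a by apply: mulr_ge0; [lra|exact: ltW].
have := hopf_integral HW k0 _ _ rs.
have w0 p : G p -> 0 <= v p - d by move=> /low; lra.
have wk p : G p -> 2 + eps / 2 + 3 / 10 <= p.1 -> 3 / 10 * a <= v p - d.
  move=> Gp px; have xx : 2 + eps / 2 < p.1 by lra.
  have := grow p Gp xx.
  have : a * (3 / 10) <= a * (p.1 - (2 + eps / 2)) by rewrite ler_wpM2l; [|exact: ltW|lra].
  lra.
move=> /(_ w0 wk).
have p0 := @pi_gt0 R.
rewrite RintB; [|exact: (circ_column_cont H)|exact: cont_on_cst].
rewrite Rint_cst ?subr0; last exact: ltW.
have [_] := Ht r rt; rewrite ler_norml => /andP[_ h1] h2.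
have r1 : 0 < r - 1 by rewrite /r; lra.
have : 0 < a * (r - 1) by exact: mulr_gt0.
lra.
Qed.

(** Since [bip] is not periodic, the comparison takes place in a box containing [p], up to an error
    [e] that is arbitrary: far to the right [v] exceeds [d], and at large heights [d bip] is below
    [e] while [v] is nonnegative. *)
Lemma profile_ge_bip : 0 < a -> forall p, G p -> d * bip eps p <= v p.
Proof.
move=> a0 p Gp; have d0 := profile_pos a0; have e0 := eps_gt0.
have md : Num.min 0 d = 0 by apply/min_idPl; exact: ltW.
have low := profile_lower a0; have grow := profile_growth a0; rewrite md in low grow.
have [vx [vy H]] := HhG.
apply/ler_addgt0Pr => e ep; rewrite addrC -lerBlDr.
have [_ /= px] := Gp.
have da : 0 < d / a by exact: divr_gt0.
(* From the abscissa [X - 1] on, the linear growth of [v] gives [v >= d]; the margin 1 leaves room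
   for a neighbourhood of the side of the box. *)
pose X := 2 + eps / 2 + d / a + 1 + p.1 + 1.
have X0 : 0 < X by rewrite /X; lra.
have K0 : 0 < 4 * X * d / e by apply: divr_gt0 => //; apply: mulr_gt0 => //; apply: mulr_gt0.
have p2 := normr_ge0 p.2.
(* At heights above [Y - 1] one has both [|y| > 1] and [e |y| >= 4 X d], so the decay [4 d x / y^2]
   is at most [e]. *)
pose Y := `|p.2| + 2 + 4 * X * d / e.
pose D := G `&` [set z : R * R | -1 < z.1 < X /\ - Y < z.2 < Y].
have Dp : D p by split => //=; split; [apply/andP; split; rewrite /X; lra|rewrite -ltr_norml /Y; lra].
have oD : open D by apply: openI; [apply: open_column => //; exact: open_right|exact: open_box].
have HW := harmB (harmZ d harm_bip_column) H.
have := @ext_max_bounded R eps delta D _ _ _ e (X + Y) oD _ (harm_sub (fun z (Dz : D z) => Dz.1) HW).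
move=> /(_ _ _ _ _ _ p Dp); apply.
- by move=> z [[]].
- move=> z [[_ /= z0] /= [/andP[_ zX] zY]]; rewrite -ltr_norml in zY; split; last lra.
  by rewrite gtr0_norm //; rewrite /Y in zY *; lra.
- move=> n [x y] /sqdist_right_half /andP[_ xq] e' _.
  have q0 : (x, y).1 < 0 by move: xq => /=; lra.
  by apply: near_imp (near_fst_lt q0) _ => z z0 [[_ /= z1] _]; lra.
- move=> n q qc e' ep'; apply: near_imp (bv qc ep') _ => z h [Gz _].
  have [_ _ b1] := column_bip Gz; have := h Gz.1; rewrite ler_norml => /andP[h1 _].
  have : d * bip eps z <= d * 1 by rewrite ler_wpM2l // ltW.
  lra.
- move=> q Eq nD e' ep'.
  have [q0|q0|q0] := ltgtP q.1 0.
  + by apply: near_imp (near_fst_lt q0) _ => z z0 [[_ /= z1] _]; lra.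
  + have [qX|qX] := lerP X q.1.
      have qX1 : X - 1 < q.1 by lra.
      apply: near_imp (near_fst_gt qX1) _ => z z1 [Gz _].
      have zx : 2 + eps / 2 < z.1 by rewrite /X in z1; lra.
      have := grow z Gz zx; rewrite add0r => h.
      have [_ _ b1] := column_bip Gz.
      have : d * bip eps z <= d * 1 by rewrite ler_wpM2l // ltW.
      have : a * (d / a) <= a * (z.1 - (2 + eps / 2)).
        by apply: ler_wpM2l; [exact: ltW|rewrite /X in z1; lra].
      have -> : a * (d / a) = d by rewrite mulrC divfK // gt_eqF.
      lra.
    have qY : Y <= `|q.2|.
      rewrite leNgt; apply/negP; rewrite ltr_norml => qY; apply: nD; split => //=.
      by split => //; rewrite qX andbT; lra.
    have qY1 : Y - 1 < `|q.2| by lra.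
    have nY : \forall z \near q, Y - 1 < `|z.2|.
      apply/nbhs_boxP; exists (`|q.2| - (Y - 1)); first lra.
      move=> x y _ hy /=; have := ler_distD y q.2 0; rewrite !subr0 distrC; lra.
    apply: near_imp nY _ => z zY [Gz [/andP[_ zX] _]].
    have z1 : 1 < `|z.2| by rewrite /Y in zY; move: zY K0 p2; narrow; lra.
    have z2 : z.2 != 0 by rewrite -normr_gt0; move: z1; narrow; lra.
    have [s1 _ _] := column_bip Gz; have [_ /= z0] := Gz.
    have e1 : 0 < eps <= 1 by rewrite e0; have := eps_small; narrow; lra.
    have dec := bip_decay e1 z0 z2 (ltW s1).
    have y2 : 0 < z.2 ^+ 2 by rewrite exprn_even_gt0.
    have vz := low z Gz.
    suff : d * bip eps z <= e by move: vz ep'; narrow; lra.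
    apply: (@le_trans _ _ (d * (4 * z.1 / z.2 ^+ 2))); first by rewrite ler_wpM2l // ltW.
    rewrite mulrA ler_pdivrMr //.
    have h1 : 4 * X * d <= e * `|z.2|.
      have -> : 4 * X * d = e * (4 * X * d / e) by rewrite [RHS]mulrC divfK // gt_eqF.
      by apply: ler_wpM2l; [exact: ltW|rewrite /Y in zY; move: zY p2; narrow; lra].
    have h2 : e * `|z.2| <= e * z.2 ^+ 2.
      by apply: ler_wpM2l; [exact: ltW|rewrite -(real_normK (num_real z.2)); move: z1; narrow; nra].
    have h3 : d * z.1 <= d * X by apply: ler_wpM2l; exact: ltW.
    move: h1 h2 h3; narrow; lra.
  + have cb : {for q, continuous (fun z => d * bip eps z)}.
      apply: cvgMr; have [] := Eq 0; rewrite cR0E cL0E => h1 h2.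
      by apply: bip_continuous => //; exact: ltW.
    have bq : d * bip eps q <= 0 by case: q q0 {Eq nD cb} => x y /= ->; rewrite bip0 mulr0.
    apply: near_imp2 (near_le_continuous cb bq ep') (profile_axis_near Eq q0 ep) _ => z h1 h2 _.
    by move: h2; rewrite ler_norml => /andP[]; lra.
Qed.

Lemma profile_lower_bound : 0 < a -> a * Num.sqrt eps <= 20 * 20 * 20 * d.
Proof.
move=> a0; have d0 := profile_pos a0; have e0 := eps_gt0; have e5 := eps_small.
set q := Num.sqrt eps; have q0 : 0 < q by rewrite sqrtr_gt0.
have qE : q ^+ 2 = eps by rewrite sqr_sqrtr // ltW.
have q1 : q <= 1 by nra.
(* For [a <= 10 d] the claim is immediate from [sqrt eps <= 1]; otherwise
   [v - d bip >= 3 a / 10 - d >= a / 5] to the right of the disks, as Hopf's lemma needs. *)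
have [da|da] := lerP a (10 * d).
  have : a * q <= a * 1 by rewrite ler_wpM2l // ltW.
  lra.
have md : Num.min 0 d = 0 by apply/min_idPl; exact: ltW.
have grow := profile_growth a0; rewrite md in grow.
have geb := profile_ge_bip a0.
have [vx [vy H]] := HhG.
have HW := harmB H (harmZ d harm_bip_column).
(* Hopf's lemma yields [2 a (r - 1) / 25]; after the tolerance [a (r - 1) / 40] of the flux
   condition, at least [a (r - 1) / 20] remains for the integral of [d (1 - bip)]. *)
have a40 : 0 < a / 40 by exact: divr_gt0.
have [t t0 Ht] := mv a40; have sr := small_radius_gt0.
pose r := 1 + Num.min t small_radius / 2.
have m0 : 0 < Num.min t small_radius by rewrite lt_min t0.
have m1 : Num.min t small_radius <= t by rewrite ge_min lexx.
have m2 : Num.min t small_radius <= small_radius by rewrite ge_min lexx orbT.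
have rs : 1 < r < 1 + small_radius by apply/andP; split; rewrite /r; lra.
have rt : 1 < r < 1 + t by apply/andP; split; rewrite /r; lra.
have k0 : 0 <= 1 / 5 * a by apply: mulr_ge0; [lra|exact: ltW].
have := hopf_integral HW k0 _ _ rs.
have w0 p : G p -> 0 <= v p - d * bip eps p by move=> /geb; lra.
have wk p : G p -> 2 + eps / 2 + 3 / 10 <= p.1 -> 1 / 5 * a <= v p - d * bip eps p.
  move=> Gp px; have xx : 2 + eps / 2 < p.1 by lra.
  have := grow p Gp xx; have [_ _ b1] := column_bip Gp.
  have : a * (3 / 10) <= a * (p.1 - (2 + eps / 2)) by rewrite ler_wpM2l; [|exact: ltW|lra].
  have : d * bip eps p <= d * 1 by rewrite ler_wpM2l // ltW.
  lra.
move=> /(_ w0 wk).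
have p0 := @pi_gt0 R.
have cv : cont_on 0 pi (fun t => v (circ C0 r t)) by exact: (circ_column_cont H).
have cb : cont_on 0 pi (fun t => bip eps (circ C0 r t)) by exact: (circ_column_cont harm_bip_column).
have Ib : Rint 0 pi (fun t => 1 - bip eps (circ C0 r t)) = pi - Rint 0 pi (fun t => bip eps (circ C0 r t)).
  by rewrite RintB //; [rewrite Rint_cst ?subr0 ?mul1r // ltW|exact: cont_on_cst].
rewrite (RintB cv (cont_onZ (k := d) cb)) (RintZ _ cb).
have := bip_compl_integral rs; rewrite Ib -/q ler_pdivlMr //.
have [_] := Ht r rt; rewrite ler_norml => /andP[_].
move: (Rint 0 pi _) (Rint 0 pi _) => B A h1 h2 h3.
have r1 : 0 < r - 1 by rewrite /r; move: m0; narrow; lra.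
have ar : 0 <= a * (r - 1) by apply: mulr_ge0; exact: ltW.
have h4 : 1 / 20 * a * (r - 1) <= d * (pi - B) by move: h1 h3 ar; narrow; lra.
have h5 : d * ((pi - B) * q) <= d * (24 * 16 * (r - 1)) by rewrite ler_wpM2l // ltW.
have h6 : 1 / 20 * a * (r - 1) * q <= d * (pi - B) * q by rewrite ler_wpM2r // ltW.
have h7 : (1 / 20 * a * q) * (r - 1) <= (24 * 16 * d) * (r - 1) by move: h5 h6; narrow; lra.
by rewrite ler_pM2r // in h7; move: h7 d0; narrow; lra.
Qed.

(** The logarithm centred at the disk vanishes on its circle, and at radius [3 / 2] one has
    [6 a ln (9 / 4) >= 3 a >= a x >= v - d]. On the other circles and on the axis [v <= d], so
    nonnegativity of the logarithm suffices. *)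
Lemma profile_annulus : 0 <= a -> 0 <= d -> forall p, G p -> sqdist p C0 < (3 / 2) ^+ 2 ->
  v p <= d + 6 * a * ln (sqdist p C0).
Proof.
move=> a0 d0 p Gp pC; have e0 := eps_gt0; have e5 := eps_small.
have up := profile_upper a0 d0; have [vx [vy H]] := HhG.
pose D := G `&` [set z | sqdist z C0 < (3 / 2) ^+ 2].
have oD : open D by apply: openI; [apply: open_column => //; exact: open_right|exact: open_sqdist_lt].
have D1 z : D z -> 1 < sqdist z C0 by move=> [[Ez _] _]; have [] := Ez 0.
have D0 z : D z -> 0 < sqdist z C0 by move=> /D1; exact: lt_trans.
have HW := harmB (harmB (harm_sub (fun z (Dz : D z) => Dz.1) H) (harm_cst D d)) (harmZ (6 * a) (harm_log D0)).
have bnd z : D z -> `|z.1| <= 3 /\ `|z.2| <= 3.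
  move=> [[_ /= z0]]; rewrite /sqdist cR0E /= subr0 => h; split.
    by rewrite gtr0_norm //; have := sqr_ge0 z.2; nra.
  by rewrite ler_norml; have := sqr_ge0 (z.1 - c); move=> h1; apply/andP; split; nra.
have a6 : 0 <= 6 * a by lra.
suff : v p - d - 6 * a * ln (sqdist p C0) <= 0 by lra.
have := @ext_max_bounded R eps delta D _ _ _ 0 3 oD _ HW bnd.
move=> /(_ _ _ _ _ p (conj Gp pC)); apply.
- by move=> z [[]].
- move=> n [x y] /sqdist_right_half /andP[_ xq] e' _.
  have q0 : (x, y).1 < 0 by move: xq => /=; lra.
  by apply: near_imp (near_fst_lt q0) _ => z z0 [[_ /= z1] _]; lra.
- move=> n q qc e ep; apply: near_imp (bv qc ep) _ => z h Dz.
  have := h Dz.1.1; rewrite ler_norml => /andP[_ h1].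
  have := mulr_ge0 a6 (ln_ge0 (ltW (D1 z Dz))); lra.
- move=> q Eq nD e ep.
  have [q0|q0|q0] := ltgtP q.1 0.
  + by apply: near_imp (near_fst_lt q0) _ => z z0 [[_ /= z1] _]; lra.
  + have qC : (3 / 2) ^+ 2 <= sqdist q C0.
      by rewrite leNgt; apply/negP => h; apply: nD.
    pose f u := 3 * a - 6 * a * ln (sqdist u C0).
    have qp : 0 < sqdist q C0 by apply: lt_le_trans qC; lra.
    have cf : {for q, continuous f}.
      apply: cvgB; first exact: cvg_cst.
      apply: cvgMr; apply: (@continuous_comp _ _ _ (fun z => sqdist z C0) (@ln R)).
        exact: continuous_sqdist.
      exact: continuous_ln.
    have fq : f q <= 0.
      have h1 : 1 / 2 <= ln (sqdist q C0).
        apply: (@le_trans _ _ (ln ((3 / 2) ^+ 2))); last by rewrite ler_ln ?posrE //; lra.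
        have := @ln_ge_ratio R ((3 / 2) ^+ 2); have -> : 2 * ((3 / 2) ^+ 2 - 1) / ((3 / 2) ^+ 2 + 1) = 10 / 13 :> R by field.
        by move=> h; apply: le_trans (h _); lra.
      by have := ler_wpM2l a6 h1; rewrite /f; lra.
    apply: near_imp (near_le_continuous cf fq ep) _ => z; rewrite /f => fz Dz.
    have := up z Dz.1; have [] := bnd z Dz; rewrite ler_norml => /andP[_ z3] _.
    have := ler_wpM2l a0 z3; lra.
  + apply: near_imp (profile_axis_near Eq q0 ep) _ => z + Dz.
    rewrite ler_norml => /andP[_ h1].
    have := mulr_ge0 a6 (ln_ge0 (ltW (D1 z Dz))); lra.
Qed.

(** Subtracting [d bip] removes the jump across the gap: the difference is zero on the axis and on
    the circle, and at most [d + a] in the ball of radius [1 / 2] about the boundary point. The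
    tangent barrier then bounds it linearly with slope of order [d + a]; [3 / 2] is the value of
    [1 + 2 |z - q|^2] at distance [1 / 2]. *)
Lemma profile_gap_upper t : 0 <= a -> 0 <= d -> 0 <= pi - t <= Num.sqrt eps ->
  forall p, G p -> sqdist p (circ C0 1 t) < (1 / 2) ^+ 2 ->
  v p - d * bip eps p <= (d + a) / ln (3 / 2) * (2 * (sqdist p C0 - 1) + 2 * sqdist p (circ C0 1 t)).
Proof.
move=> a0 d0 /andP[s0 s1] p Gp; set q := circ C0 1 t => pq.
have e0 := eps_gt0; have e5 := eps_small; have dl := delta_gt0.
have sE : Num.sqrt eps ^+ 2 = eps by rewrite sqr_sqrtr // ltW.
have q1 : q.1 <= eps.
  have ct : cos t = - cos (pi - t) by rewrite addrC cosDpi cosN opprK.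
  rewrite /q /circ /= ct mul1r; have := one_sub_cos_le (pi - t).
  have : (pi - t) ^+ 2 <= eps by rewrite -sE lerXn2r ?nnegrE // sqrtr_ge0.
  lra.
have q2 : `|q.2| <= 1 / 10.
  have st : sin t = sin (pi - t) by rewrite addrC sinDpi sinN opprK.
  rewrite /q /circ /= mulr0z mul0r add0r mul1r st.
  have sq : Num.sqrt eps <= 1 / 10 by have := sqrtr_ge0 eps; nra.
  have h1 := sin_le_self s0; have h2 : 0 <= sin (pi - t) by apply: sin_ge0_pi; have := @pi_ge2 R; lra.
  by rewrite ger0_norm //; lra.
have qC : sqdist q C0 = 1 by rewrite sqdist_circ expr1n.
have up := profile_upper a0 d0; have [vx [vy H]] := HhG.
pose D := G `&` [set z | sqdist z q < (1 / 2) ^+ 2].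
have oD : open D by apply: openI; [apply: open_column => //; exact: open_right|exact: open_sqdist_lt].
have D1 z : D z -> 1 < sqdist z C0 by move=> [[Ez _] _]; have [] := Ez 0.
pose L : R := ln (3 / 2); have L0 : 0 < L by apply: ln_gt0; lra.
pose K := (d + a) / L; have K0 : 0 <= K by apply: divr_ge0; lra.
pose c' := ((C0.1 + q.1) / 2, (C0.2 + q.2) / 2).
pose beta z := ln (4 : R) + ln (sqdist z c').
have Dc' z : D z -> 0 < sqdist z c'.
  move=> Dz; have := tangent_barrierE z qC; rewrite -/c'.
  by have := D1 z Dz; have := sqdist_ge0 z q; lra.
have betaE z : D z -> beta z = ln (1 + 2 * (sqdist z C0 - 1) + 2 * sqdist z q).
  by move=> Dz; rewrite /beta -lnM ?posrE ?Dc'// tangent_barrierE.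
have beta_ge z : D z -> ln (1 + 2 * sqdist z q) <= beta z.
  by move=> Dz; rewrite betaE // ler_ln ?posrE; have := D1 z Dz; have := sqdist_ge0 z q; lra.
have beta0 z : D z -> 0 <= beta z.
  by move=> Dz; apply: le_trans (beta_ge z Dz); apply: ln_ge0; have := sqdist_ge0 z q; lra.
have bnd z : D z -> `|z.1| <= 1 /\ `|z.2| <= 3 / 5.
  move=> [[_ /= z0]]; rewrite /sqdist => h; split.
    by rewrite gtr0_norm //; have := sqr_ge0 (z.2 - q.2); nra.
  move: q2; rewrite !ler_norml; have := sqr_ge0 (z.1 - q.1); move: h; narrow => h h1 /andP[h2 h3]; apply/andP; split; nra.
have HW := harmB (harmB (harm_sub (fun z (Dz : D z) => Dz.1) H) (harmZ d (harm_sub (fun z (Dz : D z) => Dz.1) harm_bip_column))) (harmZ K (harmD (harm_cst D (ln 4)) (harm_log Dc'))).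
have bip0' z : D z -> 0 <= bip eps z.
  by move=> [Gz _]; have [z1 _ _] := column_bip Gz; apply: bip_ge0 => //; apply: ltW => //; exact: Gz.2.
have Dp : D p by split.
have key : v p - d * bip eps p - K * beta p <= 0.
  have := @ext_max_bounded R eps delta D _ _ _ 0 1 oD _ HW.
  move=> /(_ _ _ _ _ _ p Dp); apply.
  - by move=> z [[]].
  - by move=> z /bnd[h1 h2]; split => //; lra.
  - move=> n [x y] /sqdist_right_half /andP[_ xq] e' _.
    have x0 : (x, y).1 < 0 by move: xq => /=; lra.
    by apply: near_imp (near_fst_lt x0) _ => z z0 [[_ /= z1] _]; lra.
  - move=> n u uc e ep; have [n0|n0] := eqVneq n 0.
      have e2 : 0 < e / 2 by exact: divr_gt0.
      have uc' : sqdist u (1 + eps / 2, 0) = 1 by rewrite -cR0E -n0.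
      have [u1 u2] : 1 <= sqdist u (1 + eps / 2, 0) /\ 1 <= sqdist u (- 1 - eps / 2, 0).
        rewrite uc'; split => //; move: (uc'); rewrite /sqdist /= => h.
        by have := sqr_ge0 (u.2 - 0); nra.
      have cb : {for u, continuous (fun z => d * (1 - bip eps z))}.
        by apply: cvgMr; apply: cvgB; [exact: cvg_cst|exact: bip_continuous].
      have bu : d * (1 - bip eps u) <= 0 by rewrite bip_circle // subrr mulr0.
      apply: near_imp2 (near_le_continuous cb bu e2) (bv uc e2) _ => z h1 h2 Dz.
      have := h2 Dz.1.1; rewrite ler_norml => /andP[_ h3].
      have := mulr_ge0 K0 (beta0 z Dz); rewrite /beta; move: h1 h3; narrow; lra.
    (* The disks of the other rows lie in [|y| >= 1 + delta], away from [D], where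
       [|y| <= 3 / 5]. *)
    have u2 : 3 / 5 < `|u.2|.
      have n1 : 1 <= `|n%:~R : R| by rewrite -intr_norm -(mulr1z 1) ler_int; case: n n0 {uc} => -[].
      have h : (u.2 - n%:~R * P) ^+ 2 <= 1 by move: uc; rewrite /sqdist /=; have := sqr_ge0 (u.1 - c); lra.
      have h1 : `|u.2 - n%:~R * P| <= 1 by move: h; narrow => h; rewrite ler_norml; apply/andP; split; nra.
      have h2 := ler_distD u.2 (n%:~R * P) 0; rewrite !subr0 normrM (gtr0_norm (_ : 0 < P)) in h2; last lra.
      rewrite distrC in h1; nra.
    have nu : \forall z \near u, 3 / 5 < `|z.2|.
      apply/nbhs_boxP; exists (`|u.2| - 3 / 5); first lra.
      move=> x y _ hy /=; have := ler_distD y u.2 0; rewrite !subr0 distrC; lra.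
    by apply: near_imp nu _ => z zu /bnd[_]; lra.
  - move=> u Eu nD e ep.
    have [u0|u0|u0] := ltgtP u.1 0.
    + by apply: near_imp (near_fst_lt u0) _ => z z0 [[_ /= z1] _]; lra.
    + have uq : (1 / 2) ^+ 2 <= sqdist u q.
        by rewrite leNgt; apply/negP => h; apply: nD.
      pose f z := (d + a) * (1 - L^-1 * ln (1 + 2 * sqdist z q)).
      have cf : {for u, continuous f}.
        apply: cvgMr; apply: cvgB; first exact: cvg_cst.
        apply: cvgMr; apply: (@continuous_comp _ _ _ (fun z => 1 + 2 * sqdist z q) (@ln R)).
          by apply: cvgD; [exact: cvg_cst|apply: cvgMr; exact: continuous_sqdist].
        by apply: continuous_ln; have := sqdist_ge0 u q; lra.
      have fu : f u <= 0.
        have h1 : L <= ln (1 + 2 * sqdist u q) by rewrite ler_ln ?posrE; move: uq; narrow; lra.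
        have h2 : 1 <= L^-1 * ln (1 + 2 * sqdist u q) by rewrite mulrC ler_pdivlMr // mul1r.
        rewrite /f; have : 0 <= d + a by exact: addr_ge0.
        by move=> da; rewrite mulr_ge0_le0 //; move: h2; narrow; lra.
      apply: near_imp (near_le_continuous cf fu ep) _ => z; rewrite /f => fz Dz.
      have vz := up z Dz.1; have [z1 _] := bnd z Dz; rewrite ler_norml in z1; have /andP[_ {}z1] := z1.
      have := ler_wpM2l a0 z1; have := ler_wpM2l K0 (beta_ge z Dz).
      have := mulr_ge0 d0 (bip0' z Dz); rewrite /K /beta; move: fz vz; narrow; lra.
    + apply: near_imp (profile_axis_near Eu u0 ep) _ => z + Dz.
      rewrite ler_norml => /andP[_ h1].
      have := mulr_ge0 K0 (beta0 z Dz); have := mulr_ge0 d0 (bip0' z Dz); rewrite /beta; move: h1 d0; narrow; lra.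
have : beta p <= 2 * (sqdist p C0 - 1) + 2 * sqdist p q.
  rewrite betaE // -addrA; apply: le_ln1Dx.
  by have := D1 p Dp; have := sqdist_ge0 p q; lra.
by move=> hb; have := ler_wpM2l K0 hb; rewrite -/L -/K; lra.
Qed.

(** On this arc [x <= 11 eps / 10], so [d (1 - bip)] gains [d (r - 1) / (4 eps)], against a loss of
    at most [11 (d + a) (r - 1)] from the barrier. As [eps <= 1 / 200], the part [11 d (r - 1)]
    consumes no more than half of the gain. *)
Lemma circ_gap_upper r t : 0 <= a -> 0 <= d -> 1 < r < 1 + small_radius -> 0 <= t -> 0 <= pi - t <= Num.sqrt eps ->
  v (circ C0 r t) <= d + 12 * a * (r - 1) - d * (r - 1) / (8 * eps).
Proof.
move=> a0 d0 rs t0 ht; have [rI r1 r2] := small_radiusP rs; have /andP[s0 s1] := ht.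
have e0 := eps_gt0; have e5 := eps_small.
have Gp := circ_column t rs.
have sE : Num.sqrt eps ^+ 2 = eps by rewrite sqr_sqrtr // ltW.
have rq : sqdist (circ C0 r t) (circ C0 1 t) = (r - 1) ^+ 2.
  rewrite /circ /sqdist /= -[RHS]mulr1 -(cos2Dsin2 t); ring.
have rq4 : sqdist (circ C0 r t) (circ C0 1 t) < (1 / 2) ^+ 2 by rewrite rq; nra.
have := profile_gap_upper a0 d0 ht Gp rq4; rewrite rq sqdist_circ.
have L25 : 2 / 5 <= ln (3 / 2) :> R.
  have := @ln_ge_ratio R (3 / 2); have -> : 2 * (3 / 2 - 1) / (3 / 2 + 1) = 2 / 5 :> R by field.
  by apply; lra.
have Li : (ln (3 / 2))^-1 <= 5 / 2 :> R.
  by have -> : 5 / 2 = (2 / 5)^-1 :> R by [field]; rewrite lef_pV2 ?posrE //; lra.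
have tp : 0 <= t <= pi by apply/andP; split; lra.
have /andP[_ x2] := circ_fst_bounds rs tp.
have x1 : eps / 3 <= (circ C0 r t).1 by rewrite /circ /=; have := cos_geN1 t; nra.
have s2 : (pi - t) ^+ 2 <= eps by rewrite -sE lerXn2r ?nnegrE // sqrtr_ge0.
have x3 : (circ C0 r t).1 <= 11 / 10 * eps.
  by apply: (le_trans x2); have := sqr_ge0 (pi - t); nra.
set p := circ C0 r t in Gp x1 x3 *; set x := p.1 in x1 x3.
have [z1 _ _] := column_bip Gp.
have x0 : 0 < x by lra.
have e1 : 0 < eps <= 1 by rewrite e0; lra.
have pC : sqdist p (1 + eps / 2, 0) = r ^+ 2 by rewrite -cR0E sqdist_circ.
have rr : (r ^+ 2 - 1) / (2 * x) <= 1 / 4.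
  by rewrite ler_pdivrMr ?mulr_gt0 //; nra.
have := bip_compl_lower e1 x0 (ltW z1); rewrite pC => /(_ rr) low.
have low2 : (r - 1) / (4 * eps) <= 1 - bip eps p.
  apply: le_trans low; rewrite ler_pdivlMr ?mulr_gt0 // mulrAC ler_pdivrMr ?mulr_gt0 //.
  have : (r - 1) * (4 * x) <= (r - 1) * (9 / 2 * eps) by apply: ler_wpM2l; move: x3 r1 e0; narrow; lra.
  have re : 0 <= (r - 1) * eps by apply: mulr_ge0; move: r1 e0; narrow; lra.
  have rre : 0 <= (r - 1) * ((r - 1) * eps) by apply: mulr_ge0 => //; move: r1; narrow; lra.
  rewrite -/x; move: re rre; narrow; lra.
set Li' := (ln (3 / 2))^-1 in Li *; move=> main.
have da : 0 <= d + a by exact: addr_ge0.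
have r1' : 0 <= r - 1 by move: r1; narrow; lra.
have k1 : (d + a) * Li' * (2 * (r ^+ 2 - 1) + 2 * (r - 1) ^+ 2) <= 11 * (d + a) * (r - 1).
  have h1 : 0 <= 2 * (r ^+ 2 - 1) + 2 * (r - 1) ^+ 2 by move: r1; narrow; nra.
  have h2 : (d + a) * Li' <= (d + a) * (5 / 2) by exact: ler_wpM2l.
  apply: (le_trans (ler_wpM2r h1 h2)).
  have h3 : 2 * (r ^+ 2 - 1) + 2 * (r - 1) ^+ 2 <= 22 / 5 * (r - 1) by move: r1 r2 e0 e5; narrow; nra.
  have h4 : 0 <= (d + a) * (5 / 2) by apply: mulr_ge0; move: da; narrow; lra.
  by have := ler_wpM2l h4 h3; have := mulr_ge0 da r1'; narrow; lra.
have k2 := ler_wpM2l d0 low2.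
have k3 : 11 * d * (r - 1) <= d * (r - 1) / (8 * eps).
  rewrite ler_pdivlMr ?mulr_gt0 //.
  have : 0 <= d * (r - 1) by exact: mulr_ge0.
  by move: e0 e5; narrow; nra.
have k4 : d * ((r - 1) / (4 * eps)) = 2 * (d * (r - 1) / (8 * eps)) by field; rewrite gt_eqF.
have : 0 <= a * (r - 1) by exact: mulr_ge0.
by move: main k1 k2 k3 k4; narrow; lra.
Qed.

Lemma profile_upper_bound : 0 <= a -> 0 <= d -> d <= 20 * 20 * a * Num.sqrt eps.
Proof.
move=> a0 d0; have e0 := eps_gt0; have e5 := eps_small; have [vx [vy H]] := HhG.
set q := Num.sqrt eps; have q0 : 0 < q by rewrite sqrtr_gt0.
have qE : q ^+ 2 = eps by rewrite sqr_sqrtr // ltW.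
have p2 := @pi_ge2 R; have p4 : pi <= 4 :> R by have := @pihalf_lt2 R; lra.
have q1 : q <= 1 by nra.
(* The arc of length [q = sqrt eps] lowers the integral by [d (r - 1) / (8 eps) q = d (r - 1) / (8
   q)], while the excess over the half-circle is at most [12 a pi (r - 1) <= 48 a (r - 1)]. The flux
   condition makes the two balance up to [e (r - 1)]. *)
suff : d / (8 * q) <= 48 * a.
  rewrite ler_pdivrMr ?mulr_gt0 //; have : 0 <= a * q by apply: mulr_ge0 => //; exact: ltW.
  lra.
apply/ler_addgt0Pr => e ep; have [t t0 Ht] := mv ep; have sr := small_radius_gt0.
pose r := 1 + Num.min t small_radius / 2.
have m0 : 0 < Num.min t small_radius by rewrite lt_min t0.
have m1 : Num.min t small_radius <= t by rewrite ge_min lexx.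
have m2 : Num.min t small_radius <= small_radius by rewrite ge_min lexx orbT.
have rs : 1 < r < 1 + small_radius by apply/andP; split; rewrite /r; lra.
have rt : 1 < r < 1 + t by apply/andP; split; rewrite /r; lra.
have [_ r1 r2] := small_radiusP rs.
have [_] := Ht r rt; rewrite ler_norml => /andP[h _].
have cv aa bb : cont_on aa bb (fun t => v (circ C0 r t)) by exact: (circ_column_cont H).
have i1 : (0 : R) <= pi - q <= (pi : R) by apply/andP; split; lra.
rewrite (Rint_split i1 (cv _ _)) in h.
have b1 : Rint 0 (pi - q) (fun t => v (circ C0 r t)) <= (d + 12 * a * (r - 1)) * (pi - q).
  have -> : (d + 12 * a * (r - 1)) * (pi - q) = Rint 0 (pi - q) (fun=> d + 12 * a * (r - 1)) by rewrite Rint_cst ?subr0 //; lra.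
  apply: le_Rint; [exact: cv|exact: cont_on_cst|move=> s _].
  have pC : sqdist (circ C0 r s) C0 < (3 / 2) ^+ 2 by rewrite sqdist_circ; nra.
  apply: (le_trans (profile_annulus a0 d0 (circ_column s rs) pC)).
  rewrite sqdist_circ lnXn ?(lt_trans ltr01) // mulr2n.
  have hl : ln r <= r - 1 by have := @le_ln1Dx R (r - 1); rewrite (_ : 1 + (r - 1) = r); [apply; lra|ring].
  have a12 : 0 <= 12 * a by lra.
  have := ler_wpM2l a12 hl; lra.
set W := d + 12 * a * (r - 1) - d * (r - 1) / (8 * eps).
have b2 : Rint (pi - q) pi (fun t => v (circ C0 r t)) <= W * q.
  have -> : W * q = Rint (pi - q) pi (fun=> W) by rewrite Rint_cst; [ring|lra].
  apply: le_Rint; [exact: cv|exact: cont_on_cst|move=> s /andP[s1 s2]].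
  by apply: circ_gap_upper => //; [move: s1 q1 p2; narrow; lra|apply/andP; split; rewrite -/q; move: s1 s2; narrow; lra].
have r10 : 0 < r - 1 by lra.
have k1 : d * (r - 1) / (8 * eps) * q = d / (8 * q) * (r - 1) by rewrite -qE; field; rewrite gt_eqF.
rewrite -(ler_pM2r r10) -k1.
have : 12 * a * (r - 1) * pi <= 12 * a * (r - 1) * 4 by apply: ler_wpM2l => //; apply: mulr_ge0; move: a0 r10; narrow; lra.
by rewrite /W in b2; move: b1 b2 h; narrow; lra.
Qed.

End Profile.

Lemma odd_profile_zero d v : odd_profile eps delta 0 d v -> d = 0.
Proof.
have half d' v' : odd_profile eps delta 0 d' v' -> d' <= 0.
  move=> H; have [//|d0] := lerP d' 0.
  by have := profile_upper_bound H (lexx 0) (ltW d0); rewrite mulr0 mul0r; lra.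
move=> H; apply/eqP; rewrite eq_le (half d v H) /=.
have := odd_profile_comb eps_gt0 delta_gt0 (-1) 0 H H.
by rewrite !mulr0 mul0r !addr0 mulN1r => /half; rewrite oppr_le0.
Qed.

Lemma odd_profile_unique (a a' d d' : R) v v' :
  odd_profile eps delta a d v -> odd_profile eps delta a' d' v' -> a * d' = a' * d.
Proof.
move=> H H'; have := odd_profile_comb eps_gt0 delta_gt0 a' (- a) H H'.
have -> : a' * a + - a * a' = 0 by ring.
by move=> /odd_profile_zero; lra.
Qed.

Lemma odd_profile_ratio (a d : R) v : odd_profile eps delta a d v -> a != 0 ->
  1 <= 20 * 20 * 20 * (d / (a * Num.sqrt eps)) /\ d / (a * Num.sqrt eps) <= 20 * 20.
Proof.
move=> H; have q0 : 0 < Num.sqrt eps by rewrite sqrtr_gt0.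
have pos a' d' v' : odd_profile eps delta a' d' v' -> 0 < a' -> 1 <= 20 * 20 * 20 * (d' / (a' * Num.sqrt eps)) /\ d' / (a' * Num.sqrt eps) <= 20 * 20.
  move=> H' a0; have aq : 0 < a' * Num.sqrt eps by exact: mulr_gt0.
  have h1 := profile_lower_bound H' a0; have h2 := profile_upper_bound H' (ltW a0) (ltW (profile_pos H' a0)).
  by split; [rewrite mulrA ler_pdivlMr|rewrite ler_pdivrMr] => //; lra.
rewrite neq_lt => /orP[a0|a0]; last exact: pos H a0.
have := odd_profile_comb eps_gt0 delta_gt0 (-1) 0 H H; rewrite !mul0r !addr0 !mulN1r => /pos.
by rewrite oppr_gt0 [- a * _]mulNr invrN mulrNN; apply.
Qed.

End ProfileEstimates.

(** * The two gaps *)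

Section GapGeometry.
Variable R : realType.
Implicit Types (p q z : R * R) (w u : R * R -> R) (e s t x y : R).

(** [s] runs across a gap of width [e] and [t] along it, so that both gaps are covered, with [eps]
    and with [delta]. The circle lies below its parabola because [sqrt (1 - t^2) >= 1 - t^2]. *)
Lemma gap_interior e s t : 0 < e <= 1 / 5 -> `|s| < 1 + e / 2 - Num.sqrt (1 - t ^+ 2) -> `|t| < Num.sqrt 3 / 2 ->
  [/\ t ^+ 2 <= 3 / 4, `|s| <= e / 2 + t ^+ 2, s ^+ 2 + t ^+ 2 <= (11 / 10) ^+ 2 &
      1 < (s - (1 + e / 2)) ^+ 2 + t ^+ 2 /\ 1 < (s - (- 1 - e / 2)) ^+ 2 + t ^+ 2].
Proof.
move=> /andP[e0 e5] hs ht.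
have s3 : Num.sqrt 3 ^+ 2 = 3 :> R by rewrite sqr_sqrtr.
have s30 := sqrtr_ge0 (3 : R).
have hsq : t ^+ 2 <= 3 / 4 by rewrite -(real_normK (num_real t)); have := normr_ge0 t; nra.
have t0 := sqr_ge0 t.
set h := Num.sqrt (1 - t ^+ 2) in hs.
have hE : h ^+ 2 = 1 - t ^+ 2 by rewrite sqr_sqrtr; lra.
have h0 : 0 <= h by exact: sqrtr_ge0.
have h1 : 1 / 2 <= h by nra.
have h2 : 1 - t ^+ 2 <= h by nra.
have ss : s ^+ 2 = `|s| ^+ 2 by rewrite real_normK ?num_real.
have n0 := normr_ge0 s.
move: hs; rewrite ltr_norml => /andP[g1 g2].
have hs : `|s| < 1 + e / 2 - h by rewrite ltr_norml g1.
by split; [exact: hsq|lra|rewrite ss; nra|split; nra].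
Qed.

Lemma bip_norm_le1 e z : 0 < e -> 1 <= sqdist z (1 + e / 2, 0) -> 1 <= sqdist z (- 1 - e / 2, 0) -> `|bip e z| <= 1.
Proof.
have pos z' : 0 < e -> 1 <= sqdist z' (1 + e / 2, 0) -> 0 < z'.1 -> `|bip e z'| <= 1.
  move=> e0 h1 z0; have := bip_compl_ge0 e0 z0 h1; have := bip_ge0 e0 (ltW z0) h1.
  by move=> h2 h3; rewrite ger0_norm //; lra.
move=> e0 h1 h2; have [z0|z0|z0] := ltgtP z.1 0; last 1 first.
- by case: z z0 {h1 h2} => x y /= ->; rewrite bip0 normr0.
- have := pos (- z.1, z.2) e0; rewrite bip_odd normrN /=; apply; last by rewrite oppr_gt0.
  by rewrite (_ : sqdist _ _ = sqdist z (- 1 - e / 2, 0)) // /sqdist /=; ring.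
- exact: pos.
Qed.

Lemma bip_circle_left e z : 0 < e -> sqdist z (- 1 - e / 2, 0) = 1 -> bip e z = - 1.
Proof.
move=> e0 zc; rewrite -[LHS]opprK -bip_odd bip_circle //.
by rewrite -[RHS]zc /sqdist /=; ring.
Qed.

Lemma circle_outside (cc : R) z : 1 <= cc -> sqdist z (cc, 0) = 1 -> 1 <= sqdist z (- cc, 0).
Proof.
rewrite /sqdist /= => c1 h; have h2 := sqr_ge0 (z.2 - 0); rewrite -{1}h lerD2r.
by have z0 : 0 <= z.1 by [nra]; nra.
Qed.

Lemma vnorm_le (v : R * R) : vnorm v <= `|v.1| + `|v.2|.
Proof.
rewrite /vnorm -[leRHS]ger0_norm ?addr_ge0 // -sqrtr_sqr ler_wsqrtr //.
rewrite -(real_normK (num_real v.1)) -(real_normK (num_real v.2)).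
by have := mulr_ge0 (normr_ge0 v.1) (normr_ge0 v.2); nra.
Qed.

Lemma sqdist_far m z ctr : (11 / 5) ^+ 2 <= sqdist m ctr -> sqdist z m < (6 / 5) ^+ 2 -> 1 < sqdist z ctr.
Proof.
move=> far zm; rewrite ltNge; apply/negP => zc.
have mz : sqdist m z < (6 / 5) ^+ 2 by rewrite sqdistC.
have zc1 : sqdist z ctr <= 1 ^+ 2 by rewrite expr1n.
have p6 : (0 : R) <= 6 / 5 by lra.
by have := sqdist_triangle_lt p6 ler01 mz zc1; lra.
Qed.

Lemma boundary_value_vanishes (U G : set (R * R)) (u g w : R * R -> R) ctr (k : R) : G `<=` U ->
  boundary_value U u ctr k -> (forall q, sqdist q ctr = 1 -> {for q, continuous g}) ->
  (forall q, sqdist q ctr = 1 -> g q = k) -> (forall z, w z = u z - g z) -> vanishes_at G w ctr.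
Proof.
move=> GU bu cg gk wE q qc e e0; have e2 : 0 < e / 2 by exact: divr_gt0.
have /continuous_boxP /(_ _ e2)[r r0 Hr] := cg q qc.
have ng : \forall z \near q, `|g z - k| < e / 2.
  by apply/nbhs_boxP; exists r => // x y hx hy; have := Hr x y hx hy; rewrite (gk q qc).
apply: near_imp2 ng (bu q qc _ e2) _ => z h1 h2 Gz; have := h2 (GU z Gz); move: h1.
by rewrite wE ltr_norml !ler_norml => /andP[h3 h4] /andP[h5 h6]; apply/andP; split; lra.
Qed.

End GapGeometry.

(** * Comparison with the bipolar potential in each gap *)

Section FinalEstimates.
Variable R : realType.
Implicit Types (p q z : R * R) (w : R * R -> R) (e h k l r s t x y X S : R).
Variables eps delta : R.
Hypotheses (eps_gt0 : 0 < eps) (delta_gt0 : 0 < delta) (eps_small : eps <= 1 / 10 / 20) (delta_small : delta <= 1 / 5).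
Local Notation E := (Ext eps delta).
Local Notation P := (2 + delta).
Local Notation c := (1 + eps / 2).

(** On the circles of index [n] the term [n b P] of the boundary value cancels against [b y] up to
    [|b|], and [|x| <= 3] there; the coefficient 3 covers both errors. *)
Lemma global_upper w wx wy (a b kL kR S : R) : harm E w wx wy ->
  (forall x y, E (x, y) -> w (x, y + P) = w (x, y) + b * P) ->
  (forall n : int, boundary_value E w (cL eps delta n) (kL + n%:~R * (b * P))) ->
  (forall n : int, boundary_value E w (cR eps delta n) (kR + n%:~R * (b * P))) ->
  far_limit_at eps delta 1 w a b -> far_limit_at eps delta (-1) w a b ->
  kL <= S -> kR <= S ->
  forall p, E p -> w p - (a * p.1 + b * p.2) <= S + 3 * (`|a| + `|b|).
Proof.
move=> H per HL HR f1 fN1 kLS kRS; have e0 := eps_gt0; have e5 := eps_small.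
have [wx' [wy' HW]] : exists wx wy, harm E (fun p => w p - (a * p.1 + b * p.2)) wx wy.
  by do 2 eexists; apply: (harm_ext (harmB H (harm_affine E a b 0))) => p //; rewrite addr0.
have edge ctr (n : int) k : boundary_value E w ctr (k + n%:~R * (b * P)) -> k <= S -> ctr.2 = n%:~R * P ->
    `|ctr.1| <= 2 -> forall q, sqdist q ctr = 1 -> forall e, 0 < e ->
    \forall p \near q, E p -> w p - (a * p.1 + b * p.2) <= S + 3 * (`|a| + `|b|) + e.
  move=> bw kS c2 c1 q qc e ep; have e2 : 0 < e / 2 by exact: divr_gt0.
  have ca : {for q, continuous (fun p : R * R => (a * q.1 + b * q.2) - (a * p.1 + b * p.2))}.
    apply: cvgB; first exact: cvg_cst.
    by apply: cvgD; apply: cvgMr; [exact: cvg_fst|exact: cvg_snd].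
  have a0 : (a * q.1 + b * q.2) - (a * q.1 + b * q.2) <= 0 by rewrite subrr.
  apply: near_imp2 (near_le_continuous ca a0 e2) (bw q qc _ e2) _ => z h1 h2 Ez.
  have := h2 Ez; rewrite ler_norml => /andP[_ h3].
  have q1 : `|q.1| <= 3.
    have := ler_normD (q.1 - ctr.1) ctr.1; rewrite subrK => h.
    have : `|q.1 - ctr.1| <= 1.
      by rewrite ler_norml; move: qc; rewrite /sqdist; have := sqr_ge0 (q.2 - ctr.2) => ? ?; apply/andP; split; nra.
    lra.
  have q2 : `|q.2 - ctr.2| <= 1.
    by rewrite ler_norml; move: qc; rewrite /sqdist; have := sqr_ge0 (q.1 - ctr.1) => ? ?; apply/andP; split; nra.
  have h4 : - (a * q.1) <= `|a| * 3.
    by apply: (le_trans (ler_norm _)); rewrite normrN normrM ler_wpM2l.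
  have h5 : - (b * (q.2 - ctr.2)) <= `|b| * 1.
    by apply: (le_trans (ler_norm _)); rewrite normrN normrM ler_wpM2l.
  have bn := normr_ge0 b; rewrite c2 in h5; lra.
apply: (@full_max R eps delta eps_gt0 delta_gt0 _ _ _ _ HW).
- by move=> x y Exy _ /=; rewrite per //; ring.
- move=> n; apply: (edge _ n kL (HL n) kLS) => //.
  by rewrite /cL /= -opprD normrN ger0_norm; lra.
- move=> n; apply: (edge _ n kR (HR n) kRS) => //.
  by rewrite /cR /= ger0_norm; lra.
- exact: far_limit_affine.
- exact: far_limit_affine.
Qed.

Section Solution.
Variables (a b : R) (u : R * R -> R).
Hypothesis Hu : solution eps delta (fun p => a * p.1 + b * p.2) u.
Variables kL kR : R.
Hypothesis HL : forall n : int, boundary_value E u (cL eps delta n) (kL + n%:~R * (b * P)).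
Hypothesis HR : forall n : int, boundary_value E u (cR eps delta n) (kR + n%:~R * (b * P)).
Local Notation A := (`|a| + `|b|).
Local Notation d := ((kR - kL) / 2).
Local Notation kbar := ((kL + kR) / 2).

Let Hh : harm E u (dx u) (dy u).
Proof. by apply: harmonic_on_harm; case: Hu. Qed.

Let Hprof : odd_profile eps delta a d (profile u).
Proof. exact: (@solution_profile R eps delta eps_gt0 delta_gt0 a b u Hu kL kR HL HR). Qed.

Lemma solution_jump_bound : `|d| <= 20 * 20 * `|a| * Num.sqrt eps.
Proof.
have q0 : 0 < Num.sqrt eps by rewrite sqrtr_gt0.
have [a0|a0] := eqVneq a 0.
  have H := Hprof; rewrite a0 in H.
  by rewrite (odd_profile_zero eps_gt0 delta_gt0 eps_small H) a0 !normr0 mulr0 mul0r.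
have [h1 h2] := odd_profile_ratio eps_gt0 delta_gt0 eps_small Hprof a0.
have aq : a * Num.sqrt eps != 0 by rewrite mulf_neq0 // gt_eqF.
have dE := divfK aq d; move: h1 h2 dE; move: (d / _) => k h1 h2 <-.
rewrite !normrM (gtr0_norm q0) ger0_norm; last lra.
by rewrite -mulrA; apply: ler_wpM2r => //; apply: mulr_ge0 => //; exact: ltW.
Qed.

(** The upper bound is applied to [u] and to [- u], with boundary values within [|d|] of [kbar] and
    [- kbar]; one half of the constant 6 comes from adding [a x + b y] back. *)
Lemma solution_bound p : E p -> `|p.1| <= 3 -> `|p.2| <= 3 -> `|u p - kbar| <= `|d| + 6 * A.
Proof.
move=> Ep p1 p2.
have n1 : `|1 : R| = 1 by exact: normr1.
have nN1 : `|-1 : R| = 1 by rewrite normrN normr1.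
have qp := solution_quasiperiodic eps_gt0 delta_gt0 Hu.
have f1 := solution_far eps_gt0 delta_gt0 Hu n1; have fN1 := solution_far eps_gt0 delta_gt0 Hu nN1.
have cu z : E z -> {for z, continuous u} by move=> Ez; exact: (harm_continuous Hh).
have d1 : d <= `|d| := ler_norm _; have d2 : - d <= `|d| by rewrite -normrN ler_norm.
have sL : kL <= kbar + `|d| by lra.
have sR : kR <= kbar + `|d| by lra.
have up := global_upper Hh qp HL HR f1 fN1 sL sR Ep.
have neg_bv ctr (n : int) k : boundary_value E u ctr (k + n%:~R * (b * P)) ->
    boundary_value E (fun z => -1 * u z + 0 * u z) ctr (- k + n%:~R * (- b * P)).
  move=> bw q qc e e0; apply: near_imp (bw q qc e e0) _ => z h /h.
  by rewrite -normrN; congr (`|_| <= _); ring.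
have g1 := far_limit_comb eps_gt0 (-1) 0 n1 cu cu f1 f1.
have gN1 := far_limit_comb eps_gt0 (-1) 0 nN1 cu cu fN1 fN1.
rewrite !mul0r !addr0 !mulN1r in g1 gN1.
have nL : - kL <= - kbar + `|d| by lra.
have nR : - kR <= - kbar + `|d| by lra.
have nper x y : E (x, y) -> -1 * u (x, y + P) + 0 * u (x, y + P) = -1 * u (x, y) + 0 * u (x, y) + - b * P.
  by move=> Exy; rewrite qp //; ring.
have dn := global_upper (harmD (harmZ (-1) Hh) (harmZ 0 Hh)) nper (fun n => neg_bv _ n _ (@HL n)) (fun n => neg_bv _ n _ (@HR n)) g1 gN1 nL nR Ep.
rewrite !normrN in dn.
have h1 : `|a * p.1 + b * p.2| <= 3 * A.
  apply: (le_trans (ler_normD _ _)); rewrite !normrM.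
  have := ler_wpM2l (normr_ge0 a) p1; have := ler_wpM2l (normr_ge0 b) p2; lra.
move: h1; rewrite !ler_norml; clear g1 gN1 nL nR f1 fN1 => /andP[h1 h2]; apply/andP; split; lra.
Qed.

Section Gap.
Variable K : R.
Hypothesis gap_gradK : forall c1 c2 m w wx wy M p,
  harm (gap_nbhd c1 c2 m) w wx wy ->
  (forall z, gap_nbhd c1 c2 m z -> `|w z| <= M) ->
  vanishes_at (gap_nbhd c1 c2 m) w c1 -> vanishes_at (gap_nbhd c1 c2 m) w c2 ->
  gap_nbhd c1 c2 m p -> sqdist p m <= (11 / 10) ^+ 2 ->
  `|wx p| <= K * M /\ `|wy p| <= K * M.

Local Ltac narrow := clear - R eps delta eps_gt0 delta_gt0 eps_small delta_small a b u Hu kL kR HL HR Hh Hprof K gap_gradK.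

Lemma sqrt_eps_le1 : Num.sqrt eps <= 1.
Proof. by rewrite -sqrtr1 ler_wsqrtr //; have := eps_small; lra. Qed.

Lemma jump_le : `|d| <= 20 * 20 * A.
Proof.
apply: (le_trans solution_jump_bound); have a0 := normr_ge0 a; have b0 := normr_ge0 b.
have h := ler_wpM2l a0 sqrt_eps_le1; lra.
Qed.

Lemma int_mul_ge (n : int) : n != 0 -> P <= `|n%:~R * P|.
Proof.
move=> n0; have d0 := delta_gt0; rewrite normrM (gtr0_norm (_ : 0 < P)); last lra.
rewrite ler_peMl //; first lra.
by rewrite -intr_norm -(mulr1z 1) ler_int; case: n n0 => -[].
Qed.

(** All other centres are at distance at least [11 / 5 = 6 / 5 + 1] from the middle of the gap, as
    their squared distance exceeds 5. *)
Lemma vertical_gap_Ext : gap_nbhd (cR eps delta 0) (cL eps delta 0) (0, 0) `<=` E.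
Proof.
move=> z [z1 z2 zm] n; have [->|n0] := eqVneq n 0; first by [].
have e0 := eps_gt0; have d0 := delta_gt0.
have h : P ^+ 2 <= (0 - n%:~R * P) ^+ 2.
  by rewrite sub0r sqrrN -[leRHS]real_normK ?num_real // lerXn2r ?nnegrE ?int_mul_ge //; lra.
by split; apply: sqdist_far zm; rewrite /sqdist /cL /cR /=; nra.
Qed.

Lemma horizontal_gap_Ext : gap_nbhd (cR eps delta 0) (cR eps delta 1) (1 + eps / 2, 1 + delta / 2) `<=` E.
Proof.
move=> z [z1 z2 zm] n; have e0 := eps_gt0; have d0 := delta_gt0.
have half : (P / 2) ^+ 2 <= (1 + delta / 2 - n%:~R * P) ^+ 2.
  have -> : (1 + delta / 2 - n%:~R * P) ^+ 2 = P ^+ 2 * `|1 / 2 - n%:~R| ^+ 2.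
    by rewrite real_normK ?num_real//; field.
  have : (1 / 2) ^+ 2 <= `|1 / 2 - n%:~R : R| ^+ 2 by rewrite lerXn2r ?nnegrE // int_dist_half.
  by have := sqr_ge0 P; nra.
split; first by apply: sqdist_far zm; rewrite /sqdist /cL /=; nra.
have [->|n0] := eqVneq n 0; first by [].
have [->|n1] := eqVneq n 1; first by [].
apply: sqdist_far zm; rewrite /sqdist /cR /= subrr expr0n add0r.
have : (3 / 2 * P) ^+ 2 <= (1 + delta / 2 - n%:~R * P) ^+ 2; last by nra.
have [n2|n2] := lerP n 0.
  have : n%:~R <= (-1)%:~R :> R by rewrite ler_int; case: n n0 n1 n2 {half} => -[].
  by rewrite rmorphN /= mulr1z => h; rewrite lerXn2r ?nnegrE; nra.
have : 2%:~R <= n%:~R :> R by rewrite ler_int; case: n n0 n1 n2 {half} => [[|[]]|].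
move=> h; rewrite -[leRHS]sqrrN opprB lerXn2r ?nnegrE; nra.
Qed.

Lemma vertical_gap_grad p : Nv eps p ->
  `|dx u p - 2 * d / (eps + p.2 ^+ 2)| <= (10 * 10 * 10 * K + 20 * 20 * 20) * A /\ `|dy u p| <= (10 * 10 * 10 * K + 20 * 20 * 40) * A.
Proof.
have e0 := eps_gt0; have e5 := eps_small; have a0 := normr_ge0 a; have b0 := normr_ge0 b.
have e15 : 0 < eps <= 1 / 5 by rewrite e0; lra.
move=> [hs ht]; have [hsq hst hdist [hout1 hout2]] := gap_interior e15 hs ht.
have jl := jump_le; have jb := solution_jump_bound.
have cRE := cR0E eps delta; have cLE := cL0E eps delta.
pose G := gap_nbhd (cR eps delta 0) (cL eps delta 0) (0, 0).
have GE := vertical_gap_Ext; rewrite -/G in GE.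
have Gout z : G z -> 1 < sqdist z (1 + eps / 2, 0) /\ 1 < sqdist z (- 1 - eps / 2, 0).
  by rewrite -cRE -cLE => -[].
have hb := harm_bip e0 Gout.
have HW := harmB (harmB (harm_sub GE Hh) (harm_cst G kbar)) (harmZ d hb).
have wM z : G z -> `|u z - kbar - d * bip eps z| <= 10 * 10 * 10 * A.
  move=> Gz; have [z1 z2] := Gout z Gz.
  have bb : `|bip eps z| <= 1 by apply: bip_norm_le1 => //; exact: ltW.
  have [_ _] := Gz; rewrite /sqdist /= !subr0 => zm.
  have b1 : `|z.1| <= 3 by move: zm; narrow => zm; rewrite ler_norml; have := sqr_ge0 z.2 => ?; apply/andP; split; nra.
  have b2 : `|z.2| <= 3 by move: zm; narrow => zm; rewrite ler_norml; have := sqr_ge0 z.1 => ?; apply/andP; split; nra.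
  have := solution_bound (GE z Gz) b1 b2.
  have := ler_normB (u z - kbar) (d * bip eps z); rewrite normrM.
  have := ler_wpM2l (normr_ge0 d) bb; move: jl a0 b0; narrow; lra.
have van ctr k : boundary_value E u ctr k -> (forall z, sqdist z ctr = 1 -> 1 <= sqdist z (1 + eps / 2, 0) /\ 1 <= sqdist z (- 1 - eps / 2, 0)) ->
    (forall z, sqdist z ctr = 1 -> kbar + d * bip eps z = k) -> vanishes_at G (fun z => u z - kbar - d * bip eps z) ctr.
  move=> bw out val; apply: (boundary_value_vanishes GE bw _ val) => [q /out[q1 q2]|z]; last by ring.
  by apply: cvgD; [exact: cvg_cst|apply: cvgMr; exact: bip_continuous].
have cE : - (1 + eps / 2) = - 1 - eps / 2 by ring.
have vR : vanishes_at G (fun z => u z - kbar - d * bip eps z) (cR eps delta 0).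
  have bR : boundary_value E u (cR eps delta 0) kR by have := @HR 0; rewrite mulr0z mul0r addr0.
  apply: (van _ _ bR) => z; rewrite cRE => zc.
    by split; [rewrite zc|rewrite -cE; apply: circle_outside zc; lra].
  by rewrite bip_circle //; lra.
have vL : vanishes_at G (fun z => u z - kbar - d * bip eps z) (cL eps delta 0).
  have bL : boundary_value E u (cL eps delta 0) kL by have := @HL 0; rewrite mulr0z mul0r addr0.
  apply: (van _ _ bL) => z; rewrite cLE => zc; last by rewrite bip_circle_left //; lra.
  split; last by rewrite zc.
  have := @circle_outside R (1 + eps / 2) (- z.1, z.2); rewrite /sqdist /= in zc *.
  have -> : (- z.1 - (1 + eps / 2)) ^+ 2 = (z.1 - (- 1 - eps / 2)) ^+ 2 by ring.
  have -> : (- z.1 - - (1 + eps / 2)) ^+ 2 = (z.1 - (1 + eps / 2)) ^+ 2 by ring.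
  by apply; [lra|].
have Gp : G p by split; [rewrite cRE /sqdist /= subr0|rewrite cLE /sqdist /= subr0|rewrite /sqdist /= !subr0; lra].
have pm : sqdist p (0, 0) <= (11 / 10) ^+ 2 by rewrite /sqdist /= !subr0.
have [h1 h2] := gap_gradK HW wM vR vL Gp pm.
have [hout1' hout2'] := Gout p Gp.
have [g1 g2] := bip_grad_approx e15 hst hsq (ltW hout1') (ltW hout2').
clear HW wM van vR vL hs ht hdist hout1 hout2 hout1' hout2' pm.
have D0 : 0 < eps + p.2 ^+ 2 by have := sqr_ge0 p.2; move: e0; narrow; lra.
have k1 : `|d| * `|bipx eps p - 2 / (eps + p.2 ^+ 2)| <= `|d| * 20 by apply: ler_wpM2l.
have k2 : `|d| * `|bipy eps p + 4 * p.1 * p.2 / (eps + p.2 ^+ 2) ^+ 2| <= `|d| * 32 by apply: ler_wpM2l.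
split.
  have -> : dx u p - 2 * d / (eps + p.2 ^+ 2) = (dx u p - 0 - d * bipx eps p) + d * (bipx eps p - 2 / (eps + p.2 ^+ 2)).
    by field; rewrite gt_eqF.
  apply: (le_trans (ler_normD _ _)); rewrite (normrM d); move: h1 k1 jl a0 b0; narrow; lra.
have -> : dy u p = (dy u p - 0 - d * bipy eps p) + d * (bipy eps p + 4 * p.1 * p.2 / (eps + p.2 ^+ 2) ^+ 2) - d * (4 * p.1 * p.2 / (eps + p.2 ^+ 2) ^+ 2).
  by ring.
(* A merely bounded jump would not suffice here: [|p.1| <= eps + y^2] leaves
   [4 |d| |y| / (eps + y^2)], which is bounded because [|d|] is at most a multiple of [|a| sqrt eps]
   and [2 sqrt eps |y| <= eps + y^2]. *)
have k3 : `|d * (4 * p.1 * p.2 / (eps + p.2 ^+ 2) ^+ 2)| <= 20 * 40 * A.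
  have D2 : 0 < (eps + p.2 ^+ 2) ^+ 2 by exact: exprn_gt0.
  rewrite mulrA normrM (gtr0_norm (_ : 0 < (_ ^+ 2)^-1)) ?invr_gt0 // ler_pdivrMr //.
  set q := Num.sqrt eps in jb *; have q0 : 0 < q by rewrite sqrtr_gt0.
  have qE : q ^+ 2 = eps by rewrite sqr_sqrtr // ltW.
  have n1 : `|d * (4 * p.1 * p.2)| = 4 * (`|d| * `|p.1| * `|p.2|) by rewrite !normrM (ger0_norm (_ : 0 <= 4)) //; ring.
  have tE : p.2 ^+ 2 = `|p.2| ^+ 2 by rewrite real_normK ?num_real.
  have s1 : `|p.1| <= eps + p.2 ^+ 2 by move: hst e0; narrow; lra.
  have s2 : 2 * (q * `|p.2|) <= eps + p.2 ^+ 2 by rewrite tE -qE; have := sqr_ge0 (q - `|p.2|); narrow; nra.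
  have s3 : `|d| * `|p.2| <= 10 * 20 * `|a| * (eps + p.2 ^+ 2).
    apply: (le_trans (ler_wpM2r (normr_ge0 p.2) jb)).
    have := ler_wpM2l a0 s2; narrow; lra.
  rewrite n1; have -> : `|d| * `|p.1| * `|p.2| = (`|d| * `|p.2|) * `|p.1| by ring.
  have s4 := ler_pM (mulr_ge0 (normr_ge0 d) (normr_ge0 p.2)) (normr_ge0 p.1) s3 s1.
  have s5 : 0 <= `|b| * (eps + p.2 ^+ 2) ^+ 2 by apply: mulr_ge0 => //; exact: ltW.
  move: s4 s5; narrow; lra.
apply: (le_trans (ler_normB _ _)); apply: (@le_trans _ _ (K * (10 * 10 * 10 * A) + `|d| * 32 + 20 * 40 * A)); last by move: jl a0 b0; narrow; lra.
apply: lerD => //; apply: (le_trans (ler_normD _ _)); rewrite (normrM d); move: h2 k2; narrow; lra.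
Qed.

Lemma horizontal_gap_grad p : Nh eps delta p ->
  `|dx u p - 2 * b * ((Num.sqrt delta)^-1 * Sfun eps delta p)| <= (10 * 10 * 10 * K + 10 * 10) * A /\
  `|dy u p - 2 * b * (delta + (p.1 - 1 - eps / 2) ^+ 2)^-1| <= (10 * 10 * 10 * K + 10 * 10) * A.
Proof.
have e0 := eps_gt0; have e5 := eps_small; have a0 := normr_ge0 a; have b0 := normr_ge0 b.
have d0 := delta_gt0; have d5 := delta_small.
have d15 : 0 < delta <= 1 / 5 by rewrite d0.
move=> [hs ht]; have [] := gap_interior d15 hs ht.
set s := p.2 - 1 - delta / 2; set t := p.1 - 1 - eps / 2 => hsq hst hdist [hout1 hout2].
have jl := jump_le.
(* Half the jump between the two disks, so that [kR + B] is the average of their boundary values. As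
   [B = b + b delta / 2], the product of [B] with the gradient of [bip] has leading coefficient
   [2 b]. *)
pose B := b * P / 2.
have Bb : `|B| <= 11 / 10 * `|b|.
  by rewrite /B -mulrA normrM mulrC; apply: ler_wpM2r => //; rewrite ger0_norm; move: d0 d5; narrow; lra.
have cRE := cR0E eps delta.
have cR1 : cR eps delta 1 = (1 + eps / 2, 2 + delta) by rewrite /cR mulr1z mul1r.
pose m : R * R := (1 + eps / 2, 1 + delta / 2).
pose G := gap_nbhd (cR eps delta 0) (cR eps delta 1) m.
have GE := horizontal_gap_Ext; rewrite -/m -/G in GE.
(* Coordinates centred in the gap with the axes exchanged: the upper disk takes the part of the
   right one. *)
pose T z : R * R := (1 * z.2 + - (1 + delta / 2), 1 * z.1 + - (1 + eps / 2)).
have T1 z : sqdist (T z) (1 + delta / 2, 0) = sqdist z (cR eps delta 1) by rewrite cR1 /sqdist /T /=; field.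
have T0 z : sqdist (T z) (- 1 - delta / 2, 0) = sqdist z (cR eps delta 0) by rewrite cRE /sqdist /T /=; field.
have Gout z : G z -> 1 < sqdist (T z) (1 + delta / 2, 0) /\ 1 < sqdist (T z) (- 1 - delta / 2, 0).
  by rewrite T0 T1 => -[].
have hb : harm G (fun z => bip delta (T z)) (fun z => 1 * bipy delta (T z)) (fun z => 1 * bipx delta (T z)).
  have s1 : 1 ^+ 2 = 1 :> R by exact: expr1n.
  pose G0 := [set z | 1 < sqdist z (1 + delta / 2, 0) /\ 1 < sqdist z (- 1 - delta / 2, 0)].
  have h0 : harm G0 (bip delta) (bipx delta) (bipy delta) by apply: harm_bip => // z [].
  have := harm_swap (harm_isometry (- (1 + delta / 2)) (- (1 + eps / 2)) s1 s1 h0).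
  by apply: harm_sub => z /Gout.
have HW := harmB (harmB (harm_sub GE Hh) (harm_cst G (kR + B))) (harmZ B hb).
have wM z : G z -> `|u z - (kR + B) - B * bip delta (T z)| <= 10 * 10 * 10 * A.
  move=> Gz; have [z1 z2] := Gout z Gz.
  have bb : `|bip delta (T z)| <= 1 by apply: bip_norm_le1 => //; exact: ltW.
  have [_ _] := Gz; rewrite /sqdist /m /= => zm.
  have b1 : `|z.1| <= 3 by move: zm e0 e5; narrow => zm e0 e5; rewrite ler_norml; have := sqr_ge0 (z.2 - (1 + delta / 2)) => ?; apply/andP; split; nra.
  have b2 : `|z.2| <= 3 by move: zm d0 d5; narrow => zm d0 d5; rewrite ler_norml; have := sqr_ge0 (z.1 - (1 + eps / 2)) => ?; apply/andP; split; nra.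
  have h1 := solution_bound (GE z Gz) b1 b2.
  have h2 := ler_wpM2l (normr_ge0 B) bb.
  have -> : u z - (kR + B) - B * bip delta (T z) = (u z - kbar) - d - B - B * bip delta (T z) by narrow; lra.
  apply: (le_trans (ler_normB _ _)); rewrite normrM.
  have h3 := ler_normB (u z - kbar - d) B; have h4 := ler_normB (u z - kbar) d; move: h1 h2 h3 h4 jl Bb a0 b0; narrow; lra.
have van ctr k : boundary_value E u ctr k -> (forall z, sqdist z ctr = 1 -> 1 <= sqdist (T z) (1 + delta / 2, 0) /\ 1 <= sqdist (T z) (- 1 - delta / 2, 0)) ->
    (forall z, sqdist z ctr = 1 -> kR + B + B * bip delta (T z) = k) -> vanishes_at G (fun z => u z - (kR + B) - B * bip delta (T z)) ctr.
  move=> bw out val; apply: (boundary_value_vanishes GE bw _ val) => [q /out[q1 q2]|z]; last by ring.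
  apply: cvgD; [exact: cvg_cst|apply: cvgMr; apply: (@continuous_comp _ _ _ T (bip delta))].
    by apply: continuous_pair2; apply: cvgD; try exact: cvg_cst; apply: cvgMr; [exact: cvg_snd|exact: cvg_fst].
  exact: bip_continuous.
have cE : - (1 + delta / 2) = - 1 - delta / 2 by ring.
have v0 : vanishes_at G (fun z => u z - (kR + B) - B * bip delta (T z)) (cR eps delta 0).
  have bR : boundary_value E u (cR eps delta 0) kR by have := @HR 0; rewrite mulr0z mul0r addr0.
  apply: (van _ _ bR) => z; rewrite -T0 => zc; last by rewrite bip_circle_left //; lra.
  split; last by rewrite zc.
  have := @circle_outside R (1 + delta / 2) (- (T z).1, (T z).2); rewrite /sqdist /= in zc *.
  have -> : (- (1 * z.2 + - (1 + delta / 2)) - (1 + delta / 2)) ^+ 2 = (1 * z.2 + - (1 + delta / 2) - (- 1 - delta / 2)) ^+ 2 by ring.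
  have -> : (- (1 * z.2 + - (1 + delta / 2)) - - (1 + delta / 2)) ^+ 2 = (1 * z.2 + - (1 + delta / 2) - (1 + delta / 2)) ^+ 2 by ring.
  by apply; [lra|].
have v1 : vanishes_at G (fun z => u z - (kR + B) - B * bip delta (T z)) (cR eps delta 1).
  have bR : boundary_value E u (cR eps delta 1) (kR + b * P) by have := @HR 1; rewrite mulr1z mul1r.
  apply: (van _ _ bR) => z; rewrite -T1 => zc.
    by split; [rewrite zc|rewrite -cE; apply: circle_outside zc; lra].
  by rewrite bip_circle // /B; field.
have Tp : T p = (s, t) by rewrite /T /s /t !mul1r; congr (_, _); ring.
have pm : sqdist p m <= (11 / 10) ^+ 2.
  by apply: le_trans hdist; rewrite /sqdist /m /= /s /t le_eqVlt; apply/orP; left; apply/eqP; ring.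
have Gp : G p.
  split; [rewrite -T0|rewrite -T1|by apply: (le_lt_trans pm); lra]; by rewrite Tp /sqdist /= subr0.
have [h1 h2] := gap_gradK HW wM v0 v1 Gp pm.
have [hout1' hout2'] := Gout p Gp; rewrite Tp !mul1r in h1 h2 hout1' hout2'.
have [g1 g2] := @bip_grad_approx R delta (s, t) d15 hst hsq (ltW hout1') (ltW hout2').
rewrite /= in g1 g2.
clear HW wM van v0 v1 hs ht hdist hout1 hout2 hout1' hout2' pm e0 e5 jl.
set D := delta + t ^+ 2 in g1 g2.
have D0 : 0 < D by have := sqr_ge0 t; rewrite /D; move: d0; narrow; lra.
have D2 : 0 < D ^+ 2 by exact: exprn_gt0.
have k1 := ler_wpM2l (normr_ge0 B) g1; have k2 := ler_wpM2l (normr_ge0 B) g2.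
have sd0 : 0 < Num.sqrt delta by rewrite sqrtr_gt0.
have SE : 2 * b * ((Num.sqrt delta)^-1 * Sfun eps delta p) = - (4 * b * (s * t / D ^+ 2)).
  rewrite /Sfun -/s -/t (addrC (t ^+ 2)) -/D; field; rewrite !gt_eqF //=.
have t1 : `|t| <= 1.
  by move: hsq; narrow => hsq; rewrite ler_norml; apply/andP; split; nra.
have sD : `|s| <= D by rewrite /D; move: hst d0; narrow; lra.
have stD : `|s * t / D ^+ 2| <= D^-1.
  rewrite !normrM (gtr0_norm (_ : 0 < (D ^+ 2)^-1)) ?invr_gt0 // ler_pdivrMr //.
  have -> : D^-1 * D ^+ 2 = D * 1 by field; rewrite gt_eqF.
  by apply: ler_pM.
(* The excess [b delta / 2] of [B] over [b] only produces terms with the factor [delta / D], which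
   this bound puts into the remainder. *)
have dD : delta * D^-1 <= 1 by rewrite ler_pdivrMr // mul1r /D; have := sqr_ge0 t; narrow; lra.
split.
  have -> : dx u p - 2 * b * ((Num.sqrt delta)^-1 * Sfun eps delta p) =
    (dx u p - 0 - B * bipy delta (s, t)) + B * (bipy delta (s, t) + 4 * s * t / D ^+ 2) - 2 * b * (delta * (s * t / D ^+ 2)).
    rewrite SE /B; field; rewrite gt_eqF //.
  have k3 : `|2 * b * (delta * (s * t / D ^+ 2))| <= 2 * `|b| * 1.
    rewrite normrM (normrM delta) (gtr0_norm d0) normrM (ger0_norm (_ : 0 <= 2)) //.
    apply: ler_wpM2l; first by apply: mulr_ge0.
    apply: le_trans dD; apply: ler_wpM2l => //; exact: ltW.
  apply: (le_trans (ler_normB _ _)).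
  have := ler_normD (dx u p - 0 - B * bipy delta (s, t)) (B * (bipy delta (s, t) + 4 * s * t / D ^+ 2)).
  rewrite (normrM B); move: h1 k2 k3 Bb a0 b0; narrow; lra.
have -> : dy u p - 2 * b * D^-1 =
  (dy u p - 0 - B * bipx delta (s, t)) + B * (bipx delta (s, t) - 2 / D) + b * (delta * D^-1).
  rewrite /B; field; rewrite gt_eqF //.
have k3 : `|b * (delta * D^-1)| <= `|b| * 1.
  rewrite normrM; apply: ler_wpM2l => //; rewrite ger0_norm //.
  by apply: mulr_ge0; [exact: ltW|rewrite invr_ge0; exact: ltW].
apply: (le_trans (ler_normD _ _)).
have := ler_normD (dy u p - 0 - B * bipx delta (s, t)) (B * (bipx delta (s, t) - 2 / D)).
rewrite (normrM B); move: h2 k1 k3 Bb a0 b0; narrow; lra.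
Qed.

End Gap.
End Solution.
End FinalEstimates.

Theorem theorem1p3 (R : realType) :
  exists (C eps0 delta0 : R), [/\ 0 < C, 0 < eps0 & 0 < delta0] /\
  forall eps delta : R, 0 < eps < eps0 -> 0 < delta < delta0 ->
  exists mu0 : R, C^-1 < mu0 < C /\
  forall (a b : R) (u : R * R -> R),
    solution eps delta (fun p => a * p.1 + b * p.2) u ->
    exists M1 M2 : R,
      [/\ forall p, Nh eps delta p ->
            vnorm (dx u p - 2 * b * ((Num.sqrt delta)^-1 * Sfun eps delta p),
                   dy u p - 2 * b * (delta + (p.1 - 1 - eps / 2) ^+ 2)^-1) <= M1,
          forall p, Nv eps p ->
            vnorm (dx u p - a * mu0 * (Num.sqrt eps / (eps + p.2 ^+ 2)),
                   dy u p) <= M2 &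
          M1 + M2 <= C * (`|a| + `|b|)].
Proof.
have [K K0 HK] := gap_grad R.
(* One constant that exceeds [1 / mu0 <= 8000], [mu0 <= 800] and twice the remainder constant [M]
   below. *)
pose C := 20 * 20 * 20 * (10 * K + 10); have C1 : 1 < C by rewrite /C; lra.
exists C, (1 / 10 / 20), (1 / 5); split; first by split; lra.
move=> eps delta /andP[e0 /ltW e5] /andP[d0 /ltW d5].
have q0 : 0 < Num.sqrt eps by rewrite sqrtr_gt0.
(* The leading term of [d bipx] is [2 d / (eps + y^2)], which fixes [mu0] as [2 d / (a sqrt eps)].
   The constant has to be chosen before any solution is given, hence the quantification over all
   profiles. *)
have [mu0 [mu1 mu2 Hmu]] : exists mu0 : R, [/\ 1 <= 20 * 20 * 20 * mu0, mu0 <= 20 * 40 & forall a d v,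
    odd_profile eps delta a d v -> 2 * d = a * mu0 * Num.sqrt eps].
  have [[a [d [v [a0 Hv]]]]|none] := pselect (exists a d v, a != 0 /\ odd_profile eps delta a d v).
    have [h1 h2] := odd_profile_ratio e0 d0 e5 Hv a0.
    exists (2 * (d / (a * Num.sqrt eps))); split; [lra|lra|] => a' d' v' Hv'.
    have aa := odd_profile_unique e0 d0 e5 Hv Hv'.
    have -> : d' = a' * d / a by rewrite -aa mulrC mulKf.
    by field; rewrite a0 gt_eqF.
  (* Default value: without a profile of nonzero slope, every profile has [a = 0] and [d = 0], and
     any admissible constant serves. *)
  exists 1; split; [lra|lra|] => a d v Hv.
  have [a0|a0] := eqVneq a 0; last by exfalso; apply: none; exists a, d, v.
  by rewrite a0 in Hv *; rewrite (odd_profile_zero e0 d0 e5 Hv) !mul0r mulr0.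
have mu00 : 0 < mu0 by lra.
exists mu0; split.
  apply/andP; split; last by rewrite /C; lra.
  rewrite -div1r ltr_pdivrMr; last lra.
  by rewrite /C; have := mulr_gt0 mu00 K0; lra.
move=> a b u Hu; have [kL [kR [HL HR]]] := solution_boundary e0 d0 Hu.
have Hv := solution_profile e0 d0 Hu HL HR.
pose A := `|a| + `|b|; have A0 : 0 <= A by rewrite addr_ge0.
pose M := 2 * (10 * 10 * 10 * K + 20 * 20 * 40).
exists (M * A), (M * A); split.
- move=> p Np; apply: (le_trans (vnorm_le _)) => /=.
  have [h1 h2] := horizontal_gap_grad e0 d0 e5 d5 Hu HL HR HK Np.
  by have := lerD h1 h2; rewrite -/A /M; lra.
- move=> p Np; apply: (le_trans (vnorm_le _)) => /=.
  have [h1 h2] := vertical_gap_grad e0 d0 e5 Hu HL HR HK Np.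
  by have := lerD h1 h2; rewrite (Hmu a _ _ Hv) -/A mulrA /M; lra.
- have : 0 <= K * A by rewrite mulr_ge0 // ltW.
  by rewrite -/A /C /M; lra.
Qed.
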